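(* For every $n\ge 3$, every connected non-homotopic $n$-vertex quasiplanar graph has at most $8n-20$ edges.
   Context: Graphs are finite and have no loops, but may have parallel edges. A drawing on the sphere $\mathbb{S}^2$ maps vertices to pairwise distinct points and each edge to a simple Jordan arc joining its endpoints, such that no edge passes through a vertex, any two edges have finitely many common points, every common interior point of two edges is a proper crossing, and no three edges pass through the same crossing. A drawing is quasiplanar if no three edges pairwise cross. A lens is a region bounded by a simple closed curve consisting of exactly two contiguous parts, each being (a part of) a single edge (e.g. two uncrossed parallel edges, parts of two adjacent edges that cross, or parts of two edges crossing more than once); a drawing is non-homotopic if every lens contains a vertex or a crossing in its interior. A non-homotopic quasiplanar graph is a graph admitting a drawing that is both non-homotopic and quasiplanar. *)

(* Defs.v *)
From HB Require Import structures.
From mathcomp Require Import all_boot all_order all_algebra.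
From mathcomp Require Import all_classical all_reals topology normedtype.
Set Implicit Arguments. Unset Strict Implicit. Unset Printing Implicit Defensive.
Import Order.TTheory GRing.Theory Num.Theory.
Import numFieldNormedType.Exports.
Local Open Scope classical_set_scope.
Local Open Scope ring_scope.

Notation pt R := ((R * R) * R)%type.

Definition sphere (R : realType) : set (pt R) :=
  [set p | p.1.1 ^+ 2 + p.1.2 ^+ 2 + p.2 ^+ 2 = 1].

Definition disk (R : realType) : set (R * R)%type :=
  [set q | q.1 ^+ 2 + q.2 ^+ 2 < 1].
Definition hdiam (R : realType) : set (R * R)%type :=
  [set q | q.2 = 0 /\ q.1 ^+ 2 < 1].
Definition vdiam (R : realType) : set (R * R)%type :=
  [set q | q.1 = 0 /\ q.2 ^+ 2 < 1].

Definition I01 (R : realType) : set R := [set t | 0 <= t <= 1].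
Definition I01o (R : realType) : set R := [set t | 0 < t < 1].
Definition Iab (R : realType) (a b : R) : set R := [set t | a <= t <= b].

Arguments sphere R : clear implicits.
Arguments disk R : clear implicits.
Arguments hdiam R : clear implicits.
Arguments vdiam R : clear implicits.
Arguments I01 R : clear implicits.
Arguments I01o R : clear implicits.

Definition homeo_onto (X Y : topologicalType) (A : set X) (B : set Y)
    (h : X -> Y) :=
  exists g : Y -> X,
    (forall x, A x -> B (h x)) /\ (forall y, B y -> A (g y)) /\
    (forall x, A x -> g (h x) = x) /\ (forall y, B y -> h (g y) = y) /\
    {within A, continuous h} /\ {within B, continuous g}.

(* A multigraph on vertex set 'I_n with edge set E : ends e = endpoints;
   loops are excluded by the hypothesis [loopless]. *)
Definition loopless (n : nat) (E : finType) (ends : E -> 'I_n * 'I_n) :=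
  forall e, (ends e).1 != (ends e).2.

Definition adjacent (n : nat) (E : finType) (ends : E -> 'I_n * 'I_n) :
    rel 'I_n :=
  fun u v => [exists e, (ends e == (u, v)) || (ends e == (v, u))].

Definition connected_graph (n : nat) (E : finType) (ends : E -> 'I_n * 'I_n) :=
  forall u v : 'I_n, connect (adjacent ends) u v.

Section Drawing.
Variables (R : realType) (n : nat) (E : finType) (ends : E -> 'I_n * 'I_n).
Variables (pos : 'I_n -> pt R) (arc : E -> R -> pt R).

Definition edge_img (e : E) : set (pt R) := arc e @` I01 R.

Definition edge_int (e : E) : set (pt R) := arc e @` I01o R.

Definition proper_crossing (e f : E) (p : pt R) :=
  exists U : set (pt R),
    [/\ open U, U p &
     exists h : pt R -> (R * R)%type,
       [/\ homeo_onto (U `&` sphere R) (disk R) h,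
           h p = (0, 0),
           h @` (U `&` edge_img e) = hdiam R &
           h @` (U `&` edge_img f) = vdiam R]].

Definition is_drawing :=
  (forall v, sphere R (pos v)) /\
  injective pos /\
  (forall e, arc e @` I01 R `<=` sphere R) /\
  (forall e, {within I01 R, continuous (arc e)}) /\
  (forall e s t, I01 R s -> I01 R t -> arc e s = arc e t -> s = t) /\
  (forall e, arc e 0 = pos (ends e).1 /\ arc e 1 = pos (ends e).2) /\
  (forall e v, ~ edge_int e (pos v)) /\
  (forall e f, e != f -> finite_set (edge_img e `&` edge_img f)) /\
  (forall e f p, e != f -> edge_int e p -> edge_int f p ->
     proper_crossing e f p) /\
  (forall e f g p, e != f -> f != g -> e != g ->
     ~ [/\ edge_int e p, edge_int f p & edge_int g p]).

Definition cross (e f : E) := e != f /\ exists p, edge_int e p /\ edge_int f p.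

Definition crossing_point (p : pt R) :=
  exists e f, e != f /\ edge_int e p /\ edge_int f p.

Definition quasiplanar_drawing :=
  forall e f g : E, ~ [/\ cross e f, cross f g & cross e g].

(* A simple closed curve made of exactly two contiguous parts, a part
   arc e [s1,s2] of edge e and a part arc f [t1,t2] of another edge f,
   which meet exactly in their common endpoints. *)
Definition lens_curve (C : set (pt R)) :=
  exists (e f : E) (s1 s2 t1 t2 : R),
    e != f /\ 0 <= s1 /\ s1 < s2 /\ s2 <= 1 /\
    0 <= t1 /\ t1 < t2 /\ t2 <= 1 /\
    ((arc e s1 = arc f t1 /\ arc e s2 = arc f t2) \/
     (arc e s1 = arc f t2 /\ arc e s2 = arc f t1)) /\
    arc e @` Iab s1 s2 `&` arc f @` Iab t1 t2 = [set arc e s1; arc e s2] /\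
    C = arc e @` Iab s1 s2 `|` arc f @` Iab t1 t2.

Definition lens (L : set (pt R)) :=
  exists C x, [/\ lens_curve C, (sphere R `\` C) x &
                  L = connected_component (sphere R `\` C) x].

Definition non_homotopic_drawing :=
  forall L, lens L -> exists p, L p /\ ((exists v, p = pos v) \/ crossing_point p).

End Drawing.

Definition nonhomotopic_quasiplanar (R : realType) (n : nat) (E : finType)
    (ends : E -> 'I_n * 'I_n) :=
  exists (pos : 'I_n -> pt R) (arc : E -> R -> pt R),
    [/\ is_drawing ends pos arc, quasiplanar_drawing arc &
        non_homotopic_drawing pos arc].

(* Main.v *)
(** The edges, cut at their crossings, are the segments of a plane graph once a
    point of the sphere off the drawing is sent to infinity.  Mod 2 winding
    numbers, computed on lattice approximations, provide a rotation system at
    its nodes and, for every even set of segments, a two-colouring of the darts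
    that is constant on faces, changes exactly across that set, and equals the
    winding number at every node off the set.  Counting the colourings gives
    Euler's inequality; comparing them with winding numbers shows that the two
    edges alternate around a crossing, and that a chain of faces enclosed
    between two parts of edges without any node inside is an empty lens.

    Give the charge 5k + 4v - 20 to a face with k corners, v of which are
    vertices; the total is at most 20n - 40 - 2|E|.  Only triangles with a
    single vertex are negative (-1): each receives 1 through a chain of
    quadrilaterals without vertices from the first other face.  That face is not
    again a one-vertex triangle, since two parallel edges would then bound
    an empty lens.  Every vertex can finally collect 4 from its faces, so
    4n <= 20n - 40 - 2|E|. *)
Require Import Defs.
From HB Require Import structures.
From mathcomp Require Import all_boot all_order all_algebra.
From mathcomp Require Import zify.
Set Implicit Arguments. Unset Strict Implicit. Unset Printing Implicit Defensive.

(** * Sums over lattice paths *)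

(** Edges are arbitrary arcs, so neither a cyclic order at a node nor a face as a region is at hand.
    A face is therefore only an orbit of [face_step], and what topology has to supply is, for every
    even set of segments, a colouring of the darts. A winding number is in turn the increment of a
    primitive of [chi] along the curve; additivity, invariance and the comparison with lattice paths
    then become cancellations modulo 2. Of the Jordan curve theorem, only this is proved for lenses:
    both winding numbers occur near the curve ([local_jordan]). If all nodes off a lens had one
    winding number, non-homotopy would spread it to all points.

    In the charge, k - 4 makes the crossings vanish from the total, since each has four corners: its
    sum over the faces is at most 4n - 8 minus the number of edge ends. Taken five times, with 4
    given back for each corner at a vertex, it still leaves -1 for each edge end. *)

Ltac bool_cases :=
  clear; repeat match goal with |- forall _ : bool, _ => let b := fresh "b" in intro b; destruct b end; done.

Section PathSum.
Variables (T : Type) (F : T -> T -> bool).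

Fixpoint psum (a : T) (l : seq T) : bool :=
  if l is b :: l' then F a b (+) psum b l' else false.

Lemma psum_cat a l1 l2 : psum a (l1 ++ l2) = psum a l1 (+) psum (last a l1) l2.
Proof. by elim: l1 a => //= b l IH a; rewrite IH addbA. Qed.

Lemma psum_telescope (g : T -> bool) a l :
  path (fun x y => F x y == g x (+) g y) a l -> psum a l = g a (+) g (last a l).
Proof.
elim: l a => [|b l IH] a /=; first by rewrite addbb.
by case/andP => /eqP -> /IH ->; rewrite addbA -(addbA (g a)) addbb addbF.
Qed.
End PathSum.

Lemma psumD (T : Type) (F G : T -> T -> bool) a l :
  psum F a l (+) psum G a l = psum (fun x y => F x y (+) G x y) a l.
Proof.
elim: l a => //= b l IH a; rewrite -IH.
by case: (F a b) (G a b) (psum F b l) (psum G b l) => [] [] [] [].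
Qed.

(** * Counting faces *)

Section Euler.
Variables (S P : finType).
Local Notation D := (S * bool)%type.
Definition alpha (d : D) : D := (d.1, ~~ d.2).

Lemma alphaK : involutive alpha.
Proof. by case=> s b; rewrite /alpha /= negbK. Qed.

Definition even_at (node : D -> P) (z : S -> bool) (p : P) :=
  \big[addb/false]_(d | node d == p) z d.1 = false.

Variables (node : D -> P) (phi : D -> D).
Hypothesis phi_inj : injective phi.
Hypothesis jordan : forall z : S -> bool, (forall p, even_at node z p) ->
  exists c : D -> bool, (forall d, c (phi d) = c d) /\
    (forall d, c d (+) c (alpha d) = z d.1).

Let cyc : {set {ffun S -> bool}} :=
  [set z : {ffun S -> bool} | [forall p, \big[addb/false]_(d | node d == p) z d.1 == false]].

(** The boundary modulo 2 of a set of segments has even size, so it is determined by its part off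
    [p0]. Each fibre of the boundary map is moved into [cyc] by adding one of its members. *)
Lemma card_cyc (p0 : P) : 2 ^ #|S| <= #|cyc| * 2 ^ #|P|.-1.
Proof.
pose bd (z : {ffun S -> bool}) : {ffun {p | p != p0} -> bool} :=
  [ffun p => \big[addb/false]_(d | node d == val p) z d.1].
have cP : #|{: {p | p != p0}}| = #|P|.-1.
  by rewrite card_sig; rewrite cardC1.
have sumall (z : {ffun S -> bool}) :
    \big[addb/false]_p \big[addb/false]_(d | node d == p) z d.1 = false.
  transitivity (\big[addb/false]_(d : D) z d.1); first by rewrite (partition_big node xpredT).
  transitivity (\big[addb/false]_(s : S) \big[addb/false]_(b : bool) z s).
    by rewrite pair_big /=; apply: eq_bigr => -[].
  by rewrite big1 // => s _; rewrite big_bool /= addbb.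
have ineq (y : {ffun {p | p != p0} -> bool}) : #|[set z | bd z == y]| <= #|cyc|.
  case: (set_0Vmem [set z | bd z == y]) => [->|[z0]]; first by rewrite cards0.
  rewrite inE => /eqP z0y.
  pose h (z : {ffun S -> bool}) : {ffun S -> bool} := [ffun s => z s (+) z0 s].
  have hinj : injective h.
    move=> z z' /ffunP e; apply/ffunP => s; have := e s; rewrite !ffunE.
    by move/addIb.
  rewrite -(card_imset _ hinj); apply: subset_leq_card; apply/subsetP => w.
  case/imsetP => z; rewrite inE => /eqP zy ->; rewrite inE.
  have off p : p != p0 -> \big[addb/false]_(d | node d == p) h z d.1 = false.
    move=> pp0.
    have : bd z (exist _ p pp0) = bd z0 (exist _ p pp0) by rewrite zy z0y.
    rewrite !ffunE /= => e.
    under eq_bigr do rewrite ffunE.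
    by rewrite big_split /= e addbb.
  apply/forallP => p; apply/eqP.
  case: (eqVneq p p0) => [->|]; last exact: off.
  have := sumall (h z); rewrite (bigD1 p0) //= [X in _ (+) X]big1 ?addbF //; exact: off.
have -> : 2 ^ #|S| = #|{: {ffun S -> bool}}| by rewrite card_ffun card_bool.
have -> : 2 ^ #|P|.-1 = #|{: {ffun {p | p != p0} -> bool}}|.
  by rewrite card_ffun card_bool cP.
rewrite -[leqLHS]sum1_card (partition_big bd xpredT) //=.
apply: leq_trans (_ : \sum_(y : {ffun {p | p != p0} -> bool}) #|cyc| <= _); last first.
  by rewrite sum_nat_const mulnC.
apply: leq_sum => y _.
have -> : \sum_(i | bd i == y) 1 = #|[set z | bd z == y]|.
  by rewrite -sum1_card; apply: eq_bigl => z; rewrite inE.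
exact: ineq.
Qed.

(** An even set and a bit give a colouring of the faces, the bit choosing between two complementary
    ones. Both can be read off: the set from the changes across segments, then the bit at [d0].
    Hence [cyc] has at most half as many elements as there are colourings. *)
Lemma euler_ineq (p0 : P) (d0 : D) : #|S| + 2 <= fcard phi predT + #|P|.
Proof.
pose ok (z : {ffun S -> bool}) (c : {ffun D -> bool}) :=
  [forall d, c (phi d) == c d] && [forall d, c d (+) c (alpha d) == z d.1].
pose C (z : {ffun S -> bool}) := odflt [ffun=> false] [pick c | ok z c].
have CP z : z \in cyc -> ok z (C z).
  rewrite inE => /forallP evz; rewrite /C; case: pickP => //= no.
  have [p|c [c1 c2]] := @jordan z; first exact/eqP.
  have := no [ffun d => c d]; rewrite /ok; move/negbT/negP; case; apply/andP.
  by split; apply/forallP => d; rewrite !ffunE ?c1 ?c2.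
pose F := {d | froots phi d}.
pose G (x : {ffun S -> bool} * bool) : {ffun F -> bool} :=
  [ffun f => C x.1 (val f) (+) x.2].
have rootP d : froots phi (froot phi d) by apply: roots_root; apply: fconnect_sym.
have Croot z d : z \in cyc -> C z (froot phi d) = C z d.
  move=> /CP /andP[/forallP cphi _].
  have : fconnect phi d (froot phi d) by apply: connect_root.
  move/iter_findex => <-; elim: (findex _ _ _) => //= k IH.
  by rewrite (eqP (cphi _)).
have Ginj : {in [predX cyc & predT] &, injective G}.
  move=> [z b] [z' b'] zc0 zc0' /ffunP e.
  have zc : z \in cyc by case/andP: zc0.
  have zc' : z' \in cyc by case/andP: zc0'.
  have e' d : C z d (+) b = C z' d (+) b'.
    have := e (exist _ (froot phi d) (rootP d)); rewrite !ffunE /=.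
    by rewrite !Croot.
  have zz : z = z'.
    apply/ffunP => s.
    have /andP[_ /forallP /(_ (s, true)) /eqP /= <-] := CP _ zc.
    have /andP[_ /forallP /(_ (s, true)) /eqP /= <-] := CP _ zc'.
    have := e' (s, true); have := e' (alpha (s, true)).
    by do 4! (case: (fun_of_fin (C _) _)); case: (b); case: (b').
  by move: (e' d0); rewrite zz => /addbI ->.
have := leq_card_in _ _ Ginj.
rewrite cardX [in X in X <= _]card_bool card_ffun card_bool.
have -> : #|{: F}| = fcard phi predT.
  by rewrite card_sig; apply: eq_card => d; rewrite !inE andbT.
move=> le1; have le2 := card_cyc p0.
have P0 : 0 < #|P| by apply/card_gt0P; exists p0.
have : 2 ^ (#|S| + 1) <= 2 ^ (fcard phi predT + #|P|.-1).
  rewrite !expnD expn1; apply: leq_trans (leq_mul le1 (leqnn _)).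
  by rewrite mulnAC leq_mul2r le2.
rewrite leq_exp2l //; lia.
Qed.
End Euler.

(** * Discharging *)

Section Discharging.
Variables (n : nat) (S X E : finType) (ends : E -> 'I_n * 'I_n).
Local Notation D := (S * bool)%type.
Local Notation P := ('I_n + X)%type.
Variables (lab : S -> E) (node : D -> P) (rho : D -> D) (rk : D -> nat).

Definition is_crossing (p : P) := if p is inr _ then true else false.
Local Notation cr d := (is_crossing (node d)).
Local Notation V d := (~~ is_crossing (node d)).
Local Notation al := (@alpha S).
Definition face_step (d : D) : D := rho (al d).
Local Notation phi := face_step.
Local Notation fsz d := (order phi d).
(** At a crossing, which has four darts, this is the dart opposite to [al d]: the edge of [d]
    continues along it. *)
Definition straight (d : D) : D := rho (rho (al d)).

Hypothesis rho_inj : injective rho.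
Hypothesis node_rho : forall d, node (rho d) = node d.
Hypothesis node_orb : forall d d', node d = node d' -> fconnect rho d d'.
Hypothesis node_al : forall d, node (al d) != node d.
Hypothesis cr_rho4 : forall d, cr d -> rho (rho (rho (rho d))) = d.
Hypothesis cr_lab2 : forall d, cr d -> lab (rho (rho d)).1 = lab d.1.
Hypothesis cr_dir2 : forall d, cr d -> (rho (rho d)).2 = ~~ d.2.
Hypothesis cr_lab1 : forall d, cr d -> lab (rho d).1 != lab d.1.
Hypothesis rk_inj : forall d d', lab d.1 = lab d'.1 -> d.2 = d'.2 ->
  rk d = rk d' -> d = d'.
Hypothesis rk_straight : forall d, cr (al d) -> rk (straight d) = (rk d).+1.
Hypothesis rk0 : forall d, cr d = (rk d != 0).
Hypothesis rk_max : forall d d', V (al d) -> lab d'.1 = lab d.1 ->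
  d'.2 = d.2 -> rk d' <= rk d.
Hypothesis node_ends : forall d v, node d = inl v ->
  v = if d.2 then (ends (lab d.1)).1 else (ends (lab d.1)).2.
Hypothesis no_loop : forall e, (ends e).1 != (ends e).2.
Hypothesis conn : forall a : P -> bool, (forall d, a (node d) = a (node (al d))) ->
  forall p q, a p = a q.
Hypothesis has_dart : forall p, exists d, node d = p.
Hypothesis n_ge3 : 3 <= n.

Definition lab_cross (e f : E) := exists d, [/\ cr d, lab d.1 = e & lab (rho d).1 = f].
Hypothesis quasi : forall e f g, lab_cross e f -> lab_cross f g -> lab_cross e g -> False.

(** The predicate [q] marks the faces on one side of the closed curve formed by the two segments; by
    the last premise no node lies strictly on that side. *)
Hypothesis digon_lens : forall (d d' : D) (q : D -> bool), d.1 != d'.1 ->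
  node d' = node (al d) -> node (al d') = node d ->
  (forall x, q (phi x) = q x) ->
  (forall x, q x (+) q (al x) = (x.1 == d.1) (+) (x.1 == d'.1)) ->
  (forall x, q x -> node x = node d \/ node x = node (al d)) -> False.

Hypothesis edge_lens : forall (e f : E) (q : D -> bool), e != f ->
  (ends e = ends f \/ ends e = ((ends f).2, (ends f).1)) ->
  (forall d, cr d -> lab d.1 = e -> lab (rho d).1 <> f) ->
  (forall x, q (phi x) = q x) ->
  (forall x, q x (+) q (al x) = (lab x.1 == e) (+) (lab x.1 == f)) ->
  (forall x, q x -> exists y, node y = node x /\ (lab y.1 = e \/ lab y.1 = f)) ->
  False.

Lemma al_inj : injective al. Proof. exact: inv_inj (@alphaK S). Qed.

Lemma node_phi d : node (phi d) = node (al d).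
Proof. by rewrite /phi node_rho. Qed.

Lemma phi_al d : phi (al d) = rho d.
Proof. by rewrite /phi alphaK. Qed.

Lemma phi_inj : injective phi.
Proof. by move=> x y /rho_inj /al_inj. Qed.

Lemma straightP d : cr (al d) ->
  [/\ lab (straight d).1 = lab d.1, (straight d).2 = d.2 & rk (straight d) = (rk d).+1].
Proof.
move=> c; split; [by rewrite cr_lab2| by rewrite cr_dir2 //= negbK| exact: rk_straight].
Qed.

Lemma fsz_phi d : fsz (phi d) = fsz d.
Proof. by apply: eq_card => x; rewrite !inE -(same_fconnect1 phi_inj). Qed.

Lemma fszE d k : fsz d = k -> iter k phi d = d.
Proof. by move=> <-; apply: iter_order; apply: phi_inj. Qed.

Lemma orbit_phi_sum (F : D -> nat) r : froots phi r ->
  \sum_(d | froot phi d == r) F d = \sum_(d <- orbit phi r) F d.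
Proof.
move=> rr; rewrite big_uniq ?orbit_uniq //; apply: eq_bigl => d.
rewrite -fconnect_orbit -root_connect; last exact: fconnect_sym phi_inj.
by rewrite eq_sym; move/eqP: rr => ->.
Qed.

Lemma face_sum (F G : D -> nat) (c : nat) :
  (forall r, froots phi r -> \sum_(d <- orbit phi r) F d + c <= \sum_(d <- orbit phi r) G d) ->
  \sum_d F d + c * fcard phi predT <= \sum_d G d.
Proof.
move=> H; have rootP d : froots phi (froot phi d).
  by apply: roots_root; apply: fconnect_sym; apply: phi_inj.
rewrite [X in X + _](partition_big (froot phi) (froots phi)) => [|d _]; last exact: rootP.
rewrite [X in _ <= X](partition_big (froot phi) (froots phi)) => [|d _]; last exact: rootP.
have -> : c * fcard phi predT = \sum_(r | froots phi r) c.
  rewrite sum_nat_const mulnC; congr (_ * _); apply: eq_card => d.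
  by rewrite !inE andbT.
rewrite -big_split /=; apply: leq_sum => r rr.
by rewrite !orbit_phi_sum //; apply: H.
Qed.

(** A face of size 1 would be a segment with equal ends. In a face of size 2, either two segments
    bound an empty digon, or one segment is followed in both directions: its ends then have no other
    dart, and connectedness leaves only two nodes. *)
Lemma fsz_ge3 d : 2 < fsz d.
Proof.
have := order_gt0 phi d; case e: (fsz d) => [|[|[|k]]] // _.
  have /= := fszE e => e1.
  by have := node_al d; rewrite -node_phi e1 eqxx.
have /= e2 := fszE e.
have [same|dif] := eqVneq (phi d).1 d.1; last first.
  exfalso; apply: (@digon_lens d (phi d) (fun x => (x == d) (+) (x == phi d))).
  - by rewrite eq_sym.
  - exact: node_phi.
  - by rewrite -node_phi e2.
  - move=> x; rewrite (inj_eq phi_inj) -{1}e2 (inj_eq phi_inj).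
    by rewrite addbC.
  - have K (x y : D) : (x == y) (+) (al x == y) = (x.1 == y.1).
      case: x y => [s b] [t c]; rewrite /alpha !xpair_eqE /=.
      by case: (s == t) b c => [] [] [].
    move=> x; rewrite -(K x d) -(K x (phi d)).
    by rewrite !addbA; congr (_ (+) _); rewrite -!addbA; congr (_ (+) _); rewrite addbC.
  - move=> x; have [-> _|_] := eqVneq x d; first by left.
    by have [-> _|//] := eqVneq x (phi d); right; rewrite node_phi.
exfalso.
have pd : phi d = al d.
  have : phi d != d.
    by apply/eqP => pd; have := node_al d; rewrite -node_phi pd eqxx.
  move: same; case: (phi d) => s b; case: (d) => t c /= ->.
  by rewrite /alpha xpair_eqE eqxx /=; case: b c => [] [].
have r1 : rho (al d) = al d by [].
have r2 : rho d = d by rewrite -phi_al -pd.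
have Vd : V d by apply/negP => /cr_lab1; rewrite r2 eqxx.
have Vad : V (al d) by apply/negP => /cr_lab1; rewrite r1 eqxx.
have fixorb x y : rho x = x -> node x = node y -> y = x.
  move=> rx /node_orb /iter_findex <-.
  by elim: (findex _ _ _) => //= i ->.
pose a p := (p == node d) || (p == node (al d)).
have aP x : a (node x) -> a (node (al x)).
  case/orP => /eqP /esym h.
    by rewrite (fixorb _ _ r2 h) /a eqxx orbT.
  by rewrite (fixorb _ _ r1 h) alphaK /a eqxx.
have aE p : a p.
  rewrite (@conn a _ p (node d)); first by rewrite /a eqxx.
  by move=> x; apply/idP/idP => /aP //; rewrite alphaK.
have : #|'I_n| <= #|[:: node d; node (al d)]|.
  rewrite -(card_imset _ (@inl_inj 'I_n X)); apply: subset_leq_card.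
  apply/subsetP => p _; have := aE p; rewrite !inE; exact.
rewrite card_ord => /leq_trans /(_ (card_size _)) /=; lia.
Qed.

Lemma corner3 d : fsz (rho d) = 3 -> phi (phi (rho d)) = al d.
Proof.
rewrite -phi_al fsz_phi => /fszE /=.
by move=> e; rewrite e.
Qed.

Lemma corner4 d : fsz (rho d) = 4 -> phi (phi (phi (rho d))) = al d.
Proof.
rewrite -phi_al fsz_phi => /fszE /=.
by move=> e; rewrite e.
Qed.

(** The sides of a triangle with three crossings as corners would lie on three pairwise crossing
    edges. *)
Lemma tri_has_vertex d : fsz d = 3 -> [|| V d, V (phi d) | V (phi (phi d))].
Proof.
move=> /fszE /= e; apply/negPn/negP; rewrite !negb_or !negbK => /and3P[c0 c1 c2].
have step x : cr x -> cr (phi x) -> lab_cross (lab x.1) (lab (phi x).1).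
  by move=> _; rewrite node_phi => c; exists (al x).
have step' x : cr x -> cr (phi x) -> lab_cross (lab (phi x).1) (lab x.1).
  rewrite node_phi => cx c; exists (phi x); split; rewrite ?node_phi //.
  by rewrite /phi cr_lab2.
apply: (quasi (step _ c0 c1) (step _ c1 c2)).
by have := step' _ c2; rewrite e; apply.
Qed.

(* Six times the charge that the face of [d] gives to its corner [d]. *)
Definition weight (d : D) : nat :=
  let a := V (phi d) in let b := V (phi (phi d)) in let c := V (phi (phi (phi d))) in
  if fsz d == 3 then (if a && b then 14 else if a || b then 9 else 0)
  else if fsz d == 4 then
    (if [|| a && b, b && c | a && c] then 24 else if a || c then 21
     else if b then 24 else 12)
  else 24.

Definition tri1 (d : D) := [&& fsz d == 3, V d, cr (phi d) & cr (phi (phi d))].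
Definition quad0 (d : D) :=
  [&& fsz d == 4, cr d, cr (phi d), cr (phi (phi d)) & cr (phi (phi (phi d)))].

Lemma quad0_phi d : quad0 (phi d) = quad0 d.
Proof.
rewrite /quad0 fsz_phi; case: eqP => //= /fszE /= ->.
by do 4! case: (is_crossing _).
Qed.

(** If the face on the other side of [d] is a quadrilateral, this is its side opposite to [d]. *)
Definition across (d : D) := phi (phi (al d)).

Lemma across_inj : injective across.
Proof. by move=> x y /phi_inj /phi_inj /al_inj. Qed.

Lemma quad0_across d : quad0 (across d) = quad0 (al d).
Proof. by rewrite /across !quad0_phi. Qed.

Lemma tri1_nquad d : tri1 d -> ~~ quad0 (phi d).
Proof. by case/and4P => /eqP e _ _ _; rewrite quad0_phi /quad0 e. Qed.

(** As [across] is injective, a chain through quadrilaterals without vertices only would return to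
    its first side, which belongs to a triangle. *)
Lemma chain_ends d : tri1 d -> exists k, ~~ quad0 (al (iter k across (phi d))).
Proof.
move=> t; case: (pickP (fun k : 'I_(order across (phi d)) =>
    ~~ quad0 (al (iter k across (phi d))))) => [k h|h]; first by exists k.
have o := orderSpred across (phi d).
have lt : (order across (phi d)).-1 < order across (phi d) by lia.
have := h (Ordinal lt) => /negbFE /=.
rewrite -quad0_across -iterS o (iter_order across_inj).
by rewrite (negbTE (tri1_nquad t)).
Qed.

(* The side through which the charge for the triangle of [d] leaves its giver. *)
Definition receiver (d : D) : D :=
  if tri1 d =P true is ReflectT t then al (iter (ex_minn (chain_ends t)) across (phi d)) else d.

Lemma receiverP d : tri1 d -> exists k,
  [/\ receiver d = al (iter k across (phi d)), ~~ quad0 (al (iter k across (phi d))) &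
      forall i, i < k -> quad0 (al (iter i across (phi d)))].
Proof.
move=> t; rewrite /receiver; case: eqP => // t'.
case: ex_minnP => k kP kmin; exists k; split=> // i ik.
by apply/negPn/negP => /kmin; lia.
Qed.

(** A chain is determined backwards by its end. If two chains had the same end, the shorter would be
    a tail of the longer, and its triangle would be one of the quadrilaterals passed on the way. *)
Lemma receiver_inj : {in tri1 &, injective receiver}.
Proof.
move=> d d' t t'; have [k [-> _ kq]] := receiverP t; have [k' [-> _ kq']] := receiverP t'.
move/al_inj.
wlog le : d d' k k' t t' kq kq' / k <= k' => [W|].
  case: (leqP k k') => [le|/ltnW le]; first exact: W.
  by move/esym => e; apply/esym; apply: (W d' d k' k).
have -> : k' = k + (k' - k) by lia.
have itI : injective (iter k across).
  by elim: (k) => //= i IHi x y /across_inj /IHi.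
rewrite iterD => /itI e.
case: (k' - k) (leq_subr k k') e => [|m] le2; first exact: phi_inj.
rewrite iterS => e.
have := tri1_nquad t; rewrite e quad0_across kq' //; lia.
Qed.

Lemma cr_quad0 d : quad0 d -> cr d /\ cr (phi d).
Proof. by case/and5P. Qed.

Lemma chain_cr d k : tri1 d -> (forall i, i < k -> quad0 (al (iter i across (phi d)))) ->
  cr (iter k across (phi d)) /\ cr (al (iter k across (phi d))).
Proof.
move=> t; case: k => [|k] kq.
  by case/and4P: t => _ _ c1 c2; split=> //; rewrite -node_phi.
have := kq _ (ltnSn k); rewrite -quad0_across iterS => /cr_quad0[c1 c2].
by split=> //; rewrite -node_phi.
Qed.

(** * Chains of quadrilaterals between two triangles *)

Section Chain.
Variables (d : D) (k : nat).
Hypothesis td : tri1 d.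
Hypothesis chain_quad : forall i, i < k -> quad0 (al (iter i across (phi d))).
Local Notation e i := (iter i across (phi d)).
Hypothesis last_tri : fsz (al (e k)) = 3.
Hypothesis last_V : V (phi (phi (al (e k)))).

(** The two edges leaving the vertex of the triangle, followed segment by segment; the sides [e i]
    are the rungs between them. *)
Let lft i := iter i straight d.
Let rgt i := iter i straight (al (phi (phi d))).

Lemma chain_cre i : i <= k -> cr (e i) /\ cr (al (e i)).
Proof. by move=> ik; apply: chain_cr => // j ji; apply: chain_quad; lia. Qed.

Lemma phi3_start : phi (phi (phi d)) = d.
Proof. by case/and4P: td => /eqP /fszE. Qed.

Lemma lft_step i : i <= k -> phi (lft i) = e i.
Proof.
elim: i => [//|i IH] ik; have li := IH (ltnW ik).
have [c c'] := chain_cre (ltnW ik).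
rewrite /lft iterS -/(lft i) {1}/straight.
rewrite -/(phi (lft i)) li iterS /across -(phi_al (e i)); congr phi.
Qed.

Lemma lft_phi i : i <= k -> lft i.+1 = phi (al (e i)).
Proof. by move=> ik; rewrite /lft iterS -/(lft i) /straight -/(phi (lft i)) lft_step // phi_al. Qed.

Lemma rgt_step i : i <= k -> phi (e i) = al (rgt i).
Proof.
elim: i => [|i IH] ik; first by rewrite /rgt /= alphaK.
have ri := IH (ltnW ik).
have [c c'] := chain_cre (ltnW ik).
have q : quad0 (al (e i)) by apply: chain_quad.
have [/eqP /fszE /= q4 _ _ _ _] := and5P q.
apply: al_inj; rewrite alphaK /straight -ri.
apply: rho_inj; rewrite -/(phi (phi (e i.+1))) iterS /across q4.
by rewrite /phi cr_rho4.
Qed.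

Lemma rgt_rho i : i <= k -> rho (rgt i.+1) = al (e i).
Proof.
move=> ik; have [c c'] := chain_cre ik.
by rewrite /rgt iterS -/(rgt i) /straight -rgt_step // /phi cr_rho4.
Qed.

Lemma lft_cr i : i <= k -> cr (al (lft i)).
Proof. by move=> ik; rewrite -node_phi lft_step //; case: (chain_cre ik). Qed.

Lemma rgt_cr i : i <= k -> cr (al (rgt i)).
Proof. by move=> ik; rewrite -rgt_step // node_phi; case: (chain_cre ik). Qed.

Lemma d_rk : rk d = 0.
Proof. by apply/eqP; case/and4P: td => _; rewrite rk0 negbK. Qed.

Lemma rgt0_rho : rho (rgt 0) = d.
Proof. by rewrite /rgt /= -/(phi (phi (phi d))) phi3_start. Qed.

Lemma node_rgt0 : node (rgt 0) = node d.
Proof. by rewrite -(node_rho (rgt 0)) rgt0_rho. Qed.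

Lemma rgt0_rk : rk (rgt 0) = 0.
Proof. by apply/eqP; rewrite -[_ == _]negbK -rk0 node_rgt0 rk0 d_rk. Qed.

Lemma lftP i : i <= k.+1 -> [/\ lab (lft i).1 = lab d.1, (lft i).2 = d.2 & rk (lft i) = i].
Proof.
elim: i => [|i IH] ik; first by split=> //; exact: d_rk.
have [l1 l2 l3] := IH (ltnW ik); have := straightP (lft_cr ik).
by rewrite -iterS l1 l2 l3.
Qed.

Lemma rgtP i : i <= k.+1 ->
  [/\ lab (rgt i).1 = lab (rgt 0).1, (rgt i).2 = (rgt 0).2 & rk (rgt i) = i].
Proof.
elim: i => [|i IH] ik; first by split=> //; exact: rgt0_rk.
have [l1 l2 l3] := IH (ltnW ik); have := straightP (rgt_cr ik).
by rewrite -iterS l1 l2 l3.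
Qed.

Lemma last_step : phi (lft k.+1) = al (rgt k.+1).
Proof.
rewrite lft_phi //; apply: phi_inj; have /= -> := fszE last_tri.
by rewrite phi_al rgt_rho.
Qed.

Lemma lft_last : V (al (lft k.+1)).
Proof. by rewrite -node_phi lft_phi. Qed.

Lemma node_last : node (al (rgt k.+1)) = node (al (lft k.+1)).
Proof. by rewrite -last_step node_phi. Qed.

(** On one edge, equal directions would make the two darts equal, both having rank 0, and a side of
    the triangle would have equal ends; opposite directions would make the edge a loop. *)
Lemma chain_dir : lab d.1 = lab (rgt 0).1 -> False.
Proof.
move=> ll; have [dd|dd] := eqVneq d.2 (rgt 0).2.
  have : d = rgt 0 by apply: rk_inj => //; rewrite d_rk rgt0_rk.
  move=> dr; have := node_al (phi d).
  by rewrite -node_phi (node_phi d) {2}dr /rgt /= alphaK eqxx.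
have Vd : V d by case/and4P: td.
case nd: (node d) Vd => [v|x] // _.
have := node_ends nd; have := node_ends (etrans node_rgt0 nd).
rewrite -ll; have -> : (rgt 0).2 = ~~ d.2 by move: dd; case: (d.2); case: (rgt 0).2.
by have := no_loop (lab d.1); case: (d.2) => /= /eqP h -> // /esym.
Qed.

Lemma chain_ends_eq : ends (lab d.1) = ends (lab (rgt 0).1) \/
  ends (lab d.1) = ((ends (lab (rgt 0).1)).2, (ends (lab (rgt 0).1)).1).
Proof.
have Vd : V d by case/and4P: td.
have [l1 l2 _] := lftP (leqnn _); have [r1 r2 _] := rgtP (leqnn _).
case nd: (node d) Vd => [v|x] // _.
case nl: (node (al (lft k.+1))) lft_last => [w|x] // _.
have h1 := node_ends nd; have h2 := node_ends (etrans node_rgt0 nd).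
have h3 := node_ends nl; have h4 := node_ends (etrans node_last nl).
clearbody lft rgt; move: h1 h2 h3 h4; rewrite /= l1 l2 r1 r2.
case: (ends _) (ends _) => a b [a' b'] /=.
by case: (d.2); case: (rgt 0).2 => /= <- <- <- <-; [left|right|right|left].
Qed.

(** The segment [lft k.+1] ends at a vertex, so no dart of this direction on the edge has rank above
    k + 1: all of them have been met. *)
Lemma lft_mem y : lab y.1 = lab d.1 -> y.2 = d.2 -> exists2 i, i <= k.+1 & y = lft i.
Proof.
have [l1 l2 l3] := lftP (leqnn k.+1).
move=> h1 h2; have le := rk_max lft_last (etrans h1 (esym l1)) (etrans h2 (esym l2)).
rewrite l3 in le; exists (rk y) => //.
by have [m1 m2 m3] := lftP le; apply: rk_inj; rewrite ?m1 ?m2 ?m3.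
Qed.

Lemma rgt_mem y : lab y.1 = lab (rgt 0).1 -> y.2 = (rgt 0).2 -> exists2 i, i <= k.+1 & y = rgt i.
Proof.
have [l1 l2 l3] := rgtP (leqnn k.+1).
have Vl : V (al (rgt k.+1)) by rewrite node_last lft_last.
move=> h1 h2; have le := rk_max Vl (etrans h1 (esym l1)) (etrans h2 (esym l2)).
rewrite l3 in le; exists (rk y) => //.
by have [m1 m2 m3] := rgtP le; apply: rk_inj; rewrite ?m1 ?m2 ?m3.
Qed.

(** An edge that crosses the left side carries a rung, and that rung meets the right side at a
    crossing as well, so it does not lie on the right edge. *)
Lemma chain_nocross x : cr x -> lab x.1 = lab d.1 -> lab (rho x).1 <> lab (rgt 0).1.
Proof.
have H y : cr y -> lab y.1 = lab d.1 -> y.2 = d.2 -> lab (rho y).1 <> lab (rgt 0).1.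
  move=> cy l1 l2; have [i ik yl] := lft_mem l1 l2.
  have : i != 0 by have [_ _ r] := lftP ik; move: cy; rewrite rk0 yl r.
  case: i ik yl => // i ik yl _.
  have [c c'] := chain_cre ik.
  have ye : y = rho (e i) by rewrite yl lft_phi // phi_al.
  rewrite ye cr_lab2 //.
  have [r1 _ _] := rgtP (ltnW ik); rewrite -r1.
  have -> : lab (rgt i).1 = lab (rho (al (e i))).1 by rewrite -/(phi (e i)) rgt_step.
  by move=> h; move: (cr_lab1 c'); rewrite -h eqxx.
move=> cx l1; have [dx|dx] := eqVneq x.2 d.2; first exact: H.
have c2 : cr (rho (rho x)) by rewrite !node_rho.
have := H _ c2; rewrite cr_lab2 // cr_dir2 // => /(_ l1).
rewrite cr_lab2 ?node_rho //; apply.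
by move: dx; case: (x.2); case: (d.2).
Qed.

(** The faces of the chain, both end triangles included. A sum modulo 2 in place of a union
    dispenses with proving that they are distinct. *)
Let q (x : D) := \big[addb/false]_(i < k.+2) (x \in orbit phi (lft i)).

Lemma phi_orbit x y : (phi x \in orbit phi y) = (x \in orbit phi y).
Proof.
rewrite -!fconnect_orbit (fconnect_sym phi_inj) -(same_fconnect1 phi_inj).
by rewrite (fconnect_sym phi_inj).
Qed.

Lemma chain_q_phi x : q (phi x) = q x.
Proof. by apply: eq_bigr => i _; rewrite phi_orbit. Qed.

Lemma xor_pair (x y : D) : (x == y) (+) (al x == y) = (x.1 == y.1).
Proof.
case: x y => [s b] [t c]; rewrite /alpha !xpair_eqE /=.
by case: (s == t) b c => [] [] [].
Qed.

Lemma orbit_xor3 x y : fsz y = 3 ->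
  (x \in orbit phi y) = (x == y) (+) (x == phi y) (+) (x == phi (phi y)).
Proof.
move=> h; have := orbit_uniq phi y; rewrite /orbit h /= !inE andbT negb_or.
case/andP => /andP[/negPf n1 /negPf n2] /negPf n3.
case: eqVneq => [->|_]; first by rewrite n1 n2.
by case: eqVneq => [->|_]; rewrite ?n3.
Qed.

Lemma orbit_xor4 x y : fsz y = 4 ->
  (x \in orbit phi y) = (x == y) (+) (x == phi y) (+) (x == phi (phi y)) (+) (x == phi (phi (phi y))).
Proof.
move=> h; have := orbit_uniq phi y; rewrite /orbit h /= !inE andbT !negb_or.
case/and3P => /and3P[/negPf n1 /negPf n2 /negPf n3] /andP[/negPf n4 /negPf n5] /negPf n6.
case: eqVneq => [->|_]; first by rewrite n1 n2 n3.
case: eqVneq => [->|_]; first by rewrite n4 n5.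
by case: eqVneq => [->|_]; rewrite ?n6.
Qed.

Lemma jump3 x y : fsz y = 3 -> (x \in orbit phi y) (+) (al x \in orbit phi y) =
  (x.1 == y.1) (+) (x.1 == (phi y).1) (+) (x.1 == (phi (phi y)).1).
Proof.
move=> h; rewrite !orbit_xor3 // -!xor_pair.
by do 6! case: (_ == _).
Qed.

Lemma jump4 x y : fsz y = 4 -> (x \in orbit phi y) (+) (al x \in orbit phi y) =
  (x.1 == y.1) (+) (x.1 == (phi y).1) (+) (x.1 == (phi (phi y)).1) (+) (x.1 == (phi (phi (phi y))).1).
Proof.
move=> h; rewrite !orbit_xor4 // -!xor_pair.
by do 8! case: (_ == _).
Qed.

(** A rung between two consecutive faces is counted twice and cancels; after the first j + 1 faces
    only the two sides and the last rung remain. *)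
Lemma chain_partial x j : j <= k ->
  \big[addb/false]_(i < j.+1) ((x \in orbit phi (lft i)) (+) (al x \in orbit phi (lft i))) =
  \big[addb/false]_(i < j.+1) ((x.1 == (lft i).1) (+) (x.1 == (rgt i).1)) (+) (x.1 == (e j).1).
Proof.
elim: j => [|j IH] jk.
  rewrite !big_ord_recl !big_ord0 /= !addbF jump3; last by case/and4P: td => /eqP.
  by rewrite /rgt /=; do 3! case: (_ == _).
rewrite big_ord_recr [in RHS]big_ord_recr /= IH ?(ltnW jk) //.
have q4 : quad0 (al (e j)) by apply: chain_quad.
have f4 : fsz (lft j.+1) = 4.
  by rewrite lft_phi ?(ltnW jk) // fsz_phi; case/and5P: q4 => /eqP.
rewrite -[straight (lft j)]/(lft j.+1) -[straight (rgt j)]/(rgt j.+1) -[across (e j)]/(e j.+1).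
rewrite jump4 // lft_step // rgt_step //.
have -> : phi (al (rgt j.+1)) = al (e j) by rewrite phi_al rgt_rho // ltnW.
rewrite /alpha /=.
move: (\big[_/_]_(_ < _) _) => b.
by case: b; do 4! case: (_ == _).
Qed.

Lemma chain_q_jump x : q x (+) q (al x) = (lab x.1 == lab d.1) (+) (lab x.1 == lab (rgt 0).1).
Proof.
rewrite /q -big_split /= big_ord_recr /= chain_partial // -[straight (lft k)]/(lft k.+1) jump3; last first.
  by rewrite lft_phi // fsz_phi.
rewrite last_step phi_al rgt_rho //.
transitivity (\big[addb/false]_(i < k.+2) ((x.1 == (lft i).1) (+) (x.1 == (rgt i).1))).
  rewrite [RHS]big_ord_recr /= /alpha /=.
  by move: (\big[_/_]_(_ < _) _) => b; case: b; do 3! case: (_ == _).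
rewrite big_split /=.
have H (g : nat -> D) (l : E) (b : bool) :
    (forall i, i <= k.+1 -> [/\ lab (g i).1 = l, (g i).2 = b & rk (g i) = i]) ->
    (forall y, lab y.1 = l -> y.2 = b -> exists2 i, i <= k.+1 & y = g i) ->
    \big[addb/false]_(i < k.+2) (x.1 == (g i).1) = (lab x.1 == l).
  move=> gP gm; have [lx|lx] := eqVneq (lab x.1) l; last first.
    apply: big1 => i _; apply/negP => /eqP xg.
    have [gl _ _] := gP i (ltn_ord i); by rewrite xg gl eqxx in lx.
  have [i ik xi] := gm (x.1, b) lx (erefl _).
  have ik' : i < k.+2 by [].
  rewrite (bigD1 (Ordinal ik')) //= -xi /= eqxx big1 // => j ji.
  apply/negP => /eqP xj; case/negP: ji; apply/eqP/val_inj => /=.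
  have [_ gb r1] := gP j (ltn_ord j); have [_ _ r2] := gP i ik.
  by rewrite -r1 -[RHS]r2 -xi; congr rk; case: (g j) gb xj => ? ? /= -> ->.
congr (_ (+) _); first by apply: (H lft _ d.2 lftP lft_mem).
exact: (H rgt _ (rgt 0).2 rgtP rgt_mem).
Qed.

Lemma chain_q_node x : q x -> exists y, node y = node x /\
  (lab y.1 = lab d.1 \/ lab y.1 = lab (rgt 0).1).
Proof.
move=> qx.
have [i ik xi] : exists2 i, i <= k.+1 & x \in orbit phi (lft i).
  have [/existsP[i xi]|] := boolP [exists i : 'I_k.+2, x \in orbit phi (lft i)].
    by exists i => //; rewrite -ltnS.
  rewrite negb_exists => /forallP no; move: qx; rewrite /q big1 // => i _.
  exact/negbTE/no.
have [l1 l2 l3] := lftP ik; have [r1 r2 r3] := rgtP ik.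
have case_l : x = lft i -> exists y, node y = node x /\
    (lab y.1 = lab d.1 \/ lab y.1 = lab (rgt 0).1).
  by move=> ->; exists (lft i); split=> //; left.
have case_pl : x = phi (lft i) -> exists y, node y = node x /\
    (lab y.1 = lab d.1 \/ lab y.1 = lab (rgt 0).1).
  by move=> ->; exists (al (lft i)); rewrite node_phi; split=> //; left.
have case_r : x = al (rgt i) -> exists y, node y = node x /\
    (lab y.1 = lab d.1 \/ lab y.1 = lab (rgt 0).1).
  by move=> ->; exists (al (rgt i)); split=> //; right.
have case_rr : x = rho (rgt i) -> exists y, node y = node x /\
    (lab y.1 = lab d.1 \/ lab y.1 = lab (rgt 0).1).
  by move=> ->; exists (rgt i); rewrite node_rho; split=> //; right.
case: i ik xi l1 l2 l3 r1 r2 r3 case_l case_pl case_r case_rr => [|i] ik xi _ _ _ _ _ _ cl cpl crr crrr.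
  have f3 : fsz (lft 0) = 3 by case/and4P: td => /eqP.
  move: xi; rewrite /orbit f3 /= !inE => /or3P[] /eqP xe; [exact: cl|exact: cpl|].
  by apply: crr; rewrite xe -rgt_step.
have rr := rgt_rho (ik : i <= k).
have [ek|ne] := eqVneq i k.
  rewrite {}ek in xi cl cpl crr crrr rr.
  have f3 : fsz (lft k.+1) = 3 by rewrite lft_phi // fsz_phi.
  move: xi; rewrite /orbit f3 /= !inE => /or3P[] /eqP xe; [exact: cl|exact: cpl|].
  by apply: crrr; rewrite xe last_step phi_al.
have ik' : i < k by lia.
have f4 : fsz (lft i.+1) = 4.
  by rewrite lft_phi // fsz_phi; case/and5P: (chain_quad ik') => /eqP.
move: xi; rewrite /orbit f4 /= !inE => /or4P[] /eqP xe; [exact: cl|exact: cpl| |].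
  by apply: crr; rewrite xe -[straight _]/(lft i.+1) lft_step // rgt_step.
by apply: crrr; rewrite xe -[straight _]/(lft i.+1) lft_step // rgt_step // phi_al.
Qed.

Lemma chain_absurd : False.
Proof.
apply: (edge_lens _ chain_ends_eq chain_nocross chain_q_phi chain_q_jump chain_q_node).
by apply/eqP; exact: chain_dir.
Qed.
End Chain.

(** * The balance of charges at faces and at vertices *)

Definition recv (x : D) := [exists d, tri1 d && (x == receiver d)].

(** A giver that is a triangle would have its vertex opposite to the last rung, and the chain would
    fill an empty lens between two parallel edges. *)
Lemma recvP x : recv x -> [/\ cr x, cr (phi x), ~~ quad0 x & fsz x != 3].
Proof.
case/existsP => d /andP[t /eqP ->]; have [k [-> nq kq]] := receiverP t.
have [c c'] := chain_cr t kq; split=> //; first by rewrite node_phi alphaK.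
apply/negP => /eqP f3; have := tri_has_vertex f3.
rewrite c' node_phi alphaK c /=; exact: chain_absurd kq f3.
Qed.

Lemma sum_recv : \sum_x (recv x : nat) = \sum_x (tri1 x : nat).
Proof.
rewrite -!big_mkcond /= !sum1_card -(card_in_imset receiver_inj).
apply: eq_card => x; rewrite unfold_in; apply/existsP/imsetP.
  by case=> d /andP[t /eqP ->]; exists d.
by case=> d t ->; exists d; rewrite eqxx andbT.
Qed.

(** The unit is a sixth of a charge. A triangle gives 9 to each of two vertices or 14 to each of
    three; with one vertex its charge is just made up to 0. A quadrilateral has 24 per vertex, less
    6 for each side between two crossings: 12 remain for a single vertex, 21 for each of two
    adjacent ones. A larger face pays 24 at each vertex and 6 at each side, keeping 24k >= 120. *)
Lemma face_charge r : froots phi r ->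
  \sum_(d <- orbit phi r) ((if V d then weight d else 0) + 6 * recv d) + 120 <=
  \sum_(d <- orbit phi r) (30 + 24 * V d + 6 * tri1 d).
Proof.
move=> _; have ge3 := fsz_ge3 r.
have [e3|n3] := eqVneq (fsz r) 3.
  have p3 : phi (phi (phi r)) = r by exact: (fszE e3).
  have f1 : fsz (phi r) = 3 by rewrite fsz_phi.
  have f2 : fsz (phi (phi r)) = 3 by rewrite fsz_phi.
  have nr x : fsz x = 3 -> recv x = false.
    by move=> fx; case h: (recv x) => //; case: (recvP h) => _ _ _; rewrite fx.
  rewrite /orbit e3 /= !big_cons !big_nil !nr // /weight /tri1 e3 f1 f2 /= !p3.
  have := tri_has_vertex e3.
  by case: (cr r); case: (cr (phi r)); case: (cr (phi (phi r))).
have [e4|n4] := eqVneq (fsz r) 4.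
  have p4 : phi (phi (phi (phi r))) = r by exact: (fszE e4).
  have f1 : fsz (phi r) = 4 by rewrite fsz_phi.
  have f2 : fsz (phi (phi r)) = 4 by rewrite !fsz_phi.
  have f3 : fsz (phi (phi (phi r))) = 4 by rewrite !fsz_phi.
  have q1 := quad0_phi r; have q2 := quad0_phi (phi r); have q3 := quad0_phi (phi (phi r)).
  have r0 := @recvP r; have r1 := @recvP (phi r).
  have r2 := @recvP (phi (phi r)); have r3 := @recvP (phi (phi (phi r))).
  rewrite /orbit e4 /= !big_cons !big_nil /weight /tri1 e4 f1 f2 f3 /= !p4.
  move: r0 r1 r2 r3; rewrite q3 q2 q1 p4 /quad0 e4 /=.
  case: (cr r); case: (cr (phi r)); case: (cr (phi (phi r))); case: (cr (phi (phi (phi r))));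
  move: (recv r) (recv (phi r)) (recv (phi (phi r))) (recv (phi (phi (phi r)))) => [] [] [] [] //=;
  move=> h0 h1 h2 h3;
  solve [ by case: (h0 isT) | by case: (h1 isT) | by case: (h2 isT) | by case: (h3 isT)].
have k5 : 4 < fsz r by lia.
apply: leq_trans (_ : \sum_(d <- orbit phi r) ((if V d then weight d else 0) + 6 * recv d + 24) <= _).
  rewrite [X in _ <= X]big_split /= leq_add2l big_const_seq count_predT size_orbit iter_addn_0; lia.
rewrite !big_seq; apply: leq_sum => d dr.
have -> : weight d = 24.
  have : fsz d = fsz r.
    move: dr; rewrite -fconnect_orbit => /iter_findex <-.
    by elim: (findex _ _ _) => //= i IH; rewrite fsz_phi.
  by rewrite /weight => ->; rewrite (negPf n3) (negPf n4).
by case: ifP => _; case: (recv d); rewrite /=; lia.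
Qed.

Lemma weight_gt0 d : 0 < weight d -> 9 <= weight d.
Proof. by rewrite /weight; do ?case: ifP. Qed.

(** The corner of [rho d] lies between [d] and [rho d], and its neighbours on the face are the far
    ends of these two darts. *)
Lemma weight_one d : V (al d) || V (al (rho d)) ->
  weight (rho d) = 9 /\ fsz (rho d) = 3 \/ 14 <= weight (rho d).
Proof.
rewrite /weight node_phi; have [f3|n3] := eqVneq (fsz (rho d)) 3.
  rewrite corner3 //; case: (cr (al d)) => /=; case: (cr (al (rho d))) => //= _; try by left.
  by right.
have [f4|n4] := eqVneq (fsz (rho d)) 4; last by right.
rewrite corner4 // => H; right; move: H; clear.
by case: (cr (al d)); case: (cr (al (rho d))); case: (is_crossing _).
Qed.

Lemma weight_both d : V (al d) -> V (al (rho d)) -> 14 <= weight (rho d).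
Proof.
rewrite /weight node_phi; have [f3|n3] := eqVneq (fsz (rho d)) 3.
  by rewrite corner3 // => -> ->.
have [f4|n4] := eqVneq (fsz (rho d)) 4 => //.
by rewrite corner4 // => -> ->; case: (is_crossing _).
Qed.

Lemma weight_xor d : V (al d) (+) V (al (rho d)) ->
  weight (rho d) = 9 /\ fsz (rho d) = 3 \/ 21 <= weight (rho d).
Proof.
rewrite /weight node_phi; have [f3|n3] := eqVneq (fsz (rho d)) 3.
  by rewrite corner3 //; case: (cr (al d)) => /=; case: (cr (al (rho d))) => //= _; left.
have [f4|n4] := eqVneq (fsz (rho d)) 4; last by right.
rewrite corner4 // => H; right; move: H; clear.
by case: (cr (al d)); case: (cr (al (rho d))); case: (is_crossing _).
Qed.

Lemma weight_none d : V d -> cr (al d) -> cr (al (rho d)) -> weight (rho d) < 24 ->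
  weight (rho d) = 0 /\ fsz (rho d) = 3 \/
  [/\ weight (rho d) = 12, fsz (rho d) = 4 & cr (phi (phi (rho d)))].
Proof.
rewrite /weight node_phi; have [f3|n3] := eqVneq (fsz (rho d)) 3.
  by rewrite corner3 // => _ -> -> _; left.
have [f4|n4] := eqVneq (fsz (rho d)) 4 => //.
rewrite corner4 // => _ -> -> /=; case: (is_crossing _) => //= _.
by right.
Qed.

Lemma weight0 d : weight d = 0 -> fsz d = 3.
Proof. by rewrite /weight; case: eqP => // _; do ?case: ifP. Qed.

(** The side of a triangle opposite to a vertex goes straight on through the far end of [d] and
    becomes the opposite side at the adjacent corner. *)
Lemma link d : fsz (rho d) = 3 -> cr (al d) ->
  [/\ lab (phi d).1 = lab (phi (rho d)).1, (phi d).2 = (phi (rho d)).2 &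
      rk (phi d) = (rk (phi (rho d))).+1].
Proof.
move=> f3 c; have e := corner3 f3.
have c' : cr (al (phi (rho d))) by rewrite -node_phi e.
have [<- <- <-] := straightP c'.
by rewrite /straight -/(phi (phi (rho d))) e -/(phi d).
Qed.

Lemma links d K : (forall i, i < K -> fsz (iter i.+1 rho d) = 3 /\ cr (al (iter i rho d))) ->
  [/\ lab (phi d).1 = lab (phi (iter K rho d)).1, (phi d).2 = (phi (iter K rho d)).2 &
      rk (phi d) = rk (phi (iter K rho d)) + K].
Proof.
elim: K => [|K IH] H; first by split=> //; rewrite addn0.
have [|-> -> ->] := IH; first by move=> i ik; apply: H; lia.
by have [f c] := H _ (ltnSn K); have [-> -> ->] := link f c; rewrite addSnnS.
Qed.

Lemma sum_at_2 (p : P) (F : D -> nat) x y : node x = p -> node y = p -> x != y ->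
  F x + F y <= \sum_(d | node d == p) F d.
Proof.
move=> nx ny xy; rewrite (bigD1 x) ?nx //= leq_add2l (bigD1 y) ?ny ?eqxx 1?eq_sym //=.
exact: leq_addr.
Qed.

Lemma sum_at_3 (p : P) (F : D -> nat) x y z : node x = p -> node y = p -> node z = p ->
  x != y -> z != x -> z != y -> F x + F y + F z <= \sum_(d | node d == p) F d.
Proof.
move=> nx ny nz xy zx zy; rewrite -addnA (bigD1 x) ?nx //= leq_add2l (bigD1 y) ?ny ?eqxx 1?eq_sym //=.
by rewrite leq_add2l (bigD1 z) /= ?nz ?eqxx ?zx ?zy ?leq_addr.
Qed.

Lemma iter_rho_neq d i : 0 < i -> i < order rho d -> iter i rho d != d.
Proof.
by move=> i0 io; apply/eqP => e; have := findex_iter io; rewrite e findex0 => e0; lia.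
Qed.

Lemma node_iter_rho i d : node (iter i rho d) = node d.
Proof. by elim: i => //= i IH; rewrite node_rho. Qed.

(** A total below 24 forces triangles around v, with at most one exception, whose sides opposite to
    v follow one another on one edge ([links]). If a segment joins v to a vertex w, that edge starts
    and ends at w and is a loop. If one quadrilateral is left, the edge crosses itself at the corner
    opposite to v. If there are only triangles, the edge closes up although [rk] grows strictly
    along it. *)
Lemma vertex_charge v : 24 <= \sum_(d | node d == inl v) weight d.
Proof.
rewrite leqNgt; apply/negP => lt24.
have one x : node x = inl v -> weight x < 24.
  by move=> nx; apply: leq_ltn_trans lt24; rewrite (bigD1 x) ?nx //= leq_addr.
have two x y : node x = inl v -> node y = inl v -> x != y -> weight x + weight y < 24.
  by move=> nx ny xy; apply: leq_ltn_trans lt24; apply: sum_at_2.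
have three x y z : node x = inl v -> node y = inl v -> node z = inl v ->
    x != y -> z != x -> z != y -> weight x + weight y + weight z < 24.
  by move=> nx ny nz xy zx zy; apply: leq_ltn_trans lt24; apply: sum_at_3.
have [d0 nd0] := has_dart (inl v).
have [/existsP[m /andP[/eqP nm Vm]]|] := boolP [exists m, (node m == inl v) && V (al m)].
  have nrm : node (rho m) = inl v by rewrite node_rho.
  (* If [m] is the only dart at v, a triangle there would have a side joining the far end of [m] to
     itself, and any other face gives 24. *)
  have [mm|mm] := eqVneq m (rho m).
    have o := one _ nm; move: o; rewrite mm /weight node_phi -mm Vm.
    have [f3|n3] := eqVneq (fsz m) 3.
      have e : phi (phi m) = al m by rewrite {1}mm corner3 // -mm.
      by have := node_al (phi m); rewrite -node_phi e node_phi eqxx.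
    have [f4|//] := eqVneq (fsz m) 4.
    have -> : phi (phi (phi m)) = al m by rewrite {1}mm corner4 // -mm.
    by rewrite Vm; case: (is_crossing _).
  have [pm rpm] : exists pm, rho pm = m by exists (finv rho m); rewrite f_finv.
  have npm : node pm = inl v by rewrite -nm -rpm node_rho.
  have wm : 9 <= weight m.
    by have := @weight_one pm; rewrite rpm Vm orbT => /(_ isT)[[->]|]; lia.
  have wrm : 9 <= weight (rho m).
    by have := @weight_one m; rewrite Vm => /(_ isT)[[->]|]; lia.
  (* A positive weight is at least 9, and three of them exceed 24. *)
  have other x : node x = inl v -> x != m -> x != rho m -> weight x = 0.
    move=> nx xm xrm; apply/eqP; rewrite -leqn0 leqNgt; apply/negP => /weight_gt0 wx.
    by have := three _ _ _ nm nrm nx mm xm xrm; lia.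
  have Urm : cr (al (rho m)).
    apply/negPn/negP => U.
    have h1 := weight_both Vm U.
    have [e|ne] := eqVneq (rho (rho m)) m.
      have := @weight_both (rho m); rewrite e => /(_ U Vm) h2.
      by have := two _ _ nm nrm mm; lia.
    have : weight (rho (rho m)) = 0.
      by apply: other; rewrite ?node_rho // (inj_eq rho_inj) eq_sym.
    by have := @weight_one (rho m); rewrite U => /(_ isT)[[->]|]; lia.
  have onlym x : node x = inl v -> x != m -> cr (al x).
    move=> nx xm; apply/negPn/negP => U.
    have [xr|xr] := eqVneq x (rho m); first by rewrite xr Urm in U.
    have [px rpx] : exists px, rho px = x by exists (finv rho x); rewrite f_finv.
    have := @weight_one px; rewrite rpx U orbT => /(_ isT).
    by rewrite other //; case=> [[]|].
  (* A corner next to [m] that is not in a triangle has weight at least 21, and 21 + 9 is too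
     much. *)
  have f3 x : node x = inl v -> fsz x = 3.
    move=> nx; have [->|xm] := eqVneq x m.
      have pmm : pm != m by apply: contraNneq mm => pmm; rewrite -{1}rpm pmm.
      have := @weight_xor pm; rewrite rpm Vm onlym // => /(_ isT)[[]//|h].
      by have := two _ _ nm nrm mm; lia.
    have [->|xrm] := eqVneq x (rho m).
      have := @weight_xor m; rewrite Vm Urm => /(_ isT)[[]//|h].
      by have := two _ _ nm nrm mm; lia.
    exact: weight0 (other _ nx xm xrm).
  have o := orderSpred rho m.
  have K : forall i, i < (order rho m).-1 -> fsz (iter i.+1 rho (rho m)) = 3 /\
      cr (al (iter i rho (rho m))).
    move=> i iK; split; first by apply: f3; rewrite node_iter_rho.
    rewrite -iterSr; apply: onlym; first by rewrite node_iter_rho.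
    by apply: iter_rho_neq; lia.
  have [l1 l2 l3] := links K.
  move: l1 l2 l3; rewrite -iterSr o (iter_order rho_inj) => l1 l2 l3.
  case nw: (node (al m)) Vm => [w|//] _.
  have h1 : node (phi m) = inl w by rewrite node_phi.
  have h2 : node (al (phi (rho m))) = inl w by rewrite -node_phi corner3 ?f3.
  have := node_ends h1; have := node_ends h2; rewrite /= l1 l2.
  by have := no_loop (lab (phi m).1); case: (phi m).2 => /= /eqP h -> // /esym.
rewrite negb_exists => /forallP noU.
have crU x : node x = inl v -> cr (al x).
  by move=> nx; have := noU x; rewrite nx eqxx /= negbK.
have nV x : node x = inl v -> V x by move=> ->.
have wP x : node x = inl v -> weight x = 0 /\ fsz x = 3 \/
    [/\ weight x = 12, fsz x = 4 & cr (phi (phi x))].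
  move=> nx; have [px rpx] : exists px, rho px = x by exists (finv rho x); rewrite f_finv.
  have npx : node px = inl v by rewrite -nx -rpx node_rho.
  have := @weight_none px; rewrite rpx; apply; [exact: nV|exact: crU|exact: crU|exact: one].
have o := fun x => orderSpred rho x.
have [/existsP[q /andP[/eqP nq wq]]|] := boolP [exists q, (node q == inl v) && (0 < weight q)].
  (* Two weights of 12 already make 24, so [q] is the only corner in a quadrilateral. *)
  have other x : node x = inl v -> x != q -> fsz x = 3.
    move=> nx xq; case: (wP x nx) => [[]//|[w12 _ _]].
    have := two _ _ nx nq xq; rewrite w12; case: (wP q nq) => [[w0]|[-> //]].
    by rewrite w0 in wq.
  case: (wP q nq) wq => [[-> //]|[_ f4 c2]] _.
  have K : forall i, i < (order rho q).-1 -> fsz (iter i.+1 rho q) = 3 /\ cr (al (iter i rho q)).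
    move=> i iK; split; last by apply: crU; rewrite node_iter_rho.
    apply: other; first by rewrite node_iter_rho.
    by apply: iter_rho_neq => //; rewrite -(o q); lia.
  have [l1 _ _] := links K; set q' := iter _ _ _ in l1.
  have rq' : rho q' = q by rewrite /q' -iterS o (iter_order rho_inj).
  have nq' : node q' = inl v by rewrite -nq -rq' node_rho.
  have e4 : phi (phi (phi q)) = al q' by rewrite -rq' corner4 // rq'.
  have c3 : cr (al (phi (phi q))) by rewrite -node_phi e4 crU.
  have [s1 _ _] := straightP c3.
  have : lab (phi (phi q)).1 = lab (phi q).1.
    by rewrite l1 -s1 /straight -/(phi (phi (phi q))) e4.
  have c1 : cr (al (phi q)) by rewrite -node_phi.
  by move=> h; have := cr_lab1 c1; rewrite -/(phi (phi q)) h eqxx.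
rewrite negb_exists => /forallP now.
have f3 x : node x = inl v -> fsz x = 3.
  by move=> nx; have := now x; rewrite nx eqxx /= -eqn0Ngt => /eqP /weight0.
have K : forall i, i < order rho d0 -> fsz (iter i.+1 rho d0) = 3 /\ cr (al (iter i rho d0)).
  by move=> i _; split; [apply: f3|apply: crU]; rewrite node_iter_rho.
have [_ _] := links K; rewrite (iter_order rho_inj).
by have := order_gt0 rho d0; lia.
Qed.

Hypothesis euler : #|S| + 2 <= fcard phi predT + (n + #|X|).
Hypothesis card_vdart : 2 * #|E| <= #|[pred d | V d]|.

Lemma card_cdart : 4 * #|X| <= #|[pred d | cr d]|.
Proof.
have -> : #|[pred d | cr d]| = \sum_(x : X) #|[pred d | node d == inr x]|.
  rewrite -sum1_card.
  transitivity (\sum_(x : X) \sum_(d | node d == inr x) 1); last first.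
    by apply: eq_bigr => x _; rewrite -sum1_card; apply: eq_bigl => d; rewrite !inE.
  rewrite (exchange_big_dep (fun d => cr d)) /=; last by move=> x d _ /eqP ->.
  apply: eq_bigr => d; rewrite inE; case nd: (node d) => [//|x] _.
  by rewrite (big_pred1 x) // => y; rewrite /= eq_sym.
rewrite mulnC -sum_nat_const; apply: leq_sum => x _.
have [d nd] := has_dart (inr x); have c : cr d by rewrite nd.
have c1 : cr (rho d) by rewrite node_rho.
have u : uniq [:: d; rho d; rho (rho d); rho (rho (rho d))].
  rewrite /= !inE !negb_or !(inj_eq rho_inj).
  have n1 y : cr y -> y != rho y by move=> cy; apply: contraNneq (cr_lab1 cy) => <-.
  have n2 y : cr y -> y != rho (rho y).
    by move=> cy; apply/eqP => e; have := cr_dir2 cy; rewrite -e; case: (y.2).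
  rewrite !n1 ?n2 //= andbT; apply/eqP => e; have := cr_rho4 c; rewrite -e => e'.
  by have := n1 _ c; rewrite e' eqxx.
have := card_uniqP u; rewrite /= => <-; apply: subset_leq_card; apply/subsetP => y.
by rewrite !inE => /or4P[] /eqP ->; rewrite ?node_rho nd.
Qed.

(** With v darts at vertices, c at crossings and F faces, the balance is 24n + 120F <= 60s + 24v.
    Euler's inequality bounds F from below by s + 2 - n - x; then 2s = v + c and c >= 4x remove the
    crossings and leave 6v <= 96n - 240, where v >= 2e. *)
Theorem quasiplanar_count : #|E| <= 8 * n - 20.
Proof.
have FF := face_sum face_charge.
have D2 : #|{: D}| = 2 * #|S| by rewrite card_prod card_bool mulnC.
have DV : #|{: D}| = #|[pred d | V d]| + #|[pred d | cr d]|.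
  by rewrite addnC -(cardC [pred d | cr d]); congr (_ + _); apply: eq_card => d; rewrite !inE.
have WV : 24 * n <= \sum_d (if V d then weight d else 0).
  rewrite -big_mkcond /=.
  have -> : 24 * n = \sum_(v < n) 24 by rewrite sum_nat_const card_ord mulnC.
  apply: leq_trans (_ : \sum_(v < n) \sum_(d | node d == inl v) weight d <= _).
    by apply: leq_sum => v _; exact: vertex_charge.
  rewrite (exchange_big_dep (fun d => V d)) /=; last by move=> v d _ /eqP ->.
  apply: leq_sum => d; case nd: (node d) => [v|//] _.
  by rewrite (big_pred1 v) // => y; rewrite /= eq_sym.
have E6 (F : D -> bool) : \sum_d 6 * F d = 6 * \sum_d (F d : nat) by rewrite big_distrr.
have E24 (F : D -> bool) : \sum_d 24 * F d = 24 * \sum_d (F d : nat) by rewrite big_distrr.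
move: FF; rewrite big_split /= [X in _ <= X -> _]big_split /= [X in _ <= X + _ -> _]big_split /= (E6 recv) (E6 tri1) (E24 (fun d => V d)) sum_recv.
have -> : \sum_(i : D) 30 = 30 * #|{: D}| by rewrite sum_nat_const mulnC.
have -> : \sum_(i : D) (V i : nat) = #|[pred d | V d]|.
  by rewrite -big_mkcond /= sum1_card.
have C4 := card_cdart.
move: euler card_vdart D2 DV WV C4; move: (\sum_d (if V d then weight d else 0)) => A.
move: (\sum_d (tri1 d : nat)) => T.
move: #|[pred d | V d]| #|[pred d | cr d]| (fcard phi predT) #|{: D}| => v c F k.
move: #|S| #|X| #|E| => s x e. clear; lia.
Qed.
End Discharging.

Import Order.TTheory GRing.Theory Num.Theory.

(** * Square lattice paths *)

Section Lattice.
Local Open Scope ring_scope.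
Local Notation Z2 := (int * int)%type.
Local Notation dir := (bool * bool)%type.
Local Notation spoke := (Z2 * dir)%type.
Implicit Types (a b c q : Z2) (d : dir) (s : spoke).

(* A spoke (q, (s, v)) is the unit edge leaving q, vertically iff v and in the
   negative direction iff s; a cell is named after its lower left corner. *)
Definition mv (s : spoke) : Z2 :=
  if s.2.2 then (s.1.1, s.1.2 + (if s.2.1 then -1 else 1))
  else (s.1.1 + (if s.2.1 then -1 else 1), s.1.2).

Definition cellL (s : spoke) : Z2 :=
  match s.2 with
  | (false, false) => s.1
  | (false, true) => (s.1.1 - 1, s.1.2)
  | (true, false) => (s.1.1 - 1, s.1.2 - 1)
  | (true, true) => (s.1.1, s.1.2 - 1)
  end.

Definition cellR (s : spoke) : Z2 :=
  match s.2 with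
  | (false, false) => (s.1.1, s.1.2 - 1)
  | (false, true) => s.1
  | (true, false) => (s.1.1 - 1, s.1.2)
  | (true, true) => (s.1.1 - 1, s.1.2 - 1)
  end.

Definition adj (a b : Z2) : bool := `|a.1 - b.1| + `|a.2 - b.2| <= 1.

(** The ray goes to the right from the centre of the cell c, and so passes through no lattice
    point. *)
Definition chid (c a b : Z2) : bool := ((c.2 < a.2) (+) (c.2 < b.2)) && (c.1 < a.1).

Definition on_edge (s : spoke) (a b : Z2) : bool :=
  ((a == s.1) && (b == mv s)) || ((b == s.1) && (a == mv s)).

(** The rays from the two cells beside a horizontal spoke run along both sides of its row, and a
    step entering or leaving the row to the right meets exactly one of them. Beside a vertical spoke
    the rays lie on one line and differ by the spoke alone. *)
Definition jump_pot (s : spoke) (a : Z2) : bool :=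
  ~~ s.2.2 && ((a.2 == s.1.2) && ((if s.2.1 then s.1.1 - 1 else s.1.1) < a.1)).

Lemma adjP a b : adj a b ->
  b = a \/ b = (a.1 + 1, a.2) \/ b = (a.1 - 1, a.2) \/ b = (a.1, a.2 + 1) \/ b = (a.1, a.2 - 1).
Proof.
case: a b => a1 a2 [b1 b2]; rewrite /adj /= => h.
have : (b1 = a1 /\ b2 = a2) \/ (b1 = a1 + 1 /\ b2 = a2) \/
  (b1 = a1 - 1 /\ b2 = a2) \/ (b1 = a1 /\ b2 = a2 + 1) \/ (b1 = a1 /\ b2 = a2 - 1) by lia.
by move=> [[-> ->]|[[-> ->]|[[-> ->]|[[-> ->]|[-> ->]]]]]; tauto.
Qed.

Lemma jump_edge s a b : adj a b ->
  chid (cellL s) a b (+) chid (cellR s) a b = on_edge s a b (+) (jump_pot s a (+) jump_pot s b).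
Proof.
case: s => -[x y] d; case: a => a1 a2 /adjP[->|[->|[->|[->|->]]]]; rewrite /chid /on_edge /jump_pot /mv /cellL /cellR /= !xpair_eqE /=.
- by case: d => [[] []] /=; rewrite ?xpair_eqE; clear; lia.
- by case: d => [[] []] /=; rewrite ?xpair_eqE; clear; lia.
- by case: d => [[] []] /=; rewrite ?xpair_eqE; clear; lia.
- by case: d => [[] []] /=; rewrite ?xpair_eqE; clear; lia.
- by case: d => [[] []] /=; rewrite ?xpair_eqE; clear; lia.
Qed.

Definition mult (s : spoke) (a : Z2) (l : seq Z2) : bool := psum (on_edge s) a l.
Definition wind (c : Z2) (a : Z2) (l : seq Z2) : bool := psum (chid c) a l.

Lemma wind_jump s a l : path adj a l ->
  wind (cellL s) a l (+) wind (cellR s) a l = mult s a l (+) (jump_pot s a (+) jump_pot s (last a l)).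
Proof.
rewrite /wind /mult; elim: l a => [|b l IH] a /=; first by rewrite addbb.
case/andP => ab /IH e; have := jump_edge s ab; move: e.
move: (jump_pot s (last b l)) (jump_pot s b) (jump_pot s a) => x y z.
move: (psum _ _ _) (psum _ _ _) (psum _ _ _) => u v w.
move: (chid _ _ _) (chid _ _ _) (on_edge _ _ _) => i j k.
by case: u v w x y z i j k => [] [] [] [] [] [] [] [] [].
Qed.

Lemma mult0 s a l : s.1 \notin a :: l -> mult s a l = false.
Proof.
rewrite /mult; elim: l a => //= b l IH a; rewrite inE negb_or => /andP[n1 n2].
rewrite IH // addbF /on_edge; move: n2; rewrite inE negb_or => /andP[n2 _].
by rewrite (eq_sym a s.1) (eq_sym b s.1) (negbTE n1) (negbTE n2).
Qed.

Lemma mult0' s a l : mv s \notin a :: l -> mult s a l = false.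
Proof.
rewrite /mult; elim: l a => //= b l IH a; rewrite inE negb_or => /andP[n1 n2].
rewrite IH // addbF /on_edge; move: n2; rewrite inE negb_or => /andP[n2 _].
by rewrite (eq_sym a (mv s)) (eq_sym b (mv s)) (negbTE n1) (negbTE n2) !andbF.
Qed.

Definition opp_spoke (s : spoke) : spoke := (mv s, (~~ s.2.1, s.2.2)).

Lemma mv_opp s : mv (opp_spoke s) = s.1.
Proof. by case: s => [[x y] [[] []]]; rewrite /mv /= ?addrK ?subrK ?addrNK. Qed.

Lemma opp_spokeK : involutive opp_spoke.
Proof.
move=> s; rewrite {1}/opp_spoke mv_opp /=; by case: s => [[x y] [[] []]].
Qed.

Lemma cellL_opp s : cellL (opp_spoke s) = cellR s.
Proof. by case: s => [[x y] [[] []]]; rewrite /cellL /cellR /mv /= ?addrK ?subrK ?addrNK. Qed.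

Lemma cellR_opp s : cellR (opp_spoke s) = cellL s.
Proof. by rewrite -cellL_opp opp_spokeK. Qed.

Lemma adj_mv a b : adj a b -> a != b -> exists d, b = mv (a, d).
Proof.
case: a => a1 a2 /adjP[->|[->|[->|[->|->]]]]; first by rewrite eqxx.
- by exists (false, false).
- by exists (true, false).
- by exists (false, true).
- by exists (true, true).
Qed.

Lemma mv_inj a d d' : mv (a, d) = mv (a, d') -> d = d'.
Proof.
case: a d d' => x y [[] []] [[] []] //; rewrite /mv /= => /eqP; rewrite xpair_eqE; lia.
Qed.

(* Turning around q from the direction i towards the direction o, only edges at q in
   other directions are met. *)
Lemma left_turn (f : Z2 -> bool) q i o : i != o ->
  (forall d, d != i -> d != o -> f (cellL (q, d)) = f (cellR (q, d))) ->
  f (cellL (q, o)) = f (cellR (q, i)).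
Proof.
move=> io H.
have HH d : [|| d == i, d == o | f (cellL (q, d)) == f (cellR (q, d))].
  case: eqVneq => //= n1; case: eqVneq => //= n2; exact/eqP/H.
have := HH (false, false); have := HH (false, true).
have := HH (true, false); have := HH (true, true).
case: q {H HH} => x y; move: io; case: i o => [[] []] [[] []] //= _; rewrite /cellL /cellR /=;
by move: (f (x, y)) (f (x - 1, y)) (f (x - 1, y - 1)) (f (x, y - 1)) => [] [] [] [].
Qed.

Section LeftSide.
Variables (f : Z2 -> bool).

(** The direction is a default value unless a and b are distinct neighbours. *)
Definition spoke_of (a b : Z2) : spoke := (a, odflt (false, false) [pick d | b == mv (a, d)]).

Lemma spoke_ofP a d : spoke_of a (mv (a, d)) = (a, d).
Proof.
rewrite /spoke_of; case: pickP => [d' /eqP /mv_inj -> //|/(_ d)].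
by rewrite eqxx.
Qed.

Lemma spoke_of_opp a d : spoke_of (mv (a, d)) a = opp_spoke (a, d).
Proof. by rewrite -{2}[a]/((a, d).1) -mv_opp /opp_spoke spoke_ofP. Qed.

(** At an inner point of a simple path only the incoming and the outgoing edge may carry a jump, so
    [f] is kept when turning from one to the other on either side. The last spoke points backwards,
    which exchanges its two cells. *)
Lemma left_const a b l : path adj a (b :: l) -> uniq (a :: b :: l) ->
  (forall q d, q \in belast b l -> ~~ mult (q, d) a (b :: l) -> f (cellL (q, d)) = f (cellR (q, d))) ->
  let e := spoke_of (last b l) (last a (belast b l)) in
  f (cellL (spoke_of a b)) = f (cellR e) /\ f (cellR (spoke_of a b)) = f (cellL e).
Proof.
elim: l a b => [|r l IH] a b /=; rewrite ?andbT.
  move=> ab; rewrite inE => na _.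
  have [d bd] := adj_mv ab na.
  by rewrite bd spoke_ofP spoke_of_opp cellL_opp cellR_opp.
move=> /and3P[ab br pl] /and3P[].
rewrite !inE !negb_or => /and3P[nab nar nal] /andP[nbr nbl] /andP[nrl ul] H.
have [d bd] := adj_mv ab nab; have [o ro] := adj_mv br nbr.
pose i := (opp_spoke (a, d)).2.
have bi : (b, i) = opp_spoke (a, d) by rewrite bd.
have ai : mv (b, i) = a by rewrite bi mv_opp.
have io : i != o by apply: contraNneq nar => io; rewrite -ai ro io.
have M0 d' : d' != i -> d' != o -> ~~ mult (b, d') a [:: b, r & l].
  move=> n1 n2; rewrite /mult /= -/(mult (b, d') r l) mult0 ?inE ?negb_or ?nbr // addbF.
  rewrite /on_edge /= (negbTE nab) eqxx /= (eq_sym r b) (negbTE nbr) /= orbF.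
  have -> : (a == mv (b, d')) = false.
    by apply/eqP => e; case/eqP: n1; apply: (@mv_inj b); rewrite -e ai.
  have -> // : (r == mv (b, d')) = false.
    by apply/eqP => e; case/eqP: n2; apply: (@mv_inj b); rewrite -e.
have HH d' : d' != i -> d' != o -> f (cellL (b, d')) = f (cellR (b, d')).
  by move=> n1 n2; apply: H; [rewrite inE eqxx|exact: M0].
have t1 := left_turn io HH.
have t2 : f (cellL (b, i)) = f (cellR (b, o)).
  by apply: left_turn; [rewrite eq_sym|move=> d' n1 n2; apply: HH].
have sab : spoke_of a b = (a, d) by rewrite bd spoke_ofP.
have sbr : spoke_of b r = (b, o) by rewrite ro spoke_ofP.
have := IH b r; rewrite /= br pl !inE negb_or nbr nbl nrl ul sbr => /(_ isT isT)[].
  move=> q d' qr nm; apply: H; first by rewrite inE qr orbT.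
  rewrite /mult /= -/(mult (q, d') b (r :: l)) addbC; move: nm; rewrite /mult /= => nm.
  suff -> : on_edge (q, d') a b = false by rewrite addbF.
  have qrl : q \in r :: l by apply: mem_belast.
  have qa : q != a.
    by apply: contraTneq qrl => ->; rewrite inE negb_or nar nal.
  have qb : q != b.
    by apply: contraTneq qrl => ->; rewrite inE negb_or nbr nbl.
  by rewrite /on_edge /= (eq_sym a q) (eq_sym b q) (negbTE qa) (negbTE qb).
by move=> <- <-; rewrite sab t1 -t2 bi cellL_opp cellR_opp.
Qed.
End LeftSide.

(** * Sequences in which each right value is the next left value *)

Section Chain.
Variables (T : Type) (U : eqType) (L Rr : T -> U).

Fixpoint chain (v : U) (l : seq T) : bool :=
  if l is y :: l' then (v == L y) && chain (Rr y) l' else true.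
Fixpoint endv (v : U) (l : seq T) : U := if l is y :: l' then endv (Rr y) l' else v.

Lemma chain_cat v l1 l2 : chain v (l1 ++ l2) = chain v l1 && chain (endv v l1) l2.
Proof. by elim: l1 v => //= y l IH v; rewrite IH andbA. Qed.

Lemma endv_cat v l1 l2 : endv v (l1 ++ l2) = endv (endv v l1) l2.
Proof. by elim: l1 v => //= y l IH v. Qed.
End Chain.

Section ChainBool.
Variables (T : eqType) (L Rr : T -> bool).

Lemma chain_sum v l : chain L Rr v l ->
  \big[addb/false]_(y <- l) (L y (+) Rr y) = v (+) endv Rr v l.
Proof.
elim: l v => [|y l IH] v /=; first by rewrite big_nil addbb.
case/andP => /eqP -> /IH; rewrite big_cons => ->.
by case: (L y) (Rr y) (endv _ _ _) => [] [] [].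
Qed.

Lemma chain_filter (u : pred T) v l : {in l, forall y, ~~ u y -> L y = Rr y} -> chain L Rr v l ->
  chain L Rr v (filter u l) /\ endv Rr v (filter u l) = endv Rr v l.
Proof.
elim: l v => //= y l IH v H /andP[/eqP vy c].
have Hl : {in l, forall y0, ~~ u y0 -> L y0 = Rr y0}.
  by move=> x xl; apply: H; rewrite inE xl orbT.
case: ifP => uy /=; first by have [-> ->] := IH _ Hl c; rewrite vy eqxx.
by rewrite vy H ?inE ?eqxx ?uy //; apply: IH.
Qed.

Lemma chain_cycle x l v : chain L Rr v (x :: l) -> endv Rr v (x :: l) = v ->
  cycle (fun u w => Rr u == L w) (x :: l).
Proof.
move=> /= /andP[/eqP vx c] e; rewrite rcons_path.
have : path (fun u w => Rr u == L w) x l /\ Rr (last x l) = endv Rr (Rr x) l.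
  elim: l x {vx e} c => //= y l IH x /andP[xy c].
  by have [-> ->] := IH _ c; rewrite xy.
by case=> -> ->; rewrite e vx eqxx.
Qed.
End ChainBool.

Lemma chain_map (T : Type) (U : eqType) (L Rr : T -> U) (f : U -> bool) v l :
  chain L Rr v l -> chain (f \o L) (f \o Rr) (f v) l /\ endv (f \o Rr) (f v) l = f (endv Rr v l).
Proof.
elim: l v => //= y l IH v /andP[/eqP -> c]; rewrite eqxx /=; exact: IH.
Qed.

(** * The border of a lattice rectangle *)

Section Ring.
Variables (x0 y0 : int) (m k : nat).

Definition in_rect (q : Z2) : bool :=
  [&& x0 <= q.1, q.1 <= x0 + m%:Z, y0 <= q.2 & q.2 <= y0 + k%:Z].

(* The spokes leaving the rectangle, in clockwise order. *)
Definition ring : seq spoke :=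
  [seq ((x0 + i%:Z, y0 + k%:Z), (false, true)) | i <- iota 0 m.+1] ++
  [seq ((x0 + m%:Z, y0 + k%:Z - i%:Z), (false, false)) | i <- iota 0 k.+1] ++
  [seq ((x0 + m%:Z - i%:Z, y0), (true, true)) | i <- iota 0 m.+1] ++
  [seq ((x0, y0 + i%:Z), (true, false)) | i <- iota 0 k.+1].

Lemma ring_chain : chain cellL cellR (x0 - 1, y0 + k%:Z) ring /\
  endv cellR (x0 - 1, y0 + k%:Z) ring = (x0 - 1, y0 + k%:Z).
Proof.
have eqZ (a b c d : int) : a = c -> b = d -> (a, b) = (c, d) by move=> -> ->.
have sN (x y : int) n j : let l := [seq ((x + i%:Z, y), (false, true)) | i <- iota j n] in
    chain cellL cellR (x + j%:Z - 1, y) l /\ endv cellR (x + j%:Z - 1, y) l = (x + (j + n)%:Z - 1, y).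
  elim: n j => [|n IH] j /=; first by rewrite addn0.
  have [] := IH j.+1; rewrite /cellL /cellR /= eqxx.
  have -> : (x + j.+1%:Z - 1, y) = (x + j%:Z, y) by apply: eqZ; lia.
  by move=> -> ->; rewrite addSnnS.
have sE (x y : int) n j : let l := [seq ((x, y - i%:Z), (false, false)) | i <- iota j n] in
    chain cellL cellR (x, y - j%:Z) l /\ endv cellR (x, y - j%:Z) l = (x, y - (j + n)%:Z).
  elim: n j => [|n IH] j /=; first by rewrite addn0.
  have [] := IH j.+1; rewrite /cellL /cellR /= eqxx.
  have -> : (x, y - j.+1%:Z) = (x, y - j%:Z - 1) by apply: eqZ; lia.
  by move=> -> ->; rewrite addSnnS.
have sS (x y : int) n j : let l := [seq ((x - i%:Z, y), (true, true)) | i <- iota j n] in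
    chain cellL cellR (x - j%:Z, y - 1) l /\ endv cellR (x - j%:Z, y - 1) l = (x - (j + n)%:Z, y - 1).
  elim: n j => [|n IH] j /=; first by rewrite addn0.
  have [] := IH j.+1; rewrite /cellL /cellR /= eqxx.
  have -> : (x - j.+1%:Z, y - 1) = (x - j%:Z - 1, y - 1) by apply: eqZ; lia.
  by move=> -> ->; rewrite addSnnS.
have sW (x y : int) n j : let l := [seq ((x, y + i%:Z), (true, false)) | i <- iota j n] in
    chain cellL cellR (x - 1, y + j%:Z - 1) l /\ endv cellR (x - 1, y + j%:Z - 1) l = (x - 1, y + (j + n)%:Z - 1).
  elim: n j => [|n IH] j /=; first by rewrite addn0.
  have [] := IH j.+1; rewrite /cellL /cellR /= eqxx.
  have -> : (x - 1, y + j.+1%:Z - 1) = (x - 1, y + j%:Z) by apply: eqZ; lia.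
  by move=> -> ->; rewrite addSnnS.
have [n1 n2] := sN x0 (y0 + k%:Z) m.+1 0%N.
have [e1 e2] := sE (x0 + m%:Z) (y0 + k%:Z) k.+1 0%N.
have [s1 s2] := sS (x0 + m%:Z) y0 m.+1 0%N.
have [w1 w2] := sW x0 y0 k.+1 0%N.
have E1 : (x0 + 0%:Z - 1, y0 + k%:Z) = (x0 - 1, y0 + k%:Z) by apply: eqZ; lia.
have E2 : (x0 + (0 + m.+1)%:Z - 1, y0 + k%:Z) = (x0 + m%:Z, y0 + k%:Z - 0%:Z) by apply: eqZ; lia.
have E3 : (x0 + m%:Z, y0 + k%:Z - (0 + k.+1)%:Z) = (x0 + m%:Z - 0%:Z, y0 - 1) by apply: eqZ; lia.
have E4 : (x0 + m%:Z - (0 + m.+1)%:Z, y0 - 1) = (x0 - 1, y0 + 0%:Z - 1) by apply: eqZ; lia.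
have E5 : (x0 - 1, y0 + (0 + k.+1)%:Z - 1) = (x0 - 1, y0 + k%:Z) by apply: eqZ; lia.
rewrite E1 E2 in n1 n2; rewrite E3 in e2; rewrite E4 in s2; rewrite E5 in w2.
by rewrite /ring !chain_cat !endv_cat n2 e2 s2 w2 n1 e1 s1 w1.
Qed.

Lemma mem_ring s : (s \in ring) = in_rect s.1 && ~~ in_rect (mv s).
Proof.
case: s => -[x y] d; rewrite /ring !mem_cat; apply/idP/idP.
  case/or4P => /mapP[i]; rewrite mem_iota => hi [-> -> ->]; rewrite /in_rect /mv /=; lia.
rewrite /in_rect /mv => h0; have := h0; case: d {h0} => [[] []] h; rewrite /= in h.
- apply/orP; right; apply/orP; right; apply/orP; left.
  apply/mapP; exists (absz (x0 + m%:Z - x)%R); first by rewrite mem_iota; lia.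
  congr (_, _, _); lia.
- apply/orP; right; apply/orP; right; apply/orP; right.
  apply/mapP; exists (absz (y - y0)%R); first by rewrite mem_iota; lia.
  congr (_, _, _); lia.
- apply/orP; left; apply/mapP; exists (absz (x - x0)%R); first by rewrite mem_iota; lia.
  congr (_, _, _); lia.
- apply/orP; right; apply/orP; left.
  apply/mapP; exists (absz (y0 + k%:Z - y)%R); first by rewrite mem_iota; lia.
  congr (_, _, _); lia.
Qed.

Lemma uniq_ring : uniq ring.
Proof.
have iu n (g : nat -> spoke) : injective g -> uniq [seq g i | i <- iota 0 n].
  by move=> gi; rewrite map_inj_uniq ?iota_uniq.
have nh (d d' : dir) n n' (g g' : nat -> Z2) : d != d' ->
    has [in [seq (g i, d) | i <- iota 0 n]] [seq (g' i, d') | i <- iota 0 n'] = false.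
  move=> dd; apply/negbTE/hasPn => s /mapP[i _ ->]; apply/mapP => -[j _ []] _ e.
  by rewrite e eqxx in dd.
rewrite /ring !cat_uniq !has_cat !nh //.
apply/andP; split; first by apply: iu => i j []; lia.
apply/andP; split=> //; apply/andP; split; first by apply: iu => i j []; lia.
apply/andP; split=> //; apply/andP; split; first by apply: iu => i j []; lia.
by apply/andP; split=> //; apply: iu => i j []; lia.
Qed.

Lemma ring_mult_edge a b : adj a b ->
  \big[addb/false]_(s <- ring) on_edge s a b = in_rect a (+) in_rect b.
Proof.
move=> ab.
have one s0 : s0 \in ring -> (forall s, s \in ring -> on_edge s a b = (s == s0)) ->
    \big[addb/false]_(s <- ring) on_edge s a b = true.
  move=> s0r H; rewrite (bigD1_seq s0) //=; last exact: uniq_ring.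
  rewrite H // eqxx big_seq_cond big1 // => s /andP[sr ns].
  by rewrite H // (negbTE ns).
have zero : (forall s, s \in ring -> on_edge s a b = false) ->
    \big[addb/false]_(s <- ring) on_edge s a b = false.
  by move=> H; rewrite big_seq_cond big1 // => s /andP[/H].
case ia: (in_rect a); case ib: (in_rect b) => /=.
- apply: zero => s; rewrite mem_ring => /andP[h1 h2]; apply/negbTE/negP.
  by case/orP => /andP[/eqP e1 /eqP e2]; rewrite -e2 ?ia ?ib in h2.
- have nab : a != b by apply: contraFneq ib => <-.
  have [d bd] := adj_mv ab nab.
  apply: (one (a, d)); first by rewrite mem_ring /= ia -bd ib.
  move=> s; rewrite mem_ring => /andP[h1 h2]; apply/idP/eqP.
    case/orP => /andP[/eqP e1 /eqP e2]; last by rewrite -e1 ib in h1.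
    case: s e1 e2 {h1 h2} => q d' /= e1; rewrite -e1 bd => e2.
    by rewrite (mv_inj e2).
  by move=> ->; rewrite /on_edge /= eqxx bd eqxx.
- have nab : b != a by apply: contraFneq ia => <-.
  have adba : adj b a by move: ab; rewrite /adj distrC (distrC b.2).
  have [d bd] := adj_mv adba nab.
  apply: (one (b, d)); first by rewrite mem_ring /= ib -bd ia.
  move=> s; rewrite mem_ring => /andP[h1 h2]; apply/idP/eqP.
    case/orP => /andP[/eqP e1 /eqP e2]; first by rewrite -e1 ia in h1.
    case: s e1 e2 {h1 h2} => q d' /= e1; rewrite -e1 bd => e2.
    by rewrite (mv_inj e2).
  by move=> ->; rewrite /on_edge /= eqxx bd eqxx orbT.
- apply: zero => s; rewrite mem_ring => /andP[h1 h2]; apply/negbTE/negP.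
  by case/orP => /andP[/eqP e1 _]; rewrite -e1 ?ia ?ib in h1.
Qed.

Lemma ring_mult a l : path adj a l ->
  \big[addb/false]_(s <- ring) mult s a l = in_rect a (+) in_rect (last a l).
Proof.
elim: l a => [|b l IH] a /=; first by rewrite big1 ?addbb.
case/andP => ab pl; rewrite big_split /= ring_mult_edge // IH //.
by case: (in_rect a) (in_rect b) (in_rect (last b l)) => [] [] [].
Qed.

(** One turn around the rectangle brings [f] back to its first value. *)
Lemma ring_cells (f : Z2 -> bool) :
  \big[addb/false]_(s <- ring) (f (cellL s) (+) f (cellR s)) = false.
Proof.
have [c e] := ring_chain; have [c' e'] := chain_map f c.
by have := chain_sum c'; rewrite e' e addbb.
Qed.

Lemma rect_connected a b : in_rect a -> in_rect b ->
  exists l, [/\ path adj a l, last a l = b & all in_rect (a :: l)].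
Proof.
have [n] := ubnP (absz (a.1 - b.1) + absz (a.2 - b.2))%N.
elim: n a => // n IH a lt ra rb.
have [->|ne] := eqVneq a b; first by exists [::]; rewrite /= rb.
pose a' : Z2 := if a.1 < b.1 then (a.1 + 1, a.2) else if b.1 < a.1 then (a.1 - 1, a.2) else
  if a.2 < b.2 then (a.1, a.2 + 1) else (a.1, a.2 - 1).
have ne' : (a.1 != b.1) || (a.2 != b.2) by move: ne; case: (a) (b) => ? ? [? ?]; rewrite xpair_eqE negb_and.
have [||l [p1 p2 p3]] := IH a' _ _ rb.
- by move: lt ne'; rewrite /a'; case: ltrP => ?; [|case: ltrP => ?; [|case: ltrP => ?]]; rewrite /=; lia.
- by move: ra rb ne'; rewrite /a' /in_rect; case: ltrP => ?; [|case: ltrP => ?; [|case: ltrP => ?]]; rewrite /=; lia.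
exists (a' :: l); rewrite /= p1 p2; split=> //; last by rewrite ra.
by rewrite andbT /adj /a'; case: ltrP => ?; [|case: ltrP => ?; [|case: ltrP => ?]]; rewrite /=; lia.
Qed.
End Ring.
End Lattice.

(** * Rotation systems of lattice drawings *)

(** Each node receives an even number of chosen ends, so differences of a function of the nodes
    cancel. The error terms met below have this form. *)
Lemma even_sum (S P : finType) (node : S * bool -> P) (z : S -> bool) (g : P -> bool) :
  (forall p, even_at node z p) ->
  \big[addb/false]_s (z s && (g (node (s, true)) (+) g (node (s, false)))) = false.
Proof.
move=> ev.
transitivity (\big[addb/false]_(d : S * bool) (z d.1 && g (node d))).
  transitivity (\big[addb/false]_s \big[addb/false]_(b : bool) (z s && g (node (s, b)))).
    by apply: eq_bigr => s _; rewrite big_bool /= andb_addr.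
  by rewrite pair_big /=; apply: eq_bigr => -[].
rewrite (partition_big node xpredT) //= big1 // => p _.
transitivity (\big[addb/false]_(d | node d == p) (g p && z d.1)).
  by apply: eq_bigr => d /eqP ->; rewrite andbC.
case: (g p); first exact: ev.
by rewrite big1.
Qed.

Section Discrete.
Local Notation Z2 := (int * int)%type.
Local Notation dir := (bool * bool)%type.
Local Notation spoke := (Z2 * dir)%type.
Variables (S P : finType) (node : S * bool -> P).
Local Notation D := (S * bool)%type.
Variables (rx ry : P -> int) (rm rk : P -> nat).
Local Notation inB p := (in_rect (rx p) (ry p) (rm p) (rk p)).
Variables (a0 b0 : S -> Z2) (l0 L1 L2 : S -> seq Z2).
Local Notation pth s := (a0 s :: b0 s :: l0 s).
Local Notation lst s := (last (b0 s) (l0 s)).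
Local Notation corner p := (rx p, ry p).
Hypothesis gap0 : forall p p' q, inB p q -> inB p' q -> p = p'.
Hypothesis gap : forall p p' s, inB p s.1 -> inB p' (mv s) -> p = p'.
Hypothesis pathP : forall s, path adj (a0 s) (b0 s :: l0 s).
Hypothesis pathU : forall s, uniq (pth s).
Hypothesis startP : forall s, inB (node (s, true)) (a0 s).
Hypothesis endP : forall s, inB (node (s, false)) (lst s).
Hypothesis intP : forall s q p, q \in belast (b0 s) (l0 s) -> ~~ inB p q.
Hypothesis node_ne : forall s, node (s, true) != node (s, false).
Hypothesis sep : forall s s' q, s != s' -> q \in pth s -> q \notin pth s'.
Hypothesis L1P : forall s, [/\ path adj (corner (node (s, true))) (L1 s),
  last (corner (node (s, true))) (L1 s) = a0 s & all (inB (node (s, true))) (corner (node (s, true)) :: L1 s)].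
Hypothesis L2P : forall s, [/\ path adj (lst s) (L2 s),
  last (lst s) (L2 s) = corner (node (s, false)) & all (inB (node (s, false))) (lst s :: L2 s)].

(** With the paths prolonged to the corners of the rectangles, an even set of segments becomes a
    closed chain modulo 2 on the lattice. *)
Definition hat s := L1 s ++ (b0 s :: l0 s) ++ L2 s.
Local Notation crn s := (corner (node (s, true))).

Lemma hat_path s : path adj (crn s) (hat s).
Proof.
have [p1 e1 _] := L1P s; have [p2 e2 _] := L2P s.
by rewrite /hat !cat_path p1 e1 pathP /= p2.
Qed.

Lemma hat_last s : last (crn s) (hat s) = corner (node (s, false)).
Proof.
have [p1 e1 _] := L1P s; have [p2 e2 _] := L2P s.
by rewrite /hat !last_cat e1 /= e2.
Qed.

Lemma mult_hat s (sg : spoke) :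
  mult sg (crn s) (hat s) =
  mult sg (crn s) (L1 s) (+) mult sg (a0 s) (b0 s :: l0 s) (+) mult sg (lst s) (L2 s).
Proof.
have [p1 e1 _] := L1P s; have [p2 e2 _] := L2P s.
by rewrite /hat /mult !psum_cat e1 addbA.
Qed.

Lemma mult_L1 s (sg : spoke) : (forall p, ~~ inB p sg.1) \/ (forall p, ~~ inB p (mv sg)) ->
  mult sg (crn s) (L1 s) = false.
Proof.
have [_ _ /allP a1] := L1P s.
by case=> H; [apply: mult0|apply: mult0']; apply/negP => /a1; apply/negP/H.
Qed.

Lemma mult_L2 s (sg : spoke) : (forall p, ~~ inB p sg.1) \/ (forall p, ~~ inB p (mv sg)) ->
  mult sg (lst s) (L2 s) = false.
Proof.
have [_ _ /allP a1] := L2P s.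
by case=> H; [apply: mult0|apply: mult0']; apply/negP => /a1; apply/negP/H.
Qed.

(** The edge by which the path leaves the rectangle at the node of [d]; at its far end the path is
    read backwards. *)
Definition spk (d : D) : spoke :=
  if d.2 then spoke_of (a0 d.1) (b0 d.1)
  else spoke_of (lst d.1) (last (a0 d.1) (belast (b0 d.1) (l0 d.1))).

Lemma l0_rcons s : exists l r, l0 s = rcons l r.
Proof.
case: (lastP (l0 s)) (endP s) (pathP s) (startP s) => [|l r]; last by exists l, r.
move=> /= h1; rewrite andbT => h2 h3.
have ne : a0 s != b0 s by have := pathU s; rewrite /= inE negb_or => /andP[/andP[]].
have [d e] := adj_mv h2 ne.
have := node_ne s; rewrite (@gap (node (s, true)) (node (s, false)) (a0 s, d)) ?eqxx //.
by rewrite -e.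
Qed.

Lemma spk_start s : exists2 d, spk (s, true) = (a0 s, d) & b0 s = mv (a0 s, d).
Proof.
have ne : a0 s != b0 s by have := pathU s; rewrite /= inE negb_or => /andP[/andP[]].
have [d e] := adj_mv (proj1 (andP (pathP s))) ne.
by exists d => //; rewrite /spk /= {1}e spoke_ofP.
Qed.

Lemma b0_out s p : ~~ inB p (b0 s).
Proof.
apply: (@intP s); have [l [r ->]] := l0_rcons s.
by rewrite belast_rcons inE eqxx.
Qed.

Lemma adj_sym (a b : Z2) : adj a b = adj b a.
Proof. by rewrite /adj distrC (distrC a.2). Qed.

Lemma spk_end s : exists l r, [/\ l0 s = rcons l r, adj (last (b0 s) l) r, last (b0 s) l != r,
  last (b0 s) l \in belast (b0 s) (l0 s) &
  exists2 d, spk (s, false) = (r, d) & last (b0 s) l = mv (r, d)].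
Proof.
have [l [r e]] := l0_rcons s; exists l, r.
have := pathP s; rewrite e /= rcons_path => /and3P[_ _ ar].
have ne : last (b0 s) l != r.
  have := pathU s; rewrite e /= => /andP[_ /andP[]].
  rewrite mem_rcons inE negb_or rcons_uniq => /andP[n1 _] /andP[n2 _].
  case: (lastP l) n1 n2 => [//|l' x] _; rewrite last_rcons mem_rcons inE negb_or eq_sym.
  by case/andP.
split=> //; first by rewrite belast_rcons mem_last.
have ar' : adj r (last (b0 s) l) by rewrite adj_sym.
have [|d ed] := adj_mv ar'; first by rewrite eq_sym.
exists d => //; rewrite /spk /= e last_rcons belast_rcons /=.
by rewrite {1}ed spoke_ofP.
Qed.

Lemma spk_in d : inB (node d) (spk d).1.
Proof.
case: d => s [].
  by have [d -> _] := spk_start s; exact: startP.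
have [l [r [e _ _ _ [d -> _]]]] := spk_end s.
by have := endP s; rewrite e last_rcons.
Qed.

Lemma spk_out d p : ~~ inB p (mv (spk d)).
Proof.
case: d => s [].
  by have [d -> <-] := spk_start s; exact: b0_out.
have [l [r [e _ _ m [d -> <-]]]] := spk_end s.
exact: intP m.
Qed.

Lemma spk_mem d : (spk d).1 \in pth d.1.
Proof.
case: d => s [].
  by have [d -> _] := spk_start s; rewrite inE eqxx.
have [l [r [e _ _ m [d -> _]]]] := spk_end s.
by rewrite /= e !inE mem_rcons inE eqxx !orbT.
Qed.

Lemma spk_inj : injective spk.
Proof.
move=> [s b] [s' b'] e.
have ss : s = s'.
  apply/eqP/negPn/negP => /sep /(_ (spk_mem (s, b))).
  by rewrite e (spk_mem (s', b')).
rewrite -{s'}ss in e *; congr (_, _); apply/eqP/negPn/negP => bb.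
have : spk (s, true) = spk (s, false) by move: e bb; case: b b' => [] [].
have [d -> _] := spk_start s; have [l [r [er _ _ _ [d' -> _]]]] := spk_end s.
case=> ar _; have := pathU s; rewrite er ar /= inE mem_rcons inE eqxx orbT //.
Qed.

Lemma mult_spoke s (sg : spoke) p : inB p sg.1 -> (forall p', ~~ inB p' (mv sg)) ->
  mult sg (crn s) (hat s) = (spk (s, true) == sg) (+) (spk (s, false) == sg).
Proof.
move=> h1 h2; rewrite mult_hat mult_L1 ?mult_L2; try by right.
rewrite addbF; have [d e1 e1'] := spk_start s.
have [l [r [e _ _ m [d' e2 e2']]]] := spk_end s.
have rB : inB (node (s, false)) r by have := endP s; rewrite e last_rcons.
have nint x : x \in belast (b0 s) (l0 s) -> (x == sg.1) = false.
  by move=> /intP xo; apply/negbTE; apply: contraNneq (xo p) => ->.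
have bi : b0 s \in belast (b0 s) (l0 s) by rewrite e belast_rcons inE eqxx.
rewrite /mult e -cats1 /= psum_cat /= addbF -/(mult sg (b0 s) l).
rewrite mult0 /=; last first.
  by apply/negP => h; have := nint sg.1; rewrite e belast_rcons h eqxx => /(_ isT).
have -> : on_edge sg (a0 s) (b0 s) = (spk (s, true) == sg).
  rewrite e1 /on_edge (nint _ bi) /= orbF; case: (sg) => q dd /=.
  rewrite xpair_eqE; case: eqVneq => //= <-; rewrite e1'; apply/eqP/eqP => [/mv_inj|] -> //.
have -> // : on_edge sg (last (b0 s) l) r = (spk (s, false) == sg).
rewrite e2 /on_edge (nint _ m) /=; case: (sg) => q dd /=.
rewrite xpair_eqE; case: eqVneq => //= <-; rewrite e2'; apply/eqP/eqP => [/mv_inj|] -> //.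
Qed.

(** The ring of the rectangle, reduced to the spokes that start a path. The two cells beside a
    dropped spoke have the same colour, so the reduced list still matches cyclically. *)
Lemma rotation_list p : exists dl : seq D, [/\ uniq dl, (forall d, (d \in dl) = (node d == p)) &
  forall f : Z2 -> bool, (forall sg, inB p sg.1 -> (forall p', ~~ inB p' (mv sg)) -> (forall d, spk d != sg) ->
     f (cellL sg) = f (cellR sg)) ->
   cycle (fun d d' => f (cellR (spk d)) == f (cellL (spk d'))) dl].
Proof.
pose r := ring (rx p) (ry p) (rm p) (rk p).
pose g (sg : spoke) := [pick d | spk d == sg].
pose used (sg : spoke) := [exists d, spk d == sg].
have mapE r0 : map spk (pmap g r0) = filter used r0.
  elim: r0 => //= sg r0 IH; rewrite /oapp /g /used; case: pickP => [d /eqP e|no].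
    have -> : [exists d, spk d == sg] by apply/existsP; exists d; rewrite e.
    by rewrite /= IH e.
  have -> // : [exists d, spk d == sg] = false.
  by apply/negbTE; rewrite negb_exists; apply/forallP => d; rewrite no.
have rP sg : sg \in r -> inB p sg.1 /\ forall p', ~~ inB p' (mv sg).
  rewrite mem_ring => /andP[h1 h2]; split=> // p'; apply/negP => h3.
  by move: h2; rewrite (gap h1 h3) h3.
exists (pmap g r); split.
- by rewrite -(map_inj_uniq spk_inj) mapE filter_uniq // uniq_ring.
- move=> d; rewrite -(mem_map spk_inj) mapE mem_filter mem_ring.
  have -> /= : used (spk d) by apply/existsP; exists d.
  rewrite spk_out andbT; apply/idP/eqP => [h|<-]; last exact: spk_in.
  exact: gap0 (spk_in d) h.
- move=> f H; have [c e] := ring_chain (rx p) (ry p) (rm p) (rk p).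
  have [c' e'] := chain_map f c; rewrite e in e'.
  have Hr : {in r, forall y, ~~ used y -> (f \o cellL) y = (f \o cellR) y}.
    move=> sg /rP[h1 h2] nu /=; apply: H => // d.
    by move: nu; rewrite negb_exists => /forallP.
  have [c2 e2] := chain_filter Hr c'; rewrite -mapE in c2 e2.
  move: c2 e2; rewrite e'; case: (pmap g r) => // d l c2 e2.
  have := chain_cycle c2 e2; rewrite -[spk d :: _]/(map spk (d :: l)) => h.
  by move: h; rewrite cycle_map.
Qed.

Definition zcell (z : S -> bool) (c : Z2) : bool :=
  \big[addb/false]_s (z s && wind c (crn s) (hat s)).

Lemma zcell_jump z sg : (forall p, even_at node z p) ->
  zcell z (cellL sg) (+) zcell z (cellR sg) = \big[addb/false]_s (z s && mult sg (crn s) (hat s)).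
Proof.
move=> ev; rewrite -big_split /=.
transitivity (\big[addb/false]_s ((z s && mult sg (crn s) (hat s)) (+)
   (z s && (jump_pot sg (crn s) (+) jump_pot sg (corner (node (s, false))))))).
  apply: eq_bigr => s _; case: (z s) => //.
  by rewrite !andTb wind_jump ?hat_path // hat_last.
by rewrite big_split /= (even_sum (fun p => jump_pot sg (corner p)) ev) addbF.
Qed.

Lemma zcell_spoke z d : (forall p, even_at node z p) ->
  zcell z (cellL (spk d)) (+) zcell z (cellR (spk d)) = z d.1.
Proof.
move=> ev; rewrite zcell_jump //.
transitivity (\big[addb/false]_s (z s && (s == d.1))); last first.
  rewrite (bigD1 d.1) //= eqxx andbT big1 ?addbF // => s /negbTE ->.
  by rewrite andbF.
apply: eq_bigr => s _; congr (_ && _).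
rewrite (mult_spoke s (spk_in d) (spk_out d)) !(inj_eq spk_inj).
by case: d => t []; rewrite !xpair_eqE /= ?andbT ?andbF ?addbF.
Qed.

Lemma zcell_unused z p sg : (forall q, even_at node z q) -> inB p sg.1 -> (forall p', ~~ inB p' (mv sg)) ->
  (forall d, spk d != sg) -> zcell z (cellL sg) = zcell z (cellR sg).
Proof.
move=> ev h1 h2 h3; suff : zcell z (cellL sg) (+) zcell z (cellR sg) = false.
  by case: (zcell _ _) (zcell _ _) => [] [].
rewrite zcell_jump // big1 // => s _.
by rewrite (mult_spoke s h1 h2) !(negbTE (h3 _)) andbF.
Qed.

(** No other path passes through an inner point of this one, so jumps there come only from its own
    edges and [left_const] applies. *)
Lemma zcell_sides z s : (forall q, even_at node z q) ->
  zcell z (cellL (spk (s, true))) = zcell z (cellR (spk (s, false))) /\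
  zcell z (cellR (spk (s, true))) = zcell z (cellL (spk (s, false))).
Proof.
move=> ev; apply: left_const (pathP s) (pathU s) _ => q d qi nm.
suff : zcell z (cellL (q, d)) (+) zcell z (cellR (q, d)) = false.
  by case: (zcell _ _) (zcell _ _) => [] [].
rewrite zcell_jump // big1 // => t _; have out : forall p, ~~ inB p (q, d).1.
  by move=> p; apply: intP qi.
rewrite mult_hat mult_L1 ?mult_L2; try by left.
rewrite addbF; have [->|ne] := eqVneq t s; first by rewrite (negbTE nm) andbF.
rewrite addFb (_ : mult _ _ _ = false) ?andbF //; apply: mult0; apply: (@sep s); first by rewrite eq_sym.
by rewrite inE (mem_belast qi) orbT.
Qed.

(** The colour of [d] is that of the cell on the left of its spoke. The next spoke begins with the
    cell on the right, so [rho] crosses the spoke of [d]; and [alpha d] sees the path from its other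
    side. *)
Theorem discrete_rotation : exists rho : D -> D,
  [/\ injective rho, forall d, node (rho d) = node d,
      forall d d', node d = node d' -> fconnect rho d d' &
      forall z, (forall p, even_at node z p) -> let c d := zcell z (cellL (spk d)) in
        (forall d, c (rho d) = c d (+) z d.1) /\ (forall d, c d (+) c (alpha d) = z d.1)].
Proof.
have [dl dlP] := fin_all_exists rotation_list.
have U p := let: And3 u _ _ := dlP p in u.
have M p := let: And3 _ m _ := dlP p in m.
have C p := let: And3 _ _ c := dlP p in c.
pose rho d := next (dl (node d)) d.
have nr d : node (rho d) = node d.
  by apply/eqP; rewrite -M mem_next M.
exists rho; split=> //.
- move=> d d' e; have : node d = node d' by rewrite -nr e nr.
  by move: e; rewrite /rho => + nn; rewrite nn => /(can_inj (prev_next (U _))).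
- move=> d d' nn; have fc : fcycle rho (dl (node d)).
    rewrite (@eq_in_cycle _ (mem (dl (node d))) _ (frel (next (dl (node d))))).
    - exact: cycle_next.
    - move=> x y xd _; have /eqP e : node x == node d by rewrite -M.
      by rewrite /rho /= e.
    - exact/allP.
  by rewrite (fconnect_cycle fc) M ?nn.
move=> z ev c; split=> [d|[s b]].
  have cyc := C (node d) (zcell z) (fun sg h1 h2 h3 => zcell_unused ev h1 h2 h3).
  have := next_cycle cyc (_ : d \in dl (node d)); rewrite M eqxx => /(_ isT) /eqP e.
  rewrite /c /rho -e -(zcell_spoke d ev).
  by rewrite addbA addbb.
rewrite -(zcell_spoke (s, b) ev) /c; congr (_ (+) _).
by have [h1 h2] := zcell_sides s ev; case: b; rewrite /alpha /=; [rewrite -h2|rewrite h1].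
Qed.
End Discrete.

From mathcomp Require Import all_classical all_reals topology normedtype.
From mathcomp Require Import lra ring.
Import numFieldNormedType.Exports.
Local Open Scope classical_set_scope.
Local Open Scope ring_scope.

(** * Mod 2 winding numbers of plane curves *)

(* Hypotheses other than inequalities slow [lra] down considerably. *)
Ltac real_lra :=
  solve [repeat match goal with H : ?T |- _ =>
      lazymatch T with
      | is_true (Order.le _ _) => fail
      | is_true (Order.lt _ _) => fail
      | is_true (_ && _) => fail
      | _ => clear H
      end end; lra
    | lra].
Ltac lra_absurd x := exfalso; have : x < x; [real_lra|by rewrite ltxx].

Section Winding.
Variable R : realType.
Local Notation pl := (R * R)%type.
Implicit Types (a b c p q x y : pl) (r s e z t eta : R) (gam bet : R -> pl).

(* Parity of the crossings of the segment ab with the ray from p to the right;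
   meaningful only when p lies outside some box containing a and b. *)
Definition chi (a b p : pl) : bool :=
  ((p.2 < a.2) (+) (p.2 < b.2)) && (p.1 < a.1).

Definition nb (r : R) (a b : pl) : bool :=
  (`|a.1 - b.1| <= r) && (`|a.2 - b.2| <= r).

Lemma nbP r a b : reflect [/\ a.1 - r <= b.1, b.1 <= a.1 + r, a.2 - r <= b.2 & b.2 <= a.2 + r]
  (nb r a b).
Proof.
apply: (iffP andP); rewrite !ler_norml.
  by case=> /andP[? ?] /andP[? ?]; split; real_lra.
by case=> *; split; apply/andP; split; real_lra.
Qed.

Lemma nb_sym r a b : nb r a b = nb r b a.
Proof. by rewrite /nb distrC (distrC a.2). Qed.

Lemma nb_refl r a : 0 <= r -> nb r a a.
Proof. by move=> r0; rewrite /nb !subrr normr0 r0. Qed.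

Lemma nb_trans r s a b c : nb r a b -> nb s b c -> nb (r + s) a c.
Proof. by move=> /nbP[? ? ? ?] /nbP[? ? ? ?]; apply/nbP; split; real_lra. Qed.

Lemma nb_le r s a b : r <= s -> nb r a b -> nb s a b.
Proof. by move=> rs /nbP[? ? ? ?]; apply/nbP; split; real_lra. Qed.

(** For p to the left of the box, a crossing is a change of side with respect to the height of p; to
    the right of, above and below the box there are none. *)
Lemma chi_box r c p : ~~ nb r c p ->
  exists g : pl -> bool, forall a b, nb r c a -> nb r c b -> chi a b p = g a (+) g b.
Proof.
move=> np; case: (ltrP p.1 (c.1 - r)) => h1.
  exists (fun a => p.2 < a.2) => a b /nbP[? ? ? ?] _; rewrite /chi.
  have -> : p.1 < a.1 by real_lra.
  by rewrite andbT.
case: (ltrP (c.1 + r) p.1) => h2.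
  exists (fun a => false) => a b /nbP[? ? ? ?] _; rewrite /chi.
  have -> : (p.1 < a.1) = false by apply/negbTE; rewrite -leNgt; real_lra.
  by rewrite andbF.
exists (fun a => false) => a b /nbP[? ? ? ?] /nbP[? ? ? ?]; rewrite /chi.
case: (ltrP p.2 (c.2 - r)) => h3.
  by have [-> ->] : p.2 < a.2 /\ p.2 < b.2 by split; real_lra.
case: (ltrP (c.2 + r) p.2) => h4.
  have -> : (p.2 < a.2) = false by apply/negbTE; rewrite -leNgt; real_lra.
  by have -> : (p.2 < b.2) = false by apply/negbTE; rewrite -leNgt; real_lra.
by exfalso; move/negP: np; apply; apply/nbP; split; real_lra.
Qed.

(** Whether a lies between the rays from p and p'. A ray moving away from the box of a segment gains
    or loses crossings only at the ends of the segment. *)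
Definition dual_pot (p p' a : pl) : bool :=
  (p.1 < a.1) && ((p.2 < a.2) (+) (p'.2 < a.2)).

Lemma chi_dual r s c p p' a b : 0 <= s -> nb r c a -> nb r c b -> nb s p p' -> ~~ nb (r + s) c p ->
  chi a b p (+) chi a b p' = dual_pot p p' a (+) dual_pot p p' b.
Proof.
move=> s0 /nbP[a1 a2 a3 a4] /nbP[b1 b2 b3 b4] /nbP[p1 p2 p3 p4] np.
rewrite /chi /dual_pot.
have ge (x y : R) : y <= x -> (x < y) = false by move=> h; apply/negbTE; rewrite -leNgt.
case: (ltrP p.1 (c.1 - (r + s))) => h1.
  have -> : p.1 < a.1 by real_lra.
  have -> : p'.1 < a.1 by real_lra.
  have -> : p.1 < b.1 by real_lra.
  by do 4! case: (_ < _).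
case: (ltrP (c.1 + (r + s)) p.1) => h2.
  rewrite (ge p.1 a.1); last real_lra.
  rewrite (ge p'.1 a.1); last real_lra.
  rewrite (ge p.1 b.1); last real_lra.
  by rewrite !andbF.
case: (ltrP p.2 (c.2 - (r + s))) => h3.
  have -> : p.2 < a.2 by real_lra.
  have -> : p'.2 < a.2 by real_lra.
  have -> : p.2 < b.2 by real_lra.
  have -> : p'.2 < b.2 by real_lra.
  by rewrite /= !andbF.
case: (ltrP (c.2 + (r + s)) p.2) => h4.
  rewrite (ge p.2 a.2); last real_lra.
  rewrite (ge p'.2 a.2); last real_lra.
  rewrite (ge p.2 b.2); last real_lra.
  rewrite (ge p'.2 b.2); last real_lra.
  by rewrite /= !andbF.
by exfalso; move/negP: np; apply; apply/nbP; split; real_lra.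
Qed.

(** The uniform constants for curves below all come from this compactness argument; [g] cuts a
    closed part out of the rectangle. *)
Lemma compact_sep (f g : pl -> R) (a b c d : R) : continuous f -> continuous g ->
  (forall x, a <= x.1 <= b -> c <= x.2 <= d -> 0 <= g x -> f x != 0) ->
  exists2 eta : R, 0 < eta & forall x, a <= x.1 <= b -> c <= x.2 <= d -> 0 <= g x -> eta < `|f x|.
Proof.
move=> cf cg nz.
pose K := (`[a, b]%classic `*` `[c, d]%classic) `&` (g @^-1` [set y | 0 <= y]).
have KP x : K x <-> [/\ a <= x.1 <= b, c <= x.2 <= d & 0 <= g x].
  by rewrite /K /= !in_itv /=; split => [[[]]|[]].
have cK : compact K.
  apply: (@subclosed_compact _ _ (`[a, b]%classic `*` `[c, d]%classic)).
  - apply: closedI.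
      by apply: compact_closed; [exact: norm_hausdorff|apply: compact_setX; apply: segment_compact].
    by apply: preimage_closed; [move=> x _; exact: cg|exact: closed_ge].
  - by apply: compact_setX; apply: segment_compact.
  - by move=> x [].
have cfK : compact (f @` K).
  by apply: continuous_compact => //; apply: continuous_subspaceT.
have clfK : closed (f @` K) by apply: compact_closed => //; exact: norm_hausdorff.
have : nbhs (0 : R) (~` (f @` K)).
  apply: open_nbhs_nbhs; split; first by rewrite openC.
  by move=> [x /KP[h1 h2 h3] h4]; have := nz x h1 h2 h3; rewrite h4 eqxx.
case/nbhs_ballP => e /= e0 he; exists (e / 2); first by rewrite divr_gt0.
move=> x h1 h2 h3; rewrite ltNge; apply/negP => le.
have : ball (0 : R) e (f x).
  by rewrite /ball /= sub0r normrN; apply: (le_lt_trans le); real_lra.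
by move=> /he; apply; exists x => //; apply/KP.
Qed.

Section Curves.
Variables (gam bet : R -> pl).
Hypotheses (cg : continuous gam) (cb : continuous bet).

Definition l1 (p q : pl) : R := `|p.1 - q.1| + `|p.2 - q.2|.

Lemma l1_eq0 p q : (l1 p q == 0) = (p == q).
Proof.
rewrite /l1 paddr_eq0 ?normr_ge0 // !normr_eq0 !subr_eq0.
by case: p q => [a b] [c d].
Qed.

Lemma l1_nb p q e : e < l1 p q -> ~~ nb (e / 2) p q.
Proof. by rewrite /l1 => h; apply/negP => /andP[? ?]; real_lra. Qed.

Lemma nb_l1 p q e : ~~ nb e p q -> e <= l1 p q.
Proof.
rewrite /nb /l1 negb_and -!ltNge.
have := normr_ge0 (p.1 - q.1); have := normr_ge0 (p.2 - q.2).
by move=> ? ? /orP[] ?; real_lra.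
Qed.

Lemma l1_ge0 p q : 0 <= l1 p q.
Proof. by rewrite addr_ge0. Qed.

Lemma cont_fst (T : topologicalType) (f : T -> pl) : continuous f -> continuous (fun u => (f u).1).
Proof. by move=> cf u; apply: continuous_comp; [exact: cf|exact: cvg_fst]. Qed.

Lemma cont_snd (T : topologicalType) (f : T -> pl) : continuous f -> continuous (fun u => (f u).2).
Proof. by move=> cf u; apply: continuous_comp; [exact: cf|exact: cvg_snd]. Qed.

Lemma cont_l1 (T : topologicalType) (f g : T -> pl) : continuous f -> continuous g ->
  continuous (fun u => l1 (f u) (g u)).
Proof.
move=> cf cg' u; rewrite /l1; apply: cvgD.
  by apply: cvg_norm; apply: cvgB; [exact: (cont_fst cf)|exact: (cont_fst cg')].
by apply: cvg_norm; apply: cvgB; [exact: (cont_snd cf)|exact: (cont_snd cg')].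
Qed.

Lemma cont_diff : continuous (fun x : pl => `|x.1 - x.2| : R).
Proof.
by move=> x; apply: cvg_norm; apply: cvgB; [exact: cvg_fst|exact: cvg_snd].
Qed.

Lemma cont_l1_param : continuous (fun x : pl => l1 (gam x.1) (bet x.2)).
Proof.
apply: cont_l1 => x; apply: continuous_comp; try exact: cg; try exact: cb.
  exact: cvg_fst.
exact: cvg_snd.
Qed.
End Curves.

Lemma curve_sep gam bet (a b c d : R) : continuous gam -> continuous bet ->
  (forall t t', a <= t <= b -> c <= t' <= d -> gam t <> bet t') ->
  exists2 eta : R, 0 < eta & forall t t', a <= t <= b -> c <= t' <= d -> ~~ nb eta (gam t) (bet t').
Proof.
move=> cg cb ne.
have c0 : continuous (fun _ : pl => 0 : R) by move=> x; exact: cst_continuous.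
have [|e e0 he] := @compact_sep (fun x => l1 (gam x.1) (bet x.2)) (fun _ => 0) a b c d
  (cont_l1_param cg cb) c0.
  by move=> x h1 h2 _; rewrite l1_eq0; apply/eqP; apply: ne.
exists (e / 2); first by rewrite divr_gt0.
move=> t t' h1 h2; have := he (t, t') h1 h2 (lexx _).
by rewrite /= ger0_norm ?l1_ge0 // => /l1_nb.
Qed.

Lemma curve_away gam (a b : R) p : continuous gam -> (forall t, a <= t <= b -> gam t <> p) ->
  exists2 eta : R, 0 < eta & forall t, a <= t <= b -> ~~ nb eta (gam t) p.
Proof.
move=> cg ne; have cp : continuous (fun _ : R => p) by move=> x; exact: cst_continuous.
have [|e e0 he] := @curve_sep gam (fun _ => p) a b 0 0 cg cp; first by move=> t t' h _; apply: ne.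
by exists e => // t h; apply: (he t 0) => //; rewrite lexx.
Qed.

(** On the closed set of pairs with distant images, the difference of the parameters is bounded away
    from 0. *)
Lemma curve_unif gam (a b : R) e : continuous gam -> 0 < e ->
  exists2 z : R, 0 < z & forall t t', a <= t <= b -> a <= t' <= b -> `|t - t'| <= z -> nb e (gam t) (gam t').
Proof.
move=> cg e0.
have cd : continuous (fun x : pl => x.1 - x.2 : R).
  by move=> x; apply: cvgB; [exact: cvg_fst|exact: cvg_snd].
have cl : continuous (fun x : pl => l1 (gam x.1) (gam x.2) - e).
  by move=> x; apply: cvgB; [exact: cont_l1_param|exact: cvg_cst].
have [|z z0 hz] := @compact_sep (fun x => x.1 - x.2) (fun x => l1 (gam x.1) (gam x.2) - e) a b a b cd cl.
  move=> x _ _; apply: contraTneq => /eqP; rewrite subr_eq0 => /eqP ->.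
  have -> : l1 (gam x.2) (gam x.2) = 0 by apply/eqP; rewrite l1_eq0.
  by rewrite -ltNge; real_lra.
exists z => // t t' h1 h2 tz; apply/negPn/negP => /nb_l1 h.
have := hz (t, t') h1 h2; rewrite /= subr_ge0 => /(_ h); real_lra.
Qed.

Lemma curve_inv_unif gam (a b : R) z : continuous gam -> 0 < z ->
  (forall t t', a <= t <= b -> a <= t' <= b -> gam t = gam t' -> t = t') ->
  exists2 e : R, 0 < e & forall t t', a <= t <= b -> a <= t' <= b -> nb e (gam t) (gam t') -> `|t - t'| < z.
Proof.
move=> cg z0 inj.
have cd : continuous (fun x : pl => `|x.1 - x.2| - z : R).
  by move=> x; apply: cvgB; [exact: cont_diff|exact: cvg_cst].
have [|e e0 he] := @compact_sep (fun x => l1 (gam x.1) (gam x.2)) (fun x => `|x.1 - x.2| - z) a b a b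
  (cont_l1_param cg cg) cd.
  move=> x h1 h2 h3; rewrite l1_eq0; apply: contraTneq h3 => /inj -> //.
  by rewrite subrr normr0 -ltNge; real_lra.
exists (e / 2); first by rewrite divr_gt0.
move=> t t' h1 h2 h3; rewrite ltNge; apply/negP => h4.
have := he (t, t') h1 h2; rewrite /= subr_ge0 => /(_ h4).
rewrite ger0_norm ?l1_ge0 // => /l1_nb; by rewrite h3.
Qed.

(* [H] is a primitive of [chi] along [gam] for steps of length at most [z]. *)
Definition pot (gam : R -> pl) (a b : R) (p : pl) (H : R -> bool) (z : R) :=
  0 < z /\ forall t t', a <= t <= b -> a <= t' <= b -> `|t - t'| <= z ->
    chi (gam t) (gam t') p = H t (+) H t'.

Lemma loc_const (K : R -> bool) (a b : R) z : a <= b -> 0 < z ->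
  (forall t t', a <= t -> t <= t' -> t' <= b -> t' <= t + z -> K t = K t') -> K a = K b.
Proof.
move=> ab z0 HK.
have step k : K a = K (Num.min (a + z *+ k) b).
  elim: k => [|k IH]; first by rewrite mulr0n addr0 min_l.
  rewrite IH; apply: HK.
  - by rewrite le_min ab andbT lerDl mulrn_wge0 // ltW.
  - by rewrite le_min !ge_min lexx orbT andbT mulrS; apply/orP; left; real_lra.
  - by rewrite ge_min lexx orbT.
  - rewrite ge_min mulrS; case: (leP (a + z *+ k) b) => h; last first.
      by apply/orP; right; real_lra.
    by apply/orP; left; real_lra.
have [n hn] : exists n : nat, b - a <= z *+ n.
  have q0 : 0 <= (b - a) / z by rewrite divr_ge0 ?subr_ge0 // ltW.
  exists (Num.bound ((b - a) / z)); have := archi_boundP q0.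
  by rewrite ltr_pdivrMr // mulr_natl => /ltW.
by rewrite (step n) min_r //; real_lra.
Qed.

End Winding.

(** * Winding numbers as increments of a primitive *)

Section Crossing.
Variable R : realType.
Local Notation pl := (R * R)%type.
Implicit Types (gam bet : R -> pl) (p q x y : pl) (a b c d r s e t z m k eta : R).

Lemma potE gam a b p H z t t' : pot gam a b p H z -> a <= t -> t <= t' -> t' <= b -> t' <= t + z ->
  chi (gam t) (gam t') p = H t (+) H t'.
Proof.
move=> [z0 hz] h1 h2 h3 h4; apply: hz; try by apply/andP; split; real_lra.
by rewrite distrC ger0_norm ?subr_ge0 //; real_lra.
Qed.

Lemma pot_sub gam a b p H z c d : a <= c -> d <= b -> pot gam a b p H z -> pot gam c d p H z.
Proof.
move=> ac db [z0 hz]; split=> // t t' /andP[? ?] /andP[? ?]; apply: hz; apply/andP; split; real_lra.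
Qed.

Lemma addb4 (x y z w : bool) : x (+) y = z (+) w -> x (+) z = y (+) w.
Proof. by case: x y z w => [] [] [] []. Qed.

(** The sum modulo 2 of two primitives is locally constant. *)
Lemma pot_unique gam a b p H z H' z' : a <= b -> pot gam a b p H z -> pot gam a b p H' z' ->
  H a (+) H b = H' a (+) H' b.
Proof.
move=> ab hz hz'; apply: addb4.
have z0 : 0 < Num.min z z' by rewrite lt_min hz.1 hz'.1.
apply: (@loc_const _ (fun t => H t (+) H' t) a b _ ab z0) => t t' h1 h2 h3.
rewrite -lerBlDl le_min => /andP[h4 h5]; apply: addb4.
by rewrite -(potE hz) // -?(potE hz') //; real_lra.
Qed.

(* Parity of the crossings of gam([a,b]) with the ray from p: for a closed curve,
   the mod 2 winding number around p.  Junk value false if the curve meets p. *)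
Definition Xl gam a b p : bool := `[< exists H z, pot gam a b p H z /\ H a (+) H b >].

Lemma XlE gam a b p H z : a <= b -> pot gam a b p H z -> Xl gam a b p = H a (+) H b.
Proof.
move=> ab hz; apply/idP/idP.
  by move=> /asboolP[H' [z' [hz']]]; rewrite (pot_unique ab hz' hz).
by move=> h; apply/asboolP; exists H, z.
Qed.

Lemma pot_exists gam a b p : continuous gam -> (forall t, a <= t <= b -> gam t <> p) ->
  exists H z, pot gam a b p H z.
Proof.
move=> cg ne; have [e e0 he] := curve_away cg ne.
have [z z0 hz] := @curve_unif _ gam a b e cg e0.
pose d := z / 2.
have d0 : 0 < d by rewrite divr_gt0.
have dz : d <= z by rewrite /d; real_lra.
pose k t := Num.trunc ((t - a) / d); pose s i := a + d *+ i.
(* The crossings of the polygon through the grid points before t, followed by one last piece up to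
   t. *)
pose H t := \big[addb/false]_(i < k t) chi (gam (s i)) (gam (s i.+1)) p (+) chi (gam (s (k t))) (gam t) p.
have kP t : a <= t -> s (k t) <= t < s (k t).+1.
  move=> ht; have q0 : 0 <= (t - a) / d by rewrite divr_ge0 ?subr_ge0 // ltW.
  have := truncn_itv q0.
  rewrite ler_pdivlMr // ltr_pdivrMr // !mulr_natl /s /k => /andP[? ?].
  by apply/andP; split; real_lra.
have key t t' : a <= t -> t <= t' -> t' <= b -> t' <= t + d ->
    chi (gam t) (gam t') p = H t (+) H t' /\ chi (gam t') (gam t) p = H t (+) H t'.
  move=> h1 h2 h3 h4.
  have [|g hg] := chi_box (he t _); first by apply/andP; split; real_lra.
  have /andP[k1 k2] := kP t h1; have /andP[k3 k4] := kP t' (le_trans h1 h2).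
  have s0 i : a <= s i by rewrite /s lerDl mulrn_wge0 // ltW.
  have sS i : s i.+1 = s i + d by rewrite /s mulrS; real_lra.
  have nn u : a <= u -> u <= b -> `|t - u| <= z -> nb e (gam t) (gam u).
    by move=> *; apply: hz => //; apply/andP; split; real_lra.
  have n0 : nb e (gam t) (gam t) by apply: nn; rewrite ?subrr ?normr0; real_lra.
  have n1 : nb e (gam t) (gam t').
    by apply: nn; try real_lra; rewrite distrC ger0_norm ?subr_ge0 //; rewrite /d in h4; real_lra.
  rewrite sS in k2; rewrite sS in k4.
  have n2 : nb e (gam t) (gam (s (k t))).
    by apply: nn => //; try real_lra; rewrite ger0_norm ?subr_ge0 //; rewrite /d in k2; real_lra.
  rewrite !hg // (addbC (g (gam t'))); suff -> : g (gam t) (+) g (gam t') = H t (+) H t' by [].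
  have le_s i j : (i <= j)%N -> s i <= s j.
    by move=> ij; rewrite /s lerD2l -[_ *+ i]mulr_natr -[_ *+ j]mulr_natr ler_wpM2l ?ler_nat // ltW.
  have kk : (k t <= k t')%N.
    rewrite leqNgt; apply/negP => lt; have := le_s _ _ lt; rewrite sS; real_lra.
  have kk' : (k t' <= (k t).+1)%N.
    rewrite leqNgt; apply/negP => lt; have := le_s _ _ lt; rewrite !sS; real_lra.
  have [ke|ke] : (k t' = k t \/ k t' = (k t).+1)%N by move: kk kk'; clear; lia.
    rewrite /H ke !hg //; move: (\big[_/_]_(_ < _) _) => B.
    move: B (g _) (g _) (g _); bool_cases.
  have n3 : nb e (gam t) (gam (s (k t'))).
    rewrite ke sS in k3 *; apply: nn; [real_lra|real_lra|rewrite distrC ger0_norm; real_lra].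
  rewrite /H ke big_ord_recr /= -ke !hg //; move: (\big[_/_]_(_ < _) _) => B.
  move: B (g _) (g _) (g _) (g _); bool_cases.
exists H, d; split=> // t t' /andP[h1 h2] /andP[h3 h4] h5.
case: (lerP t t') => h6.
  by have [] := key t t' h1 h6 h4; first by move: h5; rewrite distrC ger0_norm ?subr_ge0 //; real_lra.
have [|] := key t' t h3 (ltW h6) h2; last by rewrite addbC.
by move: h5; rewrite ger0_norm ?subr_ge0 ?(ltW h6) //; real_lra.
Qed.

Lemma Xl_cat gam a b c p : continuous gam -> a <= b -> b <= c -> (forall t, a <= t <= c -> gam t <> p) ->
  Xl gam a c p = Xl gam a b p (+) Xl gam b c p.
Proof.
move=> cg ab bc ne; have [H [z hz]] := pot_exists cg ne.
rewrite (XlE (le_trans ab bc) hz) (XlE ab (pot_sub (lexx _) bc hz)) (XlE bc (pot_sub ab (lexx _) hz)).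
by case: (H a) (H b) (H c) => [] [] [].
Qed.

Lemma pot_box gam a b p H z q r : pot gam a b p H z -> a <= b ->
  (forall t, a <= t <= b -> nb r q (gam t)) -> ~~ nb r q p -> H a (+) H b = chi (gam a) (gam b) p.
Proof.
move=> hz ab hb np; have [g hg] := chi_box np.
rewrite hg; try by apply: hb; apply/andP; split; real_lra.
apply: addb4; apply: (@loc_const _ (fun t => H t (+) g (gam t)) a b _ ab hz.1) => t t' h1 h2 h3 h4.
apply: addb4; rewrite -(potE hz) // hg //; apply: hb; apply/andP; split; real_lra.
Qed.

Lemma Xl_box gam a b p q r : continuous gam -> a <= b ->
  (forall t, a <= t <= b -> nb r q (gam t)) -> ~~ nb r q p -> Xl gam a b p = chi (gam a) (gam b) p.
Proof.
move=> cg ab hb np; have [|H [z hz]] := @pot_exists gam a b p cg.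
  by move=> t /hb h tp; rewrite tp (negbTE np) in h.
by rewrite (XlE ab hz); apply: pot_box hz _ hb _.
Qed.

(** Here p keeps a distance r from the curve and moves by s < r. The change is a difference of end
    terms, so it vanishes on closed curves. *)
Lemma Xl_dual gam a b p p' r s : continuous gam -> a <= b -> 0 <= s -> s < r ->
  (forall t, a <= t <= b -> ~~ nb r (gam t) p) -> nb s p p' ->
  Xl gam a b p (+) Xl gam a b p' = dual_pot p p' (gam a) (+) dual_pot p p' (gam b).
Proof.
move=> cg ab s0 sr aw pp.
have [|H [z hz]] := @pot_exists gam a b p cg.
  by move=> t /aw h tp; rewrite tp nb_refl in h; real_lra.
have [|H' [z' hz']] := @pot_exists gam a b p' cg.
  by move=> t /aw h tp; rewrite tp nb_sym (nb_le _ pp) in h; real_lra.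
rewrite (XlE ab hz) (XlE ab hz').
have rs0 : 0 < (r - s) / 2 by real_lra.
have [w w0 hw] := @curve_unif _ gam a b _ cg rs0.
have m0 : 0 < Num.min w (Num.min z z') by rewrite !lt_min w0 hz.1 hz'.1.
suff E : H a (+) H' a (+) dual_pot p p' (gam a) = H b (+) H' b (+) dual_pot p p' (gam b).
  by move: E; case: (H a) (H b) (H' a) (H' b) (dual_pot _ _ _) (dual_pot _ _ _) => [] [] [] [] [] [].
apply: (@loc_const _ (fun t => H t (+) H' t (+) dual_pot p p' (gam t)) a b _ ab m0) => t t' h1 h2 h3.
rewrite -lerBlDl !le_min => /and3P[h4 h5 h6].
have tI : a <= t <= b by apply/andP; split; real_lra.
have tI' : a <= t' <= b by apply/andP; split; real_lra.
have n1 : nb ((r - s) / 2) (gam t) (gam t).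
  by apply: nb_refl; real_lra.
have n2 : nb ((r - s) / 2) (gam t) (gam t').
  by apply: hw => //; rewrite distrC ger0_norm ?subr_ge0.
have aw' : ~~ nb ((r - s) / 2 + s) (gam t) p.
  by apply: contra (aw t tI); apply: nb_le; real_lra.
have := chi_dual s0 n1 n2 pp aw'; rewrite (potE hz) ?(potE hz') //; try real_lra.
move: (H t) (H t') (H' t) (H' t') (dual_pot _ _ _) (dual_pot _ _ _); bool_cases.
Qed.

Lemma Xl_reparam gam a b m k p : continuous gam -> a <= b -> 0 < k ->
  (forall t, a <= t <= b -> gam (m + k * t) <> p) ->
  Xl (fun t => gam (m + k * t)) a b p = Xl gam (m + k * a) (m + k * b) p.
Proof.
move=> cg ab k0 ne.
have le u v : (m + k * u <= m + k * v) = (u <= v) by rewrite lerD2l ler_pM2l.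
have [|H [z hz]] := @pot_exists gam (m + k * a) (m + k * b) p cg.
  move=> t /andP[h1 h2]; have -> : t = m + k * ((t - m) / k).
    by rewrite mulrCA divff ?gt_eqF // mulr1; real_lra.
  by apply: ne; rewrite ler_pdivlMr // ler_pdivrMr // !(mulrC _ k); apply/andP; split; real_lra.
rewrite (XlE _ hz) ?le //.
apply: (@XlE _ _ _ _ (fun t => H (m + k * t)) (z / k)) => //; split.
  by rewrite divr_gt0 // hz.1.
move=> t t' h1 h2 h3; apply: hz.2; rewrite ?le //.
by rewrite opprD addrACA subrr add0r -mulrBr normrM gtr0_norm // -ler_pdivlMl // mulrC.
Qed.

Lemma Xl_rev gam m a b p : continuous gam -> a <= b -> (forall t, a <= t <= b -> gam t <> p) ->
  Xl (fun t => gam (m - t)) (m - b) (m - a) p = Xl gam a b p.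
Proof.
move=> cg ab ne; have [H [z hz]] := pot_exists cg ne.
rewrite (XlE ab hz) (@XlE _ _ _ _ (fun t => H (m - t)) z) ?lerB //.
  have rr (u : R) : m - (m - u) = u by rewrite opprB addrC subrK.
  by rewrite !rr addbC.
split; first exact: hz.1.
move=> t t' /andP[? ?] /andP[? ?] h; apply: hz.2; try (apply/andP; split; real_lra).
by have -> : m - t - (m - t') = t' - t by [lra]; rewrite distrC.
Qed.

(** By injectivity, points close to each other and to the arc have close parameters. The primitive
    along the arc therefore extends to a primitive [G] for short steps near it, and any chain of
    such steps between its ends has the winding increment of the arc. *)
Lemma space_pot gam a b p : continuous gam -> a <= b ->
  (forall t t', a <= t <= b -> a <= t' <= b -> gam t = gam t' -> t = t') ->
  (forall t, a <= t <= b -> gam t <> p) ->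
  exists2 eta : R, 0 < eta & exists G : pl -> bool,
    (forall x y t t', a <= t <= b -> a <= t' <= b -> nb eta (gam t) x -> nb eta (gam t') y -> nb eta x y ->
      chi x y p = G x (+) G y) /\ Xl gam a b p = G (gam a) (+) G (gam b).
Proof.
move=> cg ab inj ne.
have [e e0 he] := curve_away cg ne.
have [H [z hz]] := pot_exists cg ne.
have [z1 z10 hz1] := @curve_unif _ gam a b (e / 4) cg (divr_gt0 e0 (ltr0Sn _ 3)).
have zz0 : 0 < Num.min z z1 by rewrite lt_min hz.1.
have [n n0 hn] := curve_inv_unif cg zz0 inj.
(* Two points of the arc joined by three steps of size [eta] must have close parameters, and all
   points compared must fit in a box of radius e that misses p. *)
pose eta := Num.min (n / 3) (e / 4).
have eta0 : 0 < eta by rewrite lt_min !divr_gt0.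
have en : eta <= n / 3 by rewrite ge_min lexx.
have ee : eta <= e / 4 by rewrite ge_min lexx orbT.
have [T hT] : exists T : pl -> R, forall x, (exists2 t, a <= t <= b & nb eta (gam t) x) ->
    a <= T x <= b /\ nb eta (gam (T x)) x.
  have /choice[T hT] : forall x, exists t, (exists2 t, a <= t <= b & nb eta (gam t) x) ->
      a <= t <= b /\ nb eta (gam t) x.
    move=> x; have [[t h1 h2]|no] := pselect (exists2 t, a <= t <= b & nb eta (gam t) x).
      by exists t.
    by exists 0.
  by exists T.
pose G x := H (T x) (+) chi (gam (T x)) x p.
have close t t' x y : a <= t <= b -> a <= t' <= b -> nb eta (gam t) x -> nb eta (gam t') y -> nb eta x y ->
    chi (gam t) (gam t') p = H t (+) H t' /\ nb (e / 4) (gam t) (gam t').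
  move=> h1 h2 h3 h4 h5; have : nb n (gam t) (gam t').
    apply: (nb_le (r := eta + (eta + eta))); first real_lra.
    by apply: (nb_trans h3); apply: (nb_trans h5); rewrite nb_sym.
  move=> /(hn _ _ h1 h2); rewrite lt_min => /andP[h6 h7]; split; first by apply: hz.2 => //; apply: ltW.
  by apply: hz1 => //; apply: ltW.
exists eta => //; exists G; split.
  move=> x y t t' ht ht' tx ty xy.
  have [|h1 h2] := hT x; first by exists t.
  have [|h3 h4] := hT y; first by exists t'.
  have [c1 c2] := close _ _ _ _ h1 h3 h2 h4 xy.
  have [g hg] := chi_box (he _ h1).
  have n1 : nb e (gam (T x)) (gam (T x)) by apply: nb_refl; real_lra.
  have n2 : nb e (gam (T x)) x by apply: nb_le h2; real_lra.
  have n3 : nb e (gam (T x)) (gam (T y)) by apply: nb_le c2; real_lra.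
  have n4 : nb e (gam (T x)) y.
    by apply: (nb_le (r := e / 4 + eta)); [real_lra|exact: nb_trans c2 h4].
  have n5 : chi (gam (T y)) y p = g (gam (T y)) (+) g y by apply: hg.
  move: c1; rewrite /G n5 !hg //.
  move: (H _) (H _) (g _) (g _) (g _) (g _); bool_cases.
rewrite (XlE ab hz); suff E t : a <= t <= b -> G (gam t) = H t by rewrite !E ?lexx ?ab.
move=> ht; have [|h1 h2] := hT (gam t); first by exists t => //; apply: nb_refl; real_lra.
have nn : nb eta (gam t) (gam t) by apply: nb_refl; real_lra.
have [c1 _] := close _ _ _ _ h1 ht h2 nn nn.
by rewrite /G c1 addbA addbb.
Qed.

End Crossing.

(** * Approximating curves by lattice paths *)

Section Cut.
Variables (T : eqType) (e : rel T) (A B : pred T).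

Lemma cut_last x l : path e x l -> uniq (x :: l) -> A x ->
  exists a l', [/\ path e a l', uniq (a :: l'), A a /\ last a l' = last x l,
    {in l', forall q, ~~ A q} & {subset a :: l' <= x :: l}].
Proof.
have [n] := ubnP (size l); elim: n x l => // n IH x l ln pl ul Ax.
have [/hasP[w wl Aw]|no] := boolP (has A l); last first.
  exists x, l; split=> // q ql.
  by apply: contra no => Aq; apply/hasP; exists q.
case/splitPr: wl pl ul ln => l1 l2; rewrite cat_path => /andP[_ /= /andP[_ p2]] ul ln.
have u2 : uniq (w :: l2) by case/andP: ul => _; rewrite cat_uniq => /and3P[].
have [|a [l' [h1 h2 [h3 h4] h5 h6]]] := IH w l2 _ p2 u2 Aw.
  by move: ln; rewrite size_cat /=; lia.
exists a, l'; split=> //; first by rewrite h4 last_cat.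
by move=> q /h6 h; rewrite inE mem_cat h !orbT.
Qed.

Lemma cut_first a l : path e a l -> uniq (a :: l) -> ~~ B a -> B (last a l) ->
  exists l', [/\ path e a l', uniq (a :: l'), B (last a l'),
    {in belast a l', forall q, ~~ B q} & {subset l' <= l}].
Proof.
elim: l a => [|y l IH] a /=; first by move=> _ _ /negbTE ->.
case/andP=> ay pl /andP[na ul] nB Bl.
have [By|nBy] := boolP (B y).
  exists [:: y]; split=> //=; rewrite ?ay //.
  - by move: na; rewrite !inE negb_or => /andP[->].
  - by move=> q; rewrite inE => /eqP ->.
  - by move=> q; rewrite !inE => ->.
have [l' [h1 h2 h3 h4 h5]] := IH y pl ul nBy Bl.
exists (y :: l'); split=> //=; rewrite ?ay //.
- move: h2 => /= ->; rewrite andbT; apply: contra na; rewrite !inE => /orP[->//|/h5 ->].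
  by rewrite orbT.
- by move=> q; rewrite inE => /orP[/eqP ->//|]; apply: h4.
- by move=> q; rewrite !inE => /orP[->//|/h5 ->]; rewrite orbT.
Qed.

Hypothesis AB : forall q, A q -> ~~ B q.

(** Remove the loops, start at the last visit to A and stop at the first visit to B after it. *)
Lemma cut_path x l : path e x l -> A x -> B (last x l) ->
  exists a b l', [/\ path e a (b :: l'), uniq (a :: b :: l'), A a /\ B (last b l'),
    {in belast b l', forall q, ~~ A q && ~~ B q} & {subset a :: b :: l' <= x :: l}].
Proof.
move=> pl Ax; case: (shortenP pl) => l1 p1 u1 s1 Bl.
have [a [l2 [h1 h2 [h3 h4] h5 h6]]] := cut_last p1 u1 Ax.
have [||l3 [k1 k2 k3 k4 k5]] := cut_first h1 h2; rewrite ?h4 ?(AB h3) //.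
case: l3 k1 k2 k3 k4 k5 => [|b l'] k1 k2 k3 k4 k5; first by rewrite (negbTE (AB h3)) in k3.
exists a, b, l'; split=> //.
  move=> q qb; rewrite k4 ?inE ?qb ?orbT // andbT h5 // k5 //.
  by rewrite (mem_belast qb).
move=> q; rewrite inE => /orP[/eqP ->|/k5 ql].
  have := h6 a; rewrite inE eqxx => /(_ isT); rewrite !inE => /orP[->//|/s1 ->].
  by rewrite orbT.
have := h6 q; rewrite inE ql orbT => /(_ isT); rewrite !inE => /orP[->//|/s1 ->].
by rewrite orbT.
Qed.
End Cut.

(** * Rounding a curve to a lattice of mesh h *)

Section Embedding.
Variables (R : realType) (h : R).
Hypothesis h0 : 0 < h.
Local Notation pl := (R * R)%type.
Local Notation Z2 := (int * int)%type.
Implicit Types (gam : R -> pl) (p : pl) (q : Z2).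

Definition lp (q : Z2) : pl := (q.1%:~R * h, q.2%:~R * h).
Definition rd (x : pl) : Z2 := (Num.floor (x.1 / h), Num.floor (x.2 / h)).
Definition center (q : Z2) : pl := ((q.1%:~R + 2^-1) * h, (q.2%:~R + 2^-1) * h).

Lemma floor_mul (x : R) : (Num.floor (x / h))%:~R * h <= x < (Num.floor (x / h))%:~R * h + h.
Proof.
have /andP[h1 h2] := floor_itv (x / h).
rewrite -ler_pdivlMr // h1 /=; move: h2; rewrite intrD ltr_pdivrMr // mulrDl mul1r.
by [].
Qed.

Lemma rdP x : nb h x (lp (rd x)).
Proof.
have hp := h0.
have /andP[a1 a2] := floor_mul x.1; have /andP[b1 b2] := floor_mul x.2.
by apply/nbP; rewrite /lp /rd /=; split; real_lra.
Qed.

Lemma floor_close (x y : R) : x <= y -> y <= x + h ->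
  Num.floor (y / h) = Num.floor (x / h) \/ Num.floor (y / h) = Num.floor (x / h) + 1.
Proof.
have hp := h0.
move=> xy yx.
have l1 : Num.floor (x / h) <= Num.floor (y / h) by apply: le_floor; rewrite ler_pM2r ?invr_gt0.
have l2 : Num.floor (y / h) <= Num.floor (x / h) + 1.
  have /andP[_ lt] := floor_itv (x / h).
  rewrite -ltzD1 -(ltr_int R); apply: (le_lt_trans (floor_le _)).
  rewrite intrD; apply: (le_lt_trans (y := x / h + 1)); last by rewrite ltrD2r.
  by rewrite ler_pdivrMr // mulrDl mul1r divfK ?gt_eqF.
lia.
Qed.

Lemma rd_adj x y : nb h x y -> adj (rd x) ((rd y).1, (rd x).2) /\ adj ((rd y).1, (rd x).2) (rd y).
Proof.
have hp := h0.
have key (u v : R) : u - h <= v -> v <= u + h -> `|Num.floor (u / h) - Num.floor (v / h)| <= 1.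
  move=> uv vu; case: (lerP u v) => le.
    by case: (floor_close le vu) => ->; lia.
  have uv' : u <= v + h by real_lra.
  by case: (floor_close (ltW le) uv') => ->; lia.
case/nbP => h1 h2 h3 h4; rewrite /adj /rd /= subrr normr0 addr0 subrr normr0 add0r.
by split; apply: key.
Qed.

Lemma nb_lp_adj q q' : adj q q' -> nb h (lp q) (lp q').
Proof.
have hp := h0.
have hh (x : R) : (x + 1%:~R) * h = x * h + h by rewrite mulrDl mul1r.
have hh' (x : R) : (x - 1%:~R) * h = x * h - h by rewrite mulrBl mul1r.
case: q => x y /adjP[->|[->|[->|[->|->]]]]; apply/nbP; rewrite /lp /= ?(intrD, intrB, hh, hh'); split; real_lra.
Qed.

Lemma chi_center q a b : chi (lp a) (lp b) (center q) = chid q a b.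
Proof.
have lt (i j : int) : ((i%:~R + 2^-1) * h < j%:~R * h) = (i < j).
  rewrite ltr_pM2r //; apply/idP/idP => ij.
    rewrite -(ltr_int R); real_lra.
  have : (i + 1)%:~R <= j%:~R :> R by rewrite ler_int; lia.
  by rewrite intrD; real_lra.
by rewrite /chi /chid /lp /center /= !lt.
Qed.

Lemma wind_center q a l : psum (fun x y => chi (lp x) (lp y) (center q)) a l = wind q a l.
Proof. by rewrite /wind; elim: l a => //= b l IH a; rewrite IH chi_center. Qed.

(** The curve is followed in short steps, each lying with its roundings in a box that misses p. The
    two terms [chi] join the ends of the curve to their rounded points. *)
Lemma lattice_path gam (a b : R) : continuous gam -> a <= b ->
  exists l, [/\ path adj (rd (gam a)) l, last (rd (gam a)) l = rd (gam b),
    forall q, q \in rd (gam a) :: l -> exists2 t, a <= t <= b & nb (2 * h) (gam t) (lp q) &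
    forall p, (forall t, a <= t <= b -> ~~ nb (4 * h) (gam t) p) ->
      psum (fun x y => chi (lp x) (lp y) p) (rd (gam a)) l =
      Xl gam a b p (+) (chi (gam a) (lp (rd (gam a))) p (+) chi (gam b) (lp (rd (gam b))) p)].
Proof.
have hp := h0.
move=> cg ab; have [z z0 hz] := @curve_unif _ gam a b h cg h0.
have [n hn] : exists n : nat, b <= a + z *+ n.
  have q0 : 0 <= (b - a) / z by rewrite divr_ge0 ?subr_ge0 // ltW.
  exists (Num.bound ((b - a) / z)); have := archi_boundP q0.
  by rewrite ltr_pdivrMr // mulr_natl; real_lra.
suff H : forall b', a <= b' -> b' <= b -> b' <= a + z *+ n ->
  exists l, [/\ path adj (rd (gam a)) l, last (rd (gam a)) l = rd (gam b'),
    forall q, q \in rd (gam a) :: l -> exists2 t, a <= t <= b' & nb (2 * h) (gam t) (lp q) &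
    forall p, (forall t, a <= t <= b' -> ~~ nb (4 * h) (gam t) p) ->
      psum (fun x y => chi (lp x) (lp y) p) (rd (gam a)) l =
      Xl gam a b' p (+) (chi (gam a) (lp (rd (gam a))) p (+) chi (gam b') (lp (rd (gam b'))) p)].
  exact: H.
have n2h (x : R * R) q : nb h x (lp q) -> nb (2 * h) x (lp q).
  apply: nb_le; real_lra.
elim: n {hn} => [|n IH] b' ab' bb' hb'.
  have e : b' = a by move: hb'; rewrite mulr0n; real_lra.
  exists [::]; rewrite e; split=> //.
    by move=> q; rewrite inE => /eqP ->; exists a; [rewrite lexx|apply/n2h/rdP].
  move=> p aw; rewrite addbb addbF /= (@Xl_box _ gam a a p (gam a) h) //.
  - by apply/esym; rewrite /chi addbb.
  - move=> t /andP[? ?]; have -> : t = a by real_lra.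
    by apply: nb_refl; real_lra.
  - by apply: contra (aw a _); [apply: nb_le; real_lra|rewrite !lexx].
pose m := Num.max a (b' - z).
have am : a <= m by rewrite le_max lexx.
have mb : m <= b' by rewrite ge_max ab'; real_lra.
have mz : b' - z <= m by rewrite le_max lexx orbT.
have mn : m <= a + z *+ n.
  by rewrite ge_max; move: hb'; rewrite mulrS => ?; apply/andP; split; [rewrite lerDl mulrn_wge0 // ltW|real_lra].
have [|l [h1 h2 h3 h4]] := IH m am _ mn; first by real_lra.
have near t : m <= t <= b' -> nb h (gam b') (gam t).
  move=> /andP[? ?]; apply: hz; try (apply/andP; split; real_lra).
  by rewrite ger0_norm; real_lra.
have nmb : nb h (gam m) (gam b') by rewrite nb_sym; apply: near; rewrite lexx mb.
have [a1 a2] := rd_adj nmb.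
pose c : Z2 := ((rd (gam b')).1, (rd (gam m)).2).
have nc : nb (2 * h) (gam b') (lp c).
  have /nbP[] := rdP (gam b'); have /nbP[] := rdP (gam m); have /nbP[? ? ? ?] := nmb.
  rewrite /lp /= => ? ? ? ? ? ? ? ?.
  by apply/nbP; rewrite /lp /c /=; split; real_lra.
exists (l ++ [:: c; rd (gam b')]); split.
- by rewrite cat_path h1 /= h2 a1 a2.
- by rewrite last_cat.
- move=> q; rewrite -cat_cons mem_cat => /orP[/h3[t /andP[? ?] ?]|].
    by exists t => //; apply/andP; split; real_lra.
  rewrite !inE => qq; exists b'; first by rewrite ab' lexx.
  by case/orP: qq => /eqP ->; [exact: nc|apply/n2h/rdP].
- move=> p aw; rewrite psum_cat h4; last by move=> t /andP[? ?]; apply: aw; apply/andP; split; real_lra.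
  have np2 : ~~ nb (2 * h) (gam b') p.
    by apply: contra (aw b' _); [apply: nb_le; real_lra|rewrite ab' lexx].
  have npt t : a <= t <= b' -> gam t <> p.
    by move=> /aw h5 e; rewrite e nb_refl in h5; real_lra.
  rewrite (Xl_cat cg am mb npt) h2 /=.
  rewrite (@Xl_box _ gam m b' p (gam b') (2 * h)) //; last first.
    by move=> t /near; apply: nb_le; real_lra.
  have [g hg] := chi_box np2.
  have r1 : nb (2 * h) (gam b') (gam m) by rewrite nb_sym; apply: nb_le nmb; real_lra.
  have r2 : nb (2 * h) (gam b') (gam b') by apply: nb_refl; real_lra.
  have r3 : nb (2 * h) (gam b') (lp (rd (gam b'))) by apply/n2h/rdP.
  have r4 : nb (2 * h) (gam b') (lp (rd (gam m))).
    apply: (nb_le (r := h + h)); first real_lra.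
    by apply: (nb_trans (b := gam m)); [rewrite nb_sym|exact: rdP].
  rewrite (hg (lp (rd (gam m))) (lp c)) // (hg (lp c)) // (hg (gam m) (gam b')) //.
  rewrite (hg (gam m) (lp (rd (gam m)))) // (hg (gam b') (lp (rd (gam b')))) //.
  move: (Xl gam a m p) (chi (gam a) _ p) (g _) (g _) (g _) (g _) (g _) => A B C D E F G.
  move: A B C D E F G; bool_cases.
Qed.
End Embedding.

(** * Rotation systems of plane graphs *)

Lemma fin_eps (R : realType) (I : finType) (Q : I -> R -> Prop) :
  (forall i e e', 0 < e' -> e' <= e -> Q i e -> Q i e') ->
  (forall i, exists2 e : R, 0 < e & Q i e) -> exists2 e : R, 0 < e & forall i, Q i e.
Proof.
move=> mono H.
suff K (s : seq I) : exists2 e : R, 0 < e & forall i, i \in s -> Q i e.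
  by have [e e0 he] := K (enum I); exists e => // i; apply: he; rewrite mem_enum.
elim: s => [|i s [e e0 he]]; first by exists 1.
have [e' e0' he'] := H i; exists (Num.min e e'); first by rewrite lt_min e0.
have m0 : 0 < Num.min e e' by rewrite lt_min e0.
move=> j; rewrite inE => /orP[/eqP ->|/he].
  by apply: mono he'; rewrite ?ge_min ?lexx ?orbT.
by apply: mono; rewrite ?ge_min ?lexx.
Qed.

Lemma adj_mv_self (sg : (int * int) * (bool * bool)) : adj sg.1 (mv sg).
Proof. case: sg => -[x y] [[] []]; rewrite /adj /mv /=; lia. Qed.

Lemma in_rect_corner x y m k : in_rect x y m k (x, y).
Proof. by rewrite /in_rect /= !lexx !lerDl. Qed.

Lemma nb_cellL (R : realType) (h : R) sg : 0 < h -> nb h (lp h sg.1) (center h (cellL sg)).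
Proof.
move=> h0; have hh (x : R) : (x + 2^-1) * h = x * h + h / 2 by rewrite mulrDl; congr (_ + _); rewrite mulrC.
have hh' (x : R) : (x - 1%:~R + 2^-1) * h = x * h - h / 2 by rewrite hh mulrBl mul1r; lra.
case: sg => -[x y] [[] []]; apply/nbP; rewrite /lp /center /cellL /= ?intrB ?hh' ?hh; split; lra.
Qed.

Lemma nb_cellR (R : realType) (h : R) sg : 0 < h -> nb h (lp h sg.1) (center h (cellR sg)).
Proof.
move=> h0; have hh (x : R) : (x + 2^-1) * h = x * h + h / 2 by rewrite mulrDl; congr (_ + _); rewrite mulrC.
have hh' (x : R) : (x - 1%:~R + 2^-1) * h = x * h - h / 2 by rewrite hh mulrBl mul1r; lra.
case: sg => -[x y] [[] []]; apply/nbP; rewrite /lp /center /cellR /= ?intrB ?hh' ?hh; split; lra.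
Qed.

Section Block.
Variables (R : realType) (h r : R) (x : R * R).

Definition bx := Num.ceil ((x.1 - r) / h).
Definition by_ := Num.ceil ((x.2 - r) / h).
Definition bm := absz (Num.floor ((x.1 + r) / h) - bx).
Definition bk := absz (Num.floor ((x.2 + r) / h) - by_).

Lemma blockP q : 0 < h -> h <= r -> in_rect bx by_ bm bk q = nb r x (lp h q).
Proof.
move=> h0 hr.
have key (y : R) (i : int) : (Num.ceil ((y - r) / h) <= i) &&
    (i <= Num.ceil ((y - r) / h) + (absz (Num.floor ((y + r) / h) - Num.ceil ((y - r) / h)))%:Z) =
    (y - r <= i%:~R * h) && (i%:~R * h <= y + r).
  (* As h <= r, the interval contains a multiple of h, and taking the absolute value does not alter
     the side length. *)
  have le : Num.ceil ((y - r) / h) <= Num.floor ((y + r) / h).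
    have /andP[lt _] := ceil_itv ((y - r) / h).
    have r1 : 1 <= r / h by rewrite ler_pdivlMr ?mul1r.
    have e : (y + r) / h = (y - r) / h + 2 * (r / h) by rewrite mulrA -mulrDl; congr (_ / _); lra.
    rewrite floor_ge_int e; move: lt; rewrite intrB; lra.
  have -> : Num.ceil ((y - r) / h) + (absz (Num.floor ((y + r) / h) - Num.ceil ((y - r) / h)))%:Z =
      Num.floor ((y + r) / h) by lia.
  by rewrite ceil_le_int floor_ge_int ler_pdivrMr // ler_pdivlMr.
rewrite /in_rect /bx /by_ /bm /bk andbA !key; apply/idP/nbP; rewrite /lp /=.
  by case/andP => /andP[? ?] /andP[? ?].
by case=> -> -> -> ->.
Qed.
End Block.

Section PlaneGraph.
Variables (R : realType) (S P : finType) (node : S * bool -> P).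
Local Notation D := (S * bool)%type.
Local Notation pl := (R * R)%type.
Local Notation Z2 := (int * int)%type.
Variables (np : P -> pl) (gam : S -> R -> pl).

Record plane_graph : Prop := PlaneGraph {
  pg_cont : forall s, continuous (gam s);
  pg_start : forall s, gam s 0 = np (node (s, true));
  pg_end : forall s, gam s 1 = np (node (s, false));
  pg_np : injective np;
  pg_ne : forall s, node (s, true) != node (s, false);
  pg_inj : forall s t t', 0 <= t <= 1 -> 0 <= t' <= 1 -> gam s t = gam s t' -> t = t';
  pg_sep : forall s s' t t', s != s' -> 0 <= t <= 1 -> 0 <= t' <= 1 -> gam s t = gam s' t' ->
    t = 0 \/ t = 1;
  pg_node : forall s t v, 0 <= t <= 1 -> gam s t = np v -> t = 0 \/ t = 1 }.

Hypothesis PG : plane_graph.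
Ltac pg_lra :=
  solve [repeat match goal with H : ?T |- _ =>
      lazymatch T with
      | is_true (Order.le _ _) => fail
      | is_true (Order.lt _ _) => fail
      | is_true (_ && _) => fail
      | plane_graph => fail
      | _ => clear H
      end end; lra
    | lra].
Local Notation off s v := ((v != node (s, true)) && (v != node (s, false))).

Lemma pg_off s v t : off s v -> 0 <= t <= 1 -> gam s t <> np v.
Proof.
case/andP=> n1 n2 ht e; case: (pg_node PG ht e) => te; move: e; rewrite te.
  by rewrite (pg_start PG) => /(pg_np PG) e; rewrite e eqxx in n1.
by rewrite (pg_end PG) => /(pg_np PG) e; rewrite e eqxx in n2.
Qed.

Lemma eps_nodes : exists2 e : R, 0 < e & forall u v, u != v -> ~~ nb (4 * e) (np u) (np v).
Proof.
have [||e e0 he] := @fin_eps R (P * P)%type (fun uv e => uv.1 != uv.2 -> ~~ nb (4 * e) (np uv.1) (np uv.2)).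
- by move=> i e e' e0 ee H /H; apply: contra; apply: nb_le; lra.
- move=> [u v] /=; have [->|ne] := eqVneq u v; first by exists 1.
  have d0 : 0 < l1 (np u) (np v).
    rewrite lt_neqAle l1_ge0 andbT eq_sym l1_eq0.
    by apply: contra ne => /eqP /(pg_np PG) ->.
  exists (l1 (np u) (np v) / 16); first by rewrite divr_gt0.
  move=> _; have -> : 4 * (l1 (np u) (np v) / 16) = (l1 (np u) (np v) / 2) / 2 by lra.
  by apply: l1_nb; lra.
by exists e => // u v; apply: (he (u, v)).
Qed.

Lemma eps_off : exists2 e : R, 0 < e & forall s v t, off s v -> 0 <= t <= 1 -> ~~ nb (3 * e) (gam s t) (np v).
Proof.
have [||e e0 he] := @fin_eps R (S * P)%type (fun sv e => forall t, off sv.1 sv.2 -> 0 <= t <= 1 ->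
  ~~ nb (3 * e) (gam sv.1 t) (np sv.2)).
- by move=> i e e' e0 ee H t h1 h2; apply: contra (H t h1 h2); apply: nb_le; lra.
- move=> [s v] /=; have [o|no] := boolP (off s v); last by exists 1.
  have [|e e0 he] := @curve_away _ (gam s) 0 1 (np v) (pg_cont PG (s:=s)).
    by move=> t; apply: pg_off.
  exists (e / 3); first by rewrite divr_gt0.
  by move=> t _ /he; apply: contra; apply: nb_le; lra.
by exists e => // s v t; apply: (he (s, v)).
Qed.

Lemma eps_pot : exists2 e : R, 0 < e & forall s v, off s v -> exists G : pl -> bool,
  (forall x y t t', 0 <= t <= 1 -> 0 <= t' <= 1 -> nb e (gam s t) x -> nb e (gam s t') y -> nb e x y ->
      chi x y (np v) = G x (+) G y) /\ Xl (gam s) 0 1 (np v) = G (gam s 0) (+) G (gam s 1).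
Proof.
have [||e e0 he] := @fin_eps R (S * P)%type (fun sv e => off sv.1 sv.2 -> exists G : pl -> bool,
  (forall x y t t', 0 <= t <= 1 -> 0 <= t' <= 1 -> nb e (gam sv.1 t) x -> nb e (gam sv.1 t') y -> nb e x y ->
      chi x y (np sv.2) = G x (+) G y) /\ Xl (gam sv.1) 0 1 (np sv.2) = G (gam sv.1 0) (+) G (gam sv.1 1)).
- move=> [s v] e e' e0 ee H /H /= [G [h1 h2]]; exists G; split=> // x y t t' ht ht' n1 n2 n3.
  by apply: (h1 x y t t') => //; apply: nb_le ee _.
- move=> [s v] /=; have [o|no] := boolP (off s v); last by exists 1.
  have [|||e e0 he] := @space_pot _ (gam s) 0 1 (np v) (pg_cont PG (s:=s)); rewrite ?ler01 //.
  - by move=> t t'; apply: (pg_inj PG).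
  - by move=> t; apply: pg_off.
  by exists e.
by exists e => // s v; apply: (he (s, v)).
Qed.

Lemma eps_sep r : 0 < r -> exists2 e : R, 0 < e & forall s s' t t', s != s' -> 0 <= t <= 1 -> 0 <= t' <= 1 ->
  nb e (gam s t) (gam s' t') -> exists v, nb r (np v) (gam s t).
Proof.
move=> r0.
have [||e e0 he] := @fin_eps R (S * S)%type (fun ss e => forall t t', ss.1 != ss.2 -> 0 <= t <= 1 -> 0 <= t' <= 1 ->
  nb e (gam ss.1 t) (gam ss.2 t') -> exists v, nb r (np v) (gam ss.1 t)).
- move=> i e e' e0 ee H t t' h1 h2 h3 h4; apply: (H t t') => //; exact: nb_le ee _.
- move=> [s s'] /=; have [_|ne] := eqVneq s s'; first by exists 1.
  have [z z0 hz] := @curve_unif _ (gam s) 0 1 r (pg_cont PG (s:=s)) r0.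
  have [|e e0 he] := @curve_sep _ (gam s) (gam s') z (1 - z) 0 1 (pg_cont PG (s:=s)) (pg_cont PG (s:=s')).
    move=> t t' /andP[h1 h2] h3 e; have ht : 0 <= t <= 1 by apply/andP; split; lra.
    by case: (pg_sep PG ne ht h3 e) => te; lra.
  exists e => // t t' _ ht ht' n1.
  have h01 : 0 <= (0 : R) <= 1 by apply/andP; split; lra.
  have h11 : 0 <= (1 : R) <= 1 by apply/andP; split; lra.
  case: (ltrP t z) => tz.
    exists (node (s, true)); rewrite -(pg_start PG); apply: hz => //.
    by rewrite sub0r normrN ger0_norm; lra.
  case: (ltrP (1 - z) t) => tz'.
    exists (node (s, false)); rewrite -(pg_end PG); apply: hz => //.
    by rewrite ger0_norm; lra.
  by have := he t t'; rewrite tz tz' n1 => /(_ isT ht').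
by exists e => // s s' t t' ne; apply: (he (s, s')).
Qed.

(* On a fine lattice, the nodes become rectangles and the segments disjoint lattice
   paths: [rho] is the cyclic order in which the paths leave a rectangle, and [c d]
   the winding number of the cell on the left of the first edge of [d]. *)
Theorem plane_rotation : exists rho : D -> D,
  [/\ injective rho, forall d, node (rho d) = node d,
      forall d d', node d = node d' -> fconnect rho d d' &
      forall z, (forall p, even_at node z p) -> exists c : D -> bool,
        [/\ forall d, c (rho d) = c d (+) z d.1, forall d, c d (+) c (alpha d) = z d.1 &
         forall d, (forall s, z s -> off s (node d)) ->
           c d = \big[addb/false]_s (z s && Xl (gam s) 0 1 (np (node d)))]].
Proof.
have [e1 e10 he1] := eps_nodes; have [e2 e20 he2] := eps_off; have [e3 e30 he3] := eps_pot.
have [r r0 [re1 re2 re3]] : exists2 r : R, 0 < r & [/\ r <= e1, r <= e2 & r <= e3].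
  exists (Num.min e1 (Num.min e2 e3)); first by rewrite !lt_min e10 e20.
  by rewrite !ge_min !lexx !orbT.
have r20 : 0 < r / 2 by pg_lra.
have [e4 e40 he4] := eps_sep r20.
(* Nodes get boxes of radius r, and outside the boxes of half that radius distinct segments are e4
   apart; the lattice resolves both distances. *)
have [h h0 [hr he]] : exists2 h : R, 0 < h & 10 * h <= r /\ 10 * h <= e4.
  have m0 : 0 < Num.min r e4 by rewrite lt_min r0.
  exists (Num.min r e4 / 10); first by pg_lra.
  have : Num.min r e4 <= r by rewrite ge_min lexx.
  have : Num.min r e4 <= e4 by rewrite ge_min lexx orbT.
  by split; pg_lra.
pose rx p := bx h r (np p); pose ry p := by_ h r (np p).
pose rm p := bm h r (np p); pose rk p := bk h r (np p).
have inBE p q : in_rect (rx p) (ry p) (rm p) (rk p) q = nb r (np p) (lp h q).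
  by apply: blockP; pg_lra.
have gap0 p p' q : nb r (np p) (lp h q) -> nb r (np p') (lp h q) -> p = p'.
  move=> n1 n2; apply/eqP/negPn/negP => /he1; rewrite (@nb_le _ (r + r)) //; first pg_lra.
  by apply: (nb_trans n1); rewrite nb_sym.
have gap1 p p' q q' : nb r (np p) (lp h q) -> nb r (np p') (lp h q') -> nb h (lp h q) (lp h q') -> p = p'.
  move=> n1 n2 n3; apply/eqP/negPn/negP => /he1; rewrite (@nb_le _ (r + (h + r))) //; first pg_lra.
  by apply: (nb_trans n1); apply: (nb_trans n3); rewrite nb_sym.
have nbmv (sg : (int * int) * (bool * bool)) : nb h (lp h sg.1) (lp h (mv sg)).
  by apply: nb_lp_adj => //; apply: adj_mv_self.
have h01 : 0 <= (0 : R) <= 1 by apply/andP; split; pg_lra.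
have h11 : 0 <= (1 : R) <= 1 by apply/andP; split; pg_lra.
have paths s : exists abl : (Z2 * Z2) * seq Z2, [/\ path (@adj) abl.1.1 (abl.1.2 :: abl.2),
    uniq (abl.1.1 :: abl.1.2 :: abl.2),
    nb r (np (node (s, true))) (lp h abl.1.1) /\ nb r (np (node (s, false))) (lp h (last abl.1.2 abl.2)),
    {in belast abl.1.2 abl.2, forall q, ~~ nb r (np (node (s, true))) (lp h q) && ~~ nb r (np (node (s, false))) (lp h q)} &
    {in abl.1.1 :: abl.1.2 :: abl.2, forall q, exists2 t, 0 <= t <= 1 & nb (2 * h) (gam s t) (lp h q)}].
  have [l [l1 l2 l3 _]] := lattice_path h0 (pg_cont PG (s:=s)) ler01.
  pose A q := nb r (np (node (s, true))) (lp h q); pose B q := nb r (np (node (s, false))) (lp h q).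
  have AB q : A q -> ~~ B q.
    by move=> a; apply/negP => b; have := pg_ne PG s; rewrite (gap0 _ _ _ a b) eqxx.
  have [||a [b [l' [k1 k2 [k3 k4] k5 k6]]]] := cut_path AB l1.
  - rewrite /A -(pg_start PG); apply: (nb_le (r := h)); [pg_lra|exact: rdP].
  - rewrite /B l2 -(pg_end PG); apply: (nb_le (r := h)); [pg_lra|exact: rdP].
  exists ((a, b), l'); split=> // q /k6; exact: l3.
have {paths} [abl ablP] := fin_all_exists paths.
pose a0 s := (abl s).1.1; pose b0 s := (abl s).1.2; pose l0 s := (abl s).2.
have pathP s : path adj (a0 s) (b0 s :: l0 s) by case: (ablP s).
have pathU s : uniq (a0 s :: b0 s :: l0 s) by case: (ablP s).
have startP s : nb r (np (node (s, true))) (lp h (a0 s)) by case: (ablP s) => _ _ [].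
have endP s : nb r (np (node (s, false))) (lp h (last (b0 s) (l0 s))) by case: (ablP s) => _ _ [].
have nearP s q : q \in a0 s :: b0 s :: l0 s -> exists2 t, 0 <= t <= 1 & nb (2 * h) (gam s t) (lp h q).
  by case: (ablP s) => _ _ _ _; apply.
have farP s v q : off s v -> q \in a0 s :: b0 s :: l0 s -> ~~ nb (r + 3 * h) (np v) (lp h q).
  move=> o /nearP[t ht n1]; apply: contra (he2 _ _ _ o ht) => n2.
  by apply: (nb_le (r := 2 * h + (r + 3 * h))); [pg_lra|apply: (nb_trans n1); rewrite nb_sym].
have intP s q p : q \in belast (b0 s) (l0 s) -> ~~ nb r (np p) (lp h q).
  move=> qb; have [_ _ _ k5 _] := ablP s; have /andP[n1 n2] := k5 q qb.
  have [o|] := boolP (off s p); last by rewrite negb_and !negbK => /orP[] /eqP ->.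
  by apply: contra (farP s p q o _); [apply: nb_le; pg_lra|rewrite inE (mem_belast qb) orbT].
(* A common point q would be close to both segments, hence to a node v, and so deep in the box of v;
   a neighbour of q inside the path of s, or q itself, would then lie in that box. *)
have sep s s' q : s != s' -> q \in a0 s :: b0 s :: l0 s -> q \notin a0 s' :: b0 s' :: l0 s'.
  move=> ss qs; apply/negP => qs'.
  have [t ht n1] := nearP _ _ qs; have [t' ht' n2] := nearP _ _ qs'.
  have n3 : nb e4 (gam s t) (gam s' t').
    by apply: (nb_le (r := 2 * h + 2 * h)); [pg_lra|apply: (nb_trans n1); rewrite nb_sym].
  have [v hv] := he4 _ _ _ _ ss ht ht' n3.
  have qv : nb (r / 2 + 2 * h) (np v) (lp h q) by apply: nb_trans hv n1.
  have nbr q' : adj q q' -> nb r (np v) (lp h q').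
    move=> /(nb_lp_adj h0) n4; apply: (nb_le (r := r / 2 + 2 * h + h)); first pg_lra.
    exact: nb_trans qv n4.
  have gap' p p' sg : nb r (np p) (lp h sg.1) -> nb r (np p') (lp h (mv sg)) -> p = p'.
    by move=> m1 m2; apply: gap1 m1 m2 (nbmv sg).
  have qB : nb r (np v) (lp h q) by apply: nb_le qv; pg_lra.
  move: qs; rewrite inE => /orP[/eqP qa|].
    have bq : b0 s \in belast (b0 s) (l0 s).
      case e: (l0 s) => [|x l] /=; last by rewrite inE eqxx.
      have := endP s; have := pathP s; rewrite e /= andbT => /(nb_lp_adj h0) n4 n5.
      by have := pg_ne PG s; rewrite (gap1 _ _ _ _ (startP s) n5 n4) eqxx.
    have := intP _ _ v bq; rewrite nbr // qa; by case/andP: (pathP s).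
  rewrite lastI mem_rcons inE => /orP[/eqP qa|/(intP _ _ v)]; last by rewrite qB.
  have [l [x le]] : exists l x, l0 s = rcons l x.
    case: (lastP (l0 s)) (endP s) (pathP s) => [|l x]; last by exists l, x.
    rewrite /= andbT => n5 /(nb_lp_adj h0) n4.
    by have := pg_ne PG s; rewrite (gap1 _ _ _ _ (startP s) n5 n4) eqxx.
  have pb : last (b0 s) l \in belast (b0 s) (l0 s) by rewrite le belast_rcons mem_last.
  have := intP _ _ v pb; rewrite nbr // qa le last_rcons.
  by have := pathP s; rewrite le /= rcons_path => /and3P[_ _]; rewrite /adj distrC (distrC x.2).
have corB p : in_rect (rx p) (ry p) (rm p) (rk p) (rx p, ry p).
  exact: in_rect_corner.
have L1ex s : exists l, [/\ path adj (rx (node (s, true)), ry (node (s, true))) l,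
    last (rx (node (s, true)), ry (node (s, true))) l = a0 s &
    all (in_rect (rx (node (s, true))) (ry (node (s, true))) (rm (node (s, true))) (rk (node (s, true))))
      ((rx (node (s, true)), ry (node (s, true))) :: l)].
  by apply: rect_connected; rewrite ?corB // inBE.
have L2ex s : exists l, [/\ path adj (last (b0 s) (l0 s)) l,
    last (last (b0 s) (l0 s)) l = (rx (node (s, false)), ry (node (s, false))) &
    all (in_rect (rx (node (s, false))) (ry (node (s, false))) (rm (node (s, false))) (rk (node (s, false))))
      (last (b0 s) (l0 s) :: l)].
  by apply: rect_connected; rewrite ?corB // inBE.
have [L1 L1P] := fin_all_exists L1ex; have [L2 L2P] := fin_all_exists L2ex.
have [|||||||||||rho [r1 r2 r3 r4]] := @discrete_rotation S P node rx ry rm rk a0 b0 l0 L1 L2.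
- by move=> p p' q; rewrite !inBE; apply: gap0.
- by move=> p p' sg; rewrite !inBE => n1 n2; apply: gap1 n1 n2 (nbmv sg).
- exact: pathP.
- exact: pathU.
- by move=> s; rewrite inBE; apply: startP.
- by move=> s; rewrite inBE; apply: endP.
- by move=> s q p; rewrite inBE; apply: intP.
- exact: pg_ne PG.
- exact: sep.
- exact: L1P.
- exact: L2P.
exists rho; split=> // z ev; have [c1 c2] := r4 z ev.
exists (fun d => zcell node rx ry b0 l0 L1 L2 z (cellL (spk a0 b0 l0 d))); split=> // d dz.
pose cn p : Z2 := (rx p, ry p).
pose X s p := psum (fun x y => chi (lp h x) (lp h y) p) (cn (node (s, true))) (hat b0 l0 L1 L2 s).
set sg := spk a0 b0 l0 d; set v := node d in dz *.
have hatP s q : q \in cn (node (s, true)) :: hat b0 l0 L1 L2 s ->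
    q \in a0 s :: b0 s :: l0 s \/ exists2 u, ~~ off s u & nb r (np u) (lp h q).
  have [_ _ /allP a1] := L1P s; have [_ _ /allP a2] := L2P s.
  rewrite /hat -cat_cons !mem_cat => /or3P[/a1|h2|h2].
  - by rewrite inBE => n1; right; exists (node (s, true)); rewrite // eqxx.
  - by left; rewrite inE h2 orbT.
  - right; exists (node (s, false)); first by rewrite eqxx andbF.
    by rewrite -inBE; apply: a2; rewrite inE h2 orbT.
have hat_far s q : z s -> q \in cn (node (s, true)) :: hat b0 l0 L1 L2 s -> ~~ nb (r + 3 * h) (lp h q) (np v).
  move=> /dz o /hatP[/(farP _ _ _ o)|[u nu n1]]; first by rewrite nb_sym.
  have uv : u != v by apply: contraNneq nu => ->.
  apply: contra (he1 _ _ uv) => n2; apply: (nb_le (r := r + (r + 3 * h))); first pg_lra.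
  exact: nb_trans n1 n2.
have hat_near s q : q \in cn (node (s, true)) :: hat b0 l0 L1 L2 s ->
    exists2 t, 0 <= t <= 1 & nb e3 (gam s t) (lp h q).
  case/hatP => [/nearP[t ht n1]|[u nu n1]].
    by exists t => //; apply: nb_le n1; pg_lra.
  move: nu; rewrite negb_and !negbK => /orP[] /eqP ue.
    by exists 0 => //; rewrite (pg_start PG) -ue; apply: nb_le n1.
  by exists 1 => //; rewrite (pg_end PG) -ue; apply: nb_le n1.
have sgB : nb r (np v) (lp h sg.1).
  rewrite -inBE; apply: (@spk_in S P node rx ry rm rk a0 b0 l0) => //.
  - by move=> p p' sg'; rewrite !inBE => n1 n2; apply: gap1 n1 n2 (nbmv sg').
  - by move=> s; rewrite inBE; apply: startP.
  - by move=> s; rewrite inBE; apply: endP.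
  - exact: pg_ne PG.
have cenP : nb (r + h) (np v) (center h (cellL sg)).
  apply: (nb_trans sgB).
  exact: nb_cellL.
have psum_pot s (K : Z2 -> Z2 -> bool) (F : Z2 -> bool) :
    (forall q q', q \in cn (node (s, true)) :: hat b0 l0 L1 L2 s -> q' \in cn (node (s, true)) :: hat b0 l0 L1 L2 s ->
       nb h (lp h q) (lp h q') -> K q q' = F q (+) F q') ->
    psum K (cn (node (s, true))) (hat b0 l0 L1 L2 s) = F (cn (node (s, true))) (+) F (cn (node (s, false))).
  move=> HF; have hp := @hat_path S P node rx ry rm rk a0 b0 l0 L1 L2 pathP L1P L2P s.
  have hl := @hat_last S P node rx ry rm rk a0 b0 l0 L1 L2 L1P L2P s.
  rewrite -[cn (node (s, false))]hl; apply: psum_telescope.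
  apply: (sub_in_path (P := mem (cn (node (s, true)) :: hat b0 l0 L1 L2 s))) hp; last by apply/allP.
  by move=> q q' /= h1 h2 /(nb_lp_adj h0) h3; apply/eqP/HF.
(* The prolonged path stays near the segment, so [space_pot] compares their windings around v; [E2]
   then moves the point from v to the centre of a cell next to its box or in it. *)
have E1 s : z s -> X s (np v) = Xl (gam s) 0 1 (np v) (+)
    (chi (np (node (s, true))) (lp h (cn (node (s, true)))) (np v) (+)
     chi (np (node (s, false))) (lp h (cn (node (s, false)))) (np v)).
  move=> zs; have [G [G1 G2]] := he3 _ _ (dz _ zs).
  rewrite /X (psum_pot s _ (fun q => G (lp h q))); last first.
    move=> q q' /hat_near[t ht n1] /hat_near[t' ht' n2] n3; apply: (G1 _ _ t t') => //.
    by apply: nb_le n3; pg_lra.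
  have corn u : nb r (np u) (lp h (cn u)) by rewrite -inBE corB.
  have K u t : 0 <= t <= 1 -> gam s t = np u -> chi (np u) (lp h (cn u)) (np v) = G (np u) (+) G (lp h (cn u)).
    move=> ht e; apply: (G1 _ _ t t) => //; rewrite ?e.
    - by apply: nb_refl; pg_lra.
    - by apply: nb_le (corn u).
    - by apply: nb_le (corn u).
  rewrite G2 (K _ 0) ?(K _ 1) ?(pg_start PG) ?(pg_end PG) //.
  by move: (G _) (G _) (G _) (G _) => [] [] [] [].
have E2 s : z s -> X s (np v) (+) X s (center h (cellL sg)) =
    dual_pot (np v) (center h (cellL sg)) (lp h (cn (node (s, true)))) (+)
    dual_pot (np v) (center h (cellL sg)) (lp h (cn (node (s, false)))).
  move=> zs; rewrite /X psumD.
  apply: (psum_pot s _ (fun q => dual_pot (np v) (center h (cellL sg)) (lp h q))) => q q' qm q'm n1.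
  have rh0 : 0 <= r + h by pg_lra.
  apply: (chi_dual (r := h) (s := r + h) (c := lp h q)) => //.
    by apply: nb_refl; pg_lra.
  by apply: contra (hat_far _ _ zs qm); apply: nb_le; pg_lra.
(* Both errors are differences of this one function of the nodes, so they cancel on an even set. *)
pose gg p := chi (np p) (lp h (cn p)) (np v) (+) dual_pot (np v) (center h (cellL sg)) (lp h (cn p)).
rewrite /zcell.
transitivity (\big[addb/false]_s ((z s && Xl (gam s) 0 1 (np v)) (+)
  (z s && (gg (node (s, true)) (+) gg (node (s, false)))))).
  apply: eq_bigr => s _; case zs: (z s) => //=.
  rewrite -(wind_center h0) -/(X s (center h (cellL sg))).
  have := E2 s zs; rewrite (E1 s zs) /gg.
  move: (X s _) (Xl _ _ _ _) (chi _ _ _) (chi _ _ _) (dual_pot _ _ _) (dual_pot _ _ _); bool_cases.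
by rewrite big_split /= (even_sum gg ev) addbF.
Qed.
End PlaneGraph.

(** * Both sides of a closed curve *)

Section LocalJordan.
Variable R : realType.
Local Notation pl := (R * R)%type.
Local Notation Z2 := (int * int)%type.

(** Away from its ends the open arc has a positive distance from [bet] by compactness. *)
Lemma arc_apart (gam bet : R -> pl) (u v c d : R) r : continuous gam -> continuous bet -> 0 < r ->
  (forall t t', u < t < v -> c <= t' <= d -> gam t <> bet t') ->
  exists2 e : R, 0 < e & forall t t', u <= t <= v -> c <= t' <= d -> nb e (gam t) (bet t') ->
    nb r (gam u) (gam t) \/ nb r (gam v) (gam t).
Proof.
move=> cg cb r0 ne.
have [z z0 hz] := @curve_unif _ gam u v r cg r0.
have [|e e0 he] := @curve_sep _ gam bet (u + z) (v - z) c d cg cb.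
  by move=> t t' /andP[h1 h2] h3; apply: ne => //; apply/andP; split; real_lra.
exists e => // t t' ht ht' n1; have /andP[ht1 ht2] := ht.
case: (ltrP t (u + z)) => tz.
  left; apply: hz => //; first by apply/andP; split; real_lra.
  by rewrite distrC ger0_norm; real_lra.
case: (ltrP (v - z) t) => tz'.
  right; apply: hz => //; first by apply/andP; split; real_lra.
  by rewrite ger0_norm; real_lra.
by have := he t t'; rewrite tz tz' n1 => /(_ isT ht').
Qed.

Lemma addb_cycle4 A B C D E F G H : D (+) (E (+) F) (+)
   (C (+) (F (+) G) (+) (B (+) (G (+) H) (+) (A (+) (H (+) E)))) = D (+) (C (+) B) (+) A.
Proof. move: A B C D E F G H; bool_cases. Qed.

(* Otherwise one could colour the cells close to [gam] so that the colour changes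
   exactly across [gam]; but the border of a rectangle around gam(u) excluding
   gam(v) is crossed an odd number of times. *)
Theorem local_jordan (gam bet : R -> pl) (u v eta : R) : continuous gam -> continuous bet ->
  (forall t t' : R, 0 <= t <= 1 -> 0 <= t' <= 1 -> gam t = gam t' -> t = t') ->
  gam 1 = bet 0 -> bet 1 = gam 0 ->
  (forall t t' : R, 0 < t < 1 -> 0 <= t' <= 1 -> gam t <> bet t') ->
  0 < u -> u < v -> v < 1 -> 0 < eta ->
  let W x := Xl gam 0 1 x (+) Xl bet 0 1 x in
  let offc x := forall t : R, 0 <= t <= 1 -> gam t <> x /\ bet t <> x in
  let near x := exists2 t : R, u <= t <= v & nb eta (gam t) x in
  exists x x', [/\ offc x, offc x', near x, near x' & W x <> W x'].
Proof.
move=> cg cb inj e1 e2 ne u0 uv v1 eta0 W offc near.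
apply: contrapT => no.
have [al Hal] : exists al, forall x, offc x -> near x -> W x = al.
  have [[x [x1 x2]]|nx] := pselect (exists x, offc x /\ near x).
    exists (W x) => y y1 y2; apply: contrapT => ny; apply: no.
    by exists y, x.
  by exists false => x x1 x2; case: nx; exists x.
have I1 t : u <= t <= v -> 0 <= t <= 1 by move=> /andP[? ?]; apply/andP; split; real_lra.
have nuv : gam u <> gam v.
  move=> e; have : u = v by apply: inj e; apply/andP; split; real_lra.
  by move=> e'; rewrite e' ltxx in uv.
have [r r0 hr] : exists2 r : R, 0 < r & ~~ nb (4 * r) (gam u) (gam v).
  have d0 : 0 < l1 (gam u) (gam v).
    by rewrite lt_neqAle l1_ge0 andbT eq_sym l1_eq0; apply/eqP.
  exists (l1 (gam u) (gam v) / 16); first by rewrite divr_gt0.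
  have -> : 4 * (l1 (gam u) (gam v) / 16) = (l1 (gam u) (gam v) / 2) / 2 by real_lra.
  by apply: l1_nb; real_lra.
have r20 : 0 < r / 2 by real_lra.
have [|ea ea0 hea] := @arc_apart gam gam u v 0 u _ cg cg r20.
  move=> t t' /andP[? ?] /andP[? ?] e; have te : t = t' by apply: inj e; apply/andP; split; real_lra.
  have : t < t by real_lra.
  by rewrite ltxx.
have [|eb eb0 heb] := @arc_apart gam gam u v v 1 _ cg cg r20.
  move=> t t' /andP[? ?] /andP[? ?] e; have te : t = t' by apply: inj e; apply/andP; split; real_lra.
  have : t < t by real_lra.
  by rewrite ltxx.
have [|ec ec0 hec] := @arc_apart gam bet u v 0 1 _ cg cb r20.
  by move=> t t' /andP[? ?] h; apply: ne => //; apply/andP; split; real_lra.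
have [h h0 [hh1 hh2 hh3 hh4 hh5]] : exists2 h : R, 0 < h &
    [/\ 30 * h <= r, 30 * h <= ea, 30 * h <= eb, 30 * h <= ec & 30 * h <= eta].
  pose m := Num.min r (Num.min ea (Num.min eb (Num.min ec eta))).
  have m0 : 0 < m by rewrite !lt_min r0 ea0 eb0 ec0.
  have m1 : [/\ m <= r, m <= ea, m <= eb, m <= ec & m <= eta].
    by rewrite /m !ge_min !lexx !orbT.
  by exists (m / 30); [rewrite divr_gt0|case: m1 => *; split; real_lra].
have rest t x : u <= t <= v -> nb (25 * h) (gam t) x ->
    (exists2 t', (0 <= t' <= u) || (v <= t' <= 1) & gam t' = x) \/ (exists2 t', 0 <= t' <= 1 & bet t' = x) ->
    nb (r / 2) (gam u) (gam t) \/ nb (r / 2) (gam v) (gam t).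
  move=> ht n1 [[t' /orP[] ht' e]|[t' ht' e]]; rewrite -e in n1.
  - by apply: hea ht ht' _; apply: nb_le n1; real_lra.
  - by apply: heb ht ht' _; apply: nb_le n1; real_lra.
  - by apply: hec ht ht' _; apply: nb_le n1; real_lra.
have u1 : u <= 1 by real_lra.
have [l1 [p1 q1 n1 w1]] := lattice_path h0 cg (ltW u0).
have [l2 [p2 q2 n2 w2]] := lattice_path h0 cg (ltW uv).
have [l3 [p3 q3 n3 w3]] := lattice_path h0 cg (ltW v1).
have [l4 [p4 q4 n4 w4]] := lattice_path h0 cb ler01.
pose a := rd h (gam 0); pose l := l1 ++ l2 ++ l3 ++ l4.
have last12 : last a (l1 ++ l2) = rd h (gam v) by rewrite last_cat q1.
have lp0 : path adj a l by rewrite /l !cat_path q1 q2 q3 e1 p1 p2 p3 p4.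
have ll : last a l = a by rewrite /l !last_cat q1 q2 q3 e1 q4 e2.
have mE s : mult s a l = mult s a l1 (+) mult s (rd h (gam u)) l2 (+) mult s (rd h (gam v)) l3 (+) mult s (rd h (bet 0)) l4.
  by rewrite /mult /l !psum_cat q1 q2 q3 e1 !addbA.
pose M s := mult s (rd h (gam u)) l2.
(* By assumption this vanishes at cells near gam([u, v]) that keep off the whole curve. *)
pose sig c := wind c a l (+) al.
have sigJ s : sig (cellL s) (+) sig (cellR s) = mult s a l.
  have := wind_jump s lp0; rewrite ll addbb addbF => <-.
  by rewrite /sig addbACA addbb addbF.
pose cen c := center h c.
have sigW c : (forall t : R, 0 <= t <= 1 -> ~~ nb (4 * h) (gam t) (cen c) /\ ~~ nb (4 * h) (bet t) (cen c)) ->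
    wind c a l = W (cen c).
  move=> off; have hp : 0 <= 4 * h by real_lra.
  have oa (t : R) : 0 <= t <= 1 -> gam t <> cen c.
    by move=> /off[o _] e; rewrite e nb_refl in o.
  rewrite -(wind_center h0) /l !psum_cat q1 q2 q3 -/a.
  rewrite w1; last by move=> t /andP[? ?]; apply: (off t _).1; apply/andP; split; real_lra.
  rewrite w2; last by move=> t /andP[? ?]; apply: (off t _).1; apply/andP; split; real_lra.
  rewrite w3; last by move=> t /andP[? ?]; apply: (off t _).1; apply/andP; split; real_lra.
  rewrite e1 w4; last by move=> t ht; apply: (off t ht).2.
  have ov t : u <= t <= 1 -> gam t <> cen c by move=> /andP[? ?]; apply: oa; apply/andP; split; real_lra.
  rewrite /W (Xl_cat cg (ltW u0) u1 oa) (Xl_cat cg (ltW uv) (ltW v1) ov) e2.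
  move: (Xl _ _ _ _) (Xl _ _ _ _) (Xl _ _ _ _) (Xl _ _ _ _) => A B C D.
  move: (chi (gam 0) _ _) (chi (gam u) _ _) (chi (gam v) _ _) (chi (bet 0) _ _) => E F G H.
  exact: addb_cycle4.
pose nr c := `[< exists2 t, u <= t <= v & nb (6 * h) (gam t) (cen c) >].
have curve c : nr c -> sig c ->
    (exists2 t, u <= t <= v & nb (4 * h) (gam t) (cen c)) \/
    (exists x, ((exists2 t', (0 <= t' <= u) || (v <= t' <= 1) & gam t' = x) \/
      (exists2 t', 0 <= t' <= 1 & bet t' = x)) /\ nb (4 * h) x (cen c)).
  move=> /asboolP[t ht nt] sc; apply: contrapT => nc; move: sc; rewrite /sig sigW.
    rewrite Hal ?addbb //.
      move=> t' ht'; split=> e; apply: nc.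
        case: (boolP (u <= t' <= v)) => hu.
          by left; exists t' => //; rewrite e; apply: nb_refl; real_lra.
        right; exists (gam t'); split; last by rewrite e; apply: nb_refl; real_lra.
        left; exists t' => //; move: hu ht'; rewrite negb_and -!ltNge => /orP[] ? /andP[? ?].
          by apply/orP; left; apply/andP; split; real_lra.
        by apply/orP; right; apply/andP; split; real_lra.
      right; exists (bet t'); split; last by rewrite e; apply: nb_refl; real_lra.
      by right; exists t'.
    by exists t => //; apply: nb_le nt; real_lra.
  move=> t' ht'; split; apply/negP => nn; apply: nc.
    case: (boolP (u <= t' <= v)) => hu; first by left; exists t'.
    right; exists (gam t'); split=> //.
    left; exists t' => //; move: hu ht'; rewrite negb_and -!ltNge => /orP[] ? /andP[? ?].
      by apply/orP; left; apply/andP; split; real_lra.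
    by apply/orP; right; apply/andP; split; real_lra.
  by right; exists (bet t'); split=> //; right; exists t'.
pose S c := sig c && nr c.
pose rx := bx h r (gam u); pose ry := by_ h r (gam u).
pose rm := bm h r (gam u); pose rk := bk h r (gam u).
have inBE q : in_rect rx ry rm rk q = nb r (gam u) (lp h q) by apply: blockP; real_lra.
(* On the border of the rectangle neither the ends of gam([u, v]) nor the rest of the closed curve
   is near gam([u, v]), so the colouring [S] changes exactly across the lattice path of
   gam([u, v]). *)
have key s : s \in ring rx ry rm rk -> S (cellL s) (+) S (cellR s) = M s.
  rewrite mem_ring !inBE => /andP[b1 b2].
  have nL := @nb_cellL _ h s h0; have nR := @nb_cellR _ h s h0.
  have nm : nb h (lp h s.1) (lp h (mv s)) by apply: nb_lp_adj => //; apply: adj_mv_self.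
  have noend t : u <= t <= v -> nb (12 * h) (gam t) (lp h s.1) ->
      ~ (nb (r / 2) (gam u) (gam t) \/ nb (r / 2) (gam v) (gam t)).
    move=> ht nt [n5|n5].
      move/negP: b2; apply; apply: (nb_le (r := r / 2 + (12 * h + h))); first real_lra.
      by apply: (nb_trans n5); apply: nb_trans nt nm.
    move/negP: hr; apply; apply: (nb_le (r := r + (r / 2 + 12 * h))); first real_lra.
    by apply: (nb_trans b1); rewrite nb_sym; apply: (nb_trans n5).
  have restM t : u <= t <= v -> nb (12 * h) (gam t) (lp h s.1) -> mult s a l = M s.
    move=> ht nt; have bad x : nb (2 * h) x (lp h s.1) ->
        ((exists2 t', (0 <= t' <= u) || (v <= t' <= 1) & gam t' = x) \/
      (exists2 t', 0 <= t' <= 1 & bet t' = x)) -> False.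
      move=> nx rx'; apply: (noend t ht nt); apply: rest ht _ rx'.
      by apply: (nb_le (r := 12 * h + 2 * h)); [real_lra|apply: (nb_trans nt); rewrite nb_sym].
    rewrite mE (mult0 (a := a)) ?(mult0 (a := rd h (gam v))) ?(mult0 (a := rd h (bet 0))) /M ?addbF //.
    - by apply/negP => /n4[t' ht' nt']; apply: (bad _ nt'); right; exists t'.
    - by apply/negP => /n3[t' ht' nt']; apply: (bad _ nt'); left; exists t'; rewrite ?ht' ?orbT.
    - by apply/negP => /n1[t' ht' nt']; apply: (bad _ nt'); left; exists t'; rewrite ?ht'.
  have one c c' : nb h (lp h s.1) (cen c) -> nb h (lp h s.1) (cen c') ->
      S c -> nr c' /\ mult s a l = M s.
    move=> nc nc' /andP[sc nrc]; have /asboolP[t ht nt] := nrc.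
    have nts : nb (12 * h) (gam t) (lp h s.1).
      by apply: (nb_le (r := 6 * h + h)); [real_lra|apply: (nb_trans nt); rewrite nb_sym].
    split; last exact: restM ht nts.
    case: (curve c nrc sc) => [[t' ht' nt']|[x [rx' nx]]].
      apply/asboolP; exists t' => //; apply: (nb_le (r := 4 * h + (h + h))); first real_lra.
      by apply: (nb_trans nt'); apply: (nb_trans (b := lp h s.1)) => //; rewrite nb_sym.
    exfalso; apply: (noend t ht nts); apply: rest ht _ rx'.
    by apply: (nb_le (r := 6 * h + 4 * h)); [real_lra|apply: (nb_trans nt); rewrite nb_sym].
  case SL: (S (cellL s)).
    have [n5 <-] := one _ _ nL nR SL; rewrite -sigJ.
    by move: SL; rewrite /S n5 andbT => /andP[-> _].
  case SR: (S (cellR s)).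
    have [n5 <-] := one _ _ nR nL SR; rewrite -sigJ addFb.
    by move: SL SR; rewrite /S n5 andbT => -> /andP[-> _].
  case ME: (M s) => //.
  have [t ht nt] : exists2 t, u <= t <= v & nb (2 * h) (gam t) (lp h s.1).
    by apply: n2; apply: contraT => /mult0; rewrite -/(M s) ME.
  have nrc c : nb h (lp h s.1) (cen c) -> nr c.
    move=> nc; apply/asboolP; exists t => //; apply: (nb_le (r := 2 * h + h)); first real_lra.
    exact: nb_trans nt nc.
  have := sigJ s; rewrite (restM t ht) ?ME; last by apply: nb_le nt; real_lra.
  by move: SL SR; rewrite /S !nrc // !andbT => -> ->.
have := ring_cells rx ry rm rk S.
rewrite (eq_big_seq _ key) /M ring_mult // !inBE q2.
have -> : nb r (gam u) (lp h (rd h (gam u))) by apply: (nb_le (r := h)); [real_lra|exact: rdP].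
have -> // : nb r (gam u) (lp h (rd h (gam v))) = false.
apply/negbTE; apply: contra hr => n5; apply: (nb_le (r := r + h)); first real_lra.
by apply: (nb_trans n5); rewrite nb_sym; exact: rdP.
Qed.
End LocalJordan.

(** * Edges alternate around a crossing *)

Section WConst.
Variables (R : realType) (S P : finType).
Local Notation pl := (R * R)%type.
Variables (node : S * bool -> P) (np : P -> pl) (gam : S -> R -> pl).
Hypothesis cg : forall s, continuous (gam s).
Hypothesis gs : forall s, gam s 0 = np (node (s, true)).
Hypothesis ge : forall s, gam s 1 = np (node (s, false)).

(** A small move of the point changes each winding increment by [dual_pot] terms at the ends of the
    segment, which cancel on an even set. *)
Lemma winding_const (z : S -> bool) (c : R -> pl) : (forall p, even_at node z p) -> continuous c ->
  (forall s (t t' : R), z s -> 0 <= t <= 1 -> 0 <= t' <= 1 -> gam s t <> c t') ->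
  \big[addb/false]_s (z s && Xl (gam s) 0 1 (c 0)) = \big[addb/false]_s (z s && Xl (gam s) 0 1 (c 1)).
Proof.
move=> ev cc aw.
have [||e e0 he] := @fin_eps R S (fun s e => z s -> forall t t' : R, 0 <= t <= 1 -> 0 <= t' <= 1 ->
    ~~ nb e (gam s t) (c t')).
- by move=> s e e' e0 ee h zs t t' ht ht'; apply: contra (h zs t t' ht ht'); apply: nb_le.
- move=> s; case zs: (z s); last by exists 1.
  have [|e e0 he] := @curve_sep _ (gam s) c 0 1 0 1 (@cg s) cc; first by move=> t t'; apply: aw.
  by exists e.
have e20 : 0 < e / 2 by rewrite divr_gt0.
have [zt zt0 hz] := @curve_unif _ c 0 1 (e / 2) cc e20.
apply: (@loc_const _ (fun t => \big[addb/false]_s (z s && Xl (gam s) 0 1 (c t))) 0 1 _ ler01 zt0).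
move=> t t' h1 h2 h3 h4.
suff K : \big[addb/false]_s (z s && Xl (gam s) 0 1 (c t)) (+)
    \big[addb/false]_s (z s && Xl (gam s) 0 1 (c t')) = false.
  by move: K; case: (\big[_/_]_s _) (\big[_/_]_s _) => [] [].
rewrite -big_split /=.
have ht : 0 <= t <= 1 by apply/andP; split; lra.
have ht' : 0 <= t' <= 1 by apply/andP; split; lra.
have near : nb (e / 2) (c t) (c t').
  by apply: hz => //; rewrite distrC ger0_norm; lra.
transitivity (\big[addb/false]_s (z s && (dual_pot (c t) (c t') (np (node (s, true))) (+) dual_pot (c t) (c t') (np (node (s, false)))))); last first.
  exact: (@even_sum S P node z (fun p => dual_pot (c t) (c t') (np p)) ev).
apply: eq_bigr => s _; case zs: (z s) => //=; rewrite -gs -ge.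
apply: (@Xl_dual _ _ _ _ _ _ e (e / 2)) => //; try lra.
by move=> u hu; apply: he.
Qed.
End WConst.

Lemma even_atE (S P : finType) (node : S * bool -> P) (z : S -> bool) p :
  \big[addb/false]_(d | node d == p) z d.1 =
  \big[addb/false]_s (z s && ((node (s, true) == p) (+) (node (s, false) == p))).
Proof.
transitivity (\big[addb/false]_s \big[addb/false]_(b : bool) (z s && (node (s, b) == p))).
  rewrite pair_big /= big_mkcond /=; apply: eq_bigr => -[s b] _ /=.
  by case: (node _ == p); rewrite ?andbT ?andbF.
by apply: eq_bigr => s _; rewrite big_bool /= andb_addr.
Qed.

Lemma rot_through (D P : finType) (rho : D -> D) (node : D -> P) (c z : D -> bool) (A B : D) :
  fconnect rho A B -> A != B -> (forall d, node (rho d) = node d) ->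
  (forall d, c (rho d) = c d (+) z d) ->
  (forall d, node d = node A -> d != A -> d != B -> z d = false) -> c B = c A (+) z A.
Proof.
move=> AB nAB nr hc hz.
have nI i : node (iter i rho A) = node A by elim: i => //= i <-.
have fo := findex_max AB; have eB := iter_findex AB.
have n0 : (0 < findex rho A B)%N.
  by rewrite lt0n; apply: contra nAB => /eqP e; rewrite -eB e.
suff K i : (i < findex rho A B)%N -> c (iter i.+1 rho A) = c A (+) z A.
  by rewrite -[in LHS]eB -(prednK n0) K // prednK.
elim: i => [|i IH] hi; first by rewrite /= hc.
rewrite iterS hc IH ?(ltnW hi) //.
suff -> : z (iter i.+1 rho A) = false by rewrite addbF.
apply: hz; [exact: nI| |]; apply/eqP => e.
  have := @findex_iter _ rho A i.+1 (ltn_trans hi fo); rewrite e.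
  by rewrite findex0.
have := @findex_iter _ rho A i.+1 (ltn_trans hi fo); rewrite e => e'.
by rewrite e' ltnn in hi.
Qed.

(** Without fixed points and 2-cycles [r] is a 4-cycle. If the two elements after which [u] changes
    were opposite, they would separate the other two, on which [u] agrees. So (true, true) is next
    to (false, true), likewise by [v] to (false, false), and hence opposite to (true, false). *)
Lemma four_cycle (r : bool * bool -> bool * bool) (u v : bool * bool -> bool) :
  (forall p, r p <> p) -> (forall p, r (r p) <> p) -> injective r ->
  (forall p, u (r p) = u p (+) (p \in [:: (true, true); (false, true)])) ->
  (forall p, v (r p) = v p (+) (p \in [:: (true, true); (false, false)])) ->
  u (true, false) = u (false, false) -> v (true, false) = v (false, true) ->
  forall p, r (r p) = (p.1, ~~ p.2).
Proof.
move=> n1 n2 inj hu hv eu ev.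
have f (A : Prop) (b c : bool) : b = c (+) true -> b = c -> A by case: b c => [] [].
have hu1 := hu (true, true); have hu2 := hu (true, false).
have hu3 := hu (false, true); have hu4 := hu (false, false).
have hv1 := hv (true, true); have hv2 := hv (true, false).
have hv3 := hv (false, true); have hv4 := hv (false, false).
case E1: (r (true, true)) => [[] []]; try (by case: (n1 _ E1));
case E2: (r (true, false)) => [[] []]; try (by case: (n1 _ E2)); try (by have := inj _ _ (etrans E1 (esym E2)));
  try (by case: (n2 (true, true)); rewrite E1 E2);
case E3: (r (false, true)) => [[] []]; try (by case: (n1 _ E3)); try (by have := inj _ _ (etrans E1 (esym E3)));
  try (by have := inj _ _ (etrans E2 (esym E3)));
  try (by case: (n2 (true, true)); rewrite E1 E3); try (by case: (n2 (true, false)); rewrite E2 E3);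
case E4: (r (false, false)) => [[] []]; try (by case: (n1 _ E4)); try (by have := inj _ _ (etrans E1 (esym E4)));
  try (by have := inj _ _ (etrans E2 (esym E4))); try (by have := inj _ _ (etrans E3 (esym E4)));
  try (by case: (n2 (true, true)); rewrite E1 E4); try (by case: (n2 (true, false)); rewrite E2 E4);
  try (by case: (n2 (false, true)); rewrite E3 E4);
  try (by case=> [[] []]; rewrite ?E1 ?E2 ?E3 ?E4 /= ?E1 ?E2 ?E3 ?E4);
rewrite ?E1 ?E2 ?E3 ?E4 /= in hu1 hu2 hu3 hu4 hv1 hv2 hv3 hv4; exfalso;
move: (u _) (u _) (u _) (u _) (v _) (v _) (v _) (v _) hu1 hu2 hu3 hu4 hv1 hv2 hv3 hv4 eu ev.
all: bool_cases.
Qed.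

Lemma cont_ball (R : realType) (f : R -> (R * R)%type) (x : R) A : continuous f -> nbhs (f x) A ->
  exists2 e : R, 0 < e & forall t, `|x - t| < e -> A (f t).
Proof. by move=> cf /cf /nbhs_ballP[e e0 he]; exists e. Qed.

Section Alt.
Variables (R : realType) (S P X : finType).
Local Notation pl := (R * R)%type.
Local Notation D := (S * bool)%type.
Variables (node : D -> P) (np : P -> pl) (gam : S -> R -> pl).
Hypothesis PG : plane_graph node np gam.
Variables (xn : X -> P) (ax : X -> bool -> bool -> D).
Hypothesis xn_inj : injective xn.
Hypothesis ax_node : forall x a b, node (ax x a b) = xn x.
Hypothesis ax_all : forall x d, node d = xn x -> exists a b, d = ax x a b.
Hypothesis ax_inj : forall x a b a' b', ax x a b = ax x a' b' -> a = a' /\ b = b'.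
Variables (G H : X -> pl -> pl) (V : X -> set pl) (r : X -> R).
Hypothesis r0 : forall x, 0 < r x.
Hypothesis G_cont : forall x, continuous (G x).
Hypothesis V_open : forall x, open (V x).
Hypothesis V_x : forall x, V x (np (xn x)).
Hypothesis H_cont : forall x p, V x p -> {for p, continuous (H x)}.
Hypothesis GH : forall x p, V x p -> G x (H x p) = p.
Hypothesis H0 : forall x, H x (np (xn x)) = (0, 0).
Hypothesis HG : forall x q, nb (r x) (0, 0) q -> H x (G x q) = q.
Definition co (a : bool) (q : pl) : R := if a then q.1 else q.2.
Hypothesis axes : forall x s (t : R) q, 0 <= t <= 1 -> nb (r x) (0, 0) q -> gam s t = G x q ->
  exists a b, s = (ax x a b).1 /\ co (~~ a) q = 0.
Hypothesis nodes : forall x p q, nb (r x) (0, 0) q -> np p = G x q -> p = xn x.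
Hypothesis disj : forall x x' q q', nb (r x) (0, 0) q -> nb (r x') (0, 0) q' -> G x q = G x' q' -> x = x'.

Lemma co_ext a p q : co a p = co a q -> co (~~ a) p = co (~~ a) q -> p = q.
Proof. by case: a p q => [] [? ?] [? ?] /= -> ->. Qed.

Lemma ax_seg x a b a' b' : (ax x a b).1 = (ax x a' b').1 -> a = a' /\ b = b'.
Proof.
move=> e; apply: (ax_inj (x := x)).
have := ax_node x a b; rewrite -(ax_node x a' b').
case: (ax x a b) (ax x a' b') e => s c [s' c'] /= <-.
have := pg_ne PG s; case: c c' => [] [] //= n1 n2; [rewrite n2 in n1|rewrite n2 in n1]; by rewrite eqxx in n1.
Qed.

Definition dgam (d : D) (t : R) : pl := gam d.1 (if d.2 then t else 1 - t).

Lemma dgam_cont d : continuous (dgam d).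
Proof.
case: d => s [] t; first exact: (pg_cont PG).
change (continuous_at t (gam s \o (fun t : R => 1 - t))).
apply: continuous_comp; last exact: (pg_cont PG).
by apply: cvgB; [exact: cvg_cst|exact: cvg_id].
Qed.

Lemma dgam0 d : dgam d 0 = np (node d).
Proof. by case: d => s [] /=; rewrite /dgam /= ?subr0 ?(pg_start PG) ?(pg_end PG). Qed.

Lemma tau_ex d : exists t : R, [/\ 0 < t, t <= 1 / 4 &
  forall x, node d = xn x -> forall t' : R, 0 <= t' <= t -> V x (dgam d t') /\ nb (r x) (0, 0) (H x (dgam d t'))].
Proof.
have [[x dx]|nx] := pselect (exists x, node d = xn x); last first.
  by exists (1 / 4); split; [lra|lra|move=> x dx; case: nx; exists x].
suff [t t0 ht] : exists2 t : R, 0 < t & forall t' : R, 0 <= t' <= t ->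
    V x (dgam d t') /\ nb (r x) (0, 0) (H x (dgam d t')).
  exists (Num.min t (1 / 4)); split; first by rewrite lt_min t0; lra.
    by rewrite ge_min lexx orbT.
  move=> x'; rewrite dx => /xn_inj <- t' /andP[h1]; rewrite le_min => /andP[h2 _].
  by apply: ht; rewrite h1.
have e0 : dgam d 0 = np (xn x) by rewrite dgam0 dx.
have N1 : nbhs (dgam d 0) (V x) by rewrite e0; apply: open_nbhs_nbhs; split.
have N2 : nbhs (dgam d 0) ((H x) @^-1` (ball ((0 : R), (0 : R)) (r x))).
  have := @H_cont x _ (V_x x); rewrite -e0 => hc; apply: hc.
  by rewrite /= e0 H0; apply: nbhsx_ballx.
have N : nbhs (dgam d 0) (V x `&` (H x) @^-1` (ball ((0 : R), (0 : R)) (r x))) by apply: filterI.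
have [e /= e1 he] := cont_ball (@dgam_cont d) N.
exists (e / 2); first by rewrite divr_gt0.
move=> t' /andP[h1 h2]; have [|v1 [v2 v3]] := he t'.
  by rewrite sub0r normrN ger0_norm //; lra.
by split=> //; rewrite /nb; move: v2 v3; rewrite /ball /= => /ltW -> /ltW ->.
Qed.

(** The piece of the dart up to this parameter lies in the chart; the bound 1/4 keeps the pieces cut
    off at both ends of a segment apart. *)
Definition tau d : R := proj1_sig (cid (tau_ex d)).
Lemma tau0 d : 0 < tau d. Proof. by rewrite /tau; case: (cid _) => t []. Qed.
Lemma tau4 d : tau d <= 1 / 4. Proof. by rewrite /tau; case: (cid _) => t []. Qed.
Lemma tauV x a b (t : R) : 0 <= t <= tau (ax x a b) -> V x (dgam (ax x a b) t).
Proof. by rewrite /tau; case: (cid _) => t' [_ _ h] /=; case/(h x (ax_node x a b)). Qed.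
Lemma tauH x a b (t : R) : 0 <= t <= tau (ax x a b) -> nb (r x) (0, 0) (H x (dgam (ax x a b) t)).
Proof. by rewrite /tau; case: (cid _) => t' [_ _ h] /=; case/(h x (ax_node x a b)). Qed.

Lemma tau_in d (t : R) : 0 <= t <= tau d -> 0 <= (if d.2 then t else 1 - t) <= 1.
Proof. by move=> /andP[? ?]; have := tau4 d; case: d.2 => ?; apply/andP; split; lra. Qed.

Lemma tau_axis x a b (t : R) : 0 <= t <= tau (ax x a b) -> co (~~ a) (H x (dgam (ax x a b) t)) = 0.
Proof.
move=> ht; have [a' [b' [e <-]]] := axes (tau_in ht) (tauH ht) (esym (GH (tauV ht))).
by have [-> _] := ax_seg e.
Qed.

Definition outer d := dgam d (tau d).
Definition kx x a b := co a (H x (outer (ax x a b))).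
Arguments kx : simpl never.

Lemma tau_tau d : 0 <= tau d <= tau d. Proof. by rewrite (ltW (tau0 d)) lexx. Qed.

Lemma outerH x a b : H x (outer (ax x a b)) = if a then (kx x a b, 0) else (0, kx x a b).
Proof.
by apply: (@co_ext a); rewrite ?(tau_axis (tau_tau (ax x a b))); case: (a).
Qed.

Lemma outerG x a b : outer (ax x a b) = G x (if a then (kx x a b, 0) else (0, kx x a b)).
Proof. by rewrite -outerH GH //; apply/tauV/tau_tau. Qed.

Lemma kx_le x a b : `|kx x a b| <= r x.
Proof.
have := tauH (tau_tau (ax x a b)); rewrite -/(outer _) outerH /nb !sub0r !normrN.
by case: a => /= /andP[].
Qed.

Lemma dgam_inj d (t t' : R) : 0 <= t <= tau d -> 0 <= t' <= tau d -> dgam d t = dgam d t' -> t = t'.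
Proof.
move=> ht ht' /(pg_inj PG (tau_in ht) (tau_in ht')); case: d.2 => // e.
by lra.
Qed.

Lemma dgam_sep x a b a' b' (t t' : R) : (a, b) != (a', b') -> 0 <= t <= tau (ax x a b) -> 0 <= t' <= tau (ax x a' b') ->
  dgam (ax x a b) t = dgam (ax x a' b') t' -> t = 0.
Proof.
move=> ne ht ht' e; have sn : (ax x a b).1 != (ax x a' b').1.
  by apply: contra ne => /eqP /ax_seg[-> ->].
have := pg_sep PG sn (tau_in ht) (tau_in ht') e.
by have /andP[? ?] := ht; have := tau4 (ax x a b); case: (ax x a b).2 => ? [] ?; lra.
Qed.

Lemma H_inj x p q : V x p -> V x q -> H x p = H x q -> p = q.
Proof. by move=> vp vq e; rewrite -(GH vp) e GH. Qed.

Lemma kx0 x a b : kx x a b != 0.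
Proof.
apply/eqP => k0; have := outerH x a b; rewrite k0 => e.
have z0 : 0 <= (0 : R) <= tau (ax x a b) by rewrite lexx ltW // tau0.
have : 0 = tau (ax x a b).
  apply: (dgam_inj z0 (tau_tau _)); apply: (@H_inj x); [exact: tauV|exact/tauV/tau_tau|].
  by rewrite -/(outer _) e dgam0 ax_node H0; case: (a).
by have := tau0 (ax x a b) => ? ?; lra.
Qed.

Lemma clampP (u t : R) : 0 <= u -> 0 <= Num.max 0 (Num.min u t) <= u.
Proof. by move=> u0; rewrite le_max lexx /= ge_max u0 ge_min lexx. Qed.

Lemma clamp_cont (u : R) : continuous (fun t : R => Num.max 0 (Num.min u t)).
Proof.
move=> t; apply: (@continuous_max _ _ (fun _ => 0) (fun t => Num.min u t)); first exact: cvg_cst.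
by apply: (@continuous_min _ _ (fun _ => u) id); [exact: cvg_cst|exact: cvg_id].
Qed.

Lemma clamp_id (u t : R) : 0 <= t <= u -> Num.max 0 (Num.min u t) = t.
Proof. by move=> /andP[h1 h2]; rewrite min_r // max_r. Qed.

Lemma kx_ivt x a b (k : R) : (0 <= k <= kx x a b) || (kx x a b <= k <= 0) ->
  exists2 t : R, 0 <= t <= tau (ax x a b) & co a (H x (dgam (ax x a b) t)) = k.
Proof.
move=> hk; pose d := ax x a b; have t0 := ltW (tau0 d).
pose f (t : R) := co a (H x (dgam d (Num.max 0 (Num.min (tau d) t)))).
have cf : continuous f.
  move=> t; have cH : {for t, continuous (fun t => H x (dgam d (Num.max 0 (Num.min (tau d) t))))}.
    apply: (@continuous_comp _ _ _ (fun t => dgam d (Num.max 0 (Num.min (tau d) t))) (H x)).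
      apply: (@continuous_comp _ _ _ (fun t => Num.max 0 (Num.min (tau d) t)) (dgam d)).
        exact: clamp_cont.
      exact: dgam_cont.
    by apply/H_cont/tauV/clampP.
  rewrite /f; case: (a); apply: (continuous_comp cH); [exact: cvg_fst|exact: cvg_snd].
have f0 : f 0 = 0.
  rewrite /f clamp_id ?lexx ?t0 // dgam0 ax_node H0; by case: (a).
have f1 : f (tau d) = kx x a b by rewrite /f clamp_id ?lexx ?t0.
have [||c /= cin fc] := @IVT R f 0 (tau d) k t0.
- exact: continuous_subspaceT.
- rewrite f0 f1; case/orP: hk => /andP[h1 h2].
    by rewrite (min_l (le_trans h1 h2)) (max_r (le_trans h1 h2)) h1.
  by rewrite (min_r (le_trans h1 h2)) (max_l (le_trans h1 h2)) h1.
move: cin; rewrite in_itv /= => hc.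
by exists c => //; rewrite -fc /f clamp_id.
Qed.

(** If both outer points were on one side of the origin, then by the intermediate value theorem both
    darts would pass through a common point of the axis other than x. *)
Lemma kx_opp x a : kx x a true * kx x a false < 0.
Proof.
rewrite ltNge; apply/negP => pos.
have [k k0 [h1 h2]] : exists2 k : R, k != 0 & 
    ((0 <= k <= kx x a true) || (kx x a true <= k <= 0)) /\
    ((0 <= k <= kx x a false) || (kx x a false <= k <= 0)).
  have := kx0 x a true; have := kx0 x a false.
  move: (kx x a true) (kx x a false) pos => p q pos q0 p0.
  case: (ltrP 0 p) => hp.
    have hq : 0 < q by rewrite lt_neqAle eq_sym q0 /= -(pmulr_rge0 _ hp).
    exists (Num.min p q); first by rewrite gt_eqF // lt_min hp.
    by rewrite !ge_min !le_min !lexx (ltW hp) (ltW hq) /= orbT.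
  have hp' : p < 0 by rewrite lt_neqAle p0.
  have hq : q < 0 by rewrite lt_neqAle q0 /= -(nmulr_rge0 _ hp').
  exists (Num.max p q); first by rewrite lt_eqF // gt_max hp'.
  by rewrite !le_max !ge_max !lexx (ltW hp') (ltW hq) /= !orbT.
have [t ht et] := kx_ivt h1; have [t' ht' et'] := kx_ivt h2.
have e : dgam (ax x a true) t = dgam (ax x a false) t'.
  apply: (@H_inj x); [exact: tauV|exact: tauV|].
  by apply: (@co_ext a); [rewrite et et'|rewrite !tau_axis].
have ne : (a, true) != (a, false) by case: (a).
have t0 := dgam_sep ne ht ht' e.
by move: et k0; rewrite t0 dgam0 ax_node H0; case: (a) => /= <-; rewrite eqxx.
Qed.

Local Notation S' := ((D + S) + X * bool)%type.
Local Notation P' := (P + D)%type.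
(* Every dart is cut at an outer point close to its node; at a crossing x, two
   straight segments of the chart join the outer point of one dart to those of the
   two darts of the other edge. *)
Definition node' (d : S' * bool) : P' :=
  match d.1 with
  | inl (inl e) => if d.2 then inl (node e) else inr e
  | inl (inr s) => inr (s, d.2)
  | inr xb => inr (if d.2 then ax xb.1 true true else ax xb.1 false xb.2)
  end.
Definition np' (p : P') : pl := match p with inl v => np v | inr d => outer d end.
Definition sg (w : D + S) : S := match w with inl d => d.1 | inr s => s end.
Definition pa0 (w : D + S) : R :=
  match w with inl d => if d.2 then 0 else 1 | inr s => tau (s, true) end.
Definition pa1 (w : D + S) : R :=
  match w with inl d => if d.2 then tau d else - tau d | inr s => 1 - tau (s, false) - tau (s, true) end.
Definition qb x b (t : R) : pl := ((1 - t) * kx x true true, t * kx x false b).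
Definition gam' (s : S') (t : R) : pl :=
  match s with inl w => gam (sg w) (pa0 w + pa1 w * t) | inr xb => G xb.1 (qb xb.1 xb.2 t) end.

Lemma gam'_first d t : gam' (inl (inl d)) t = dgam d (tau d * t).
Proof. by case: d => s [] /=; rewrite /dgam /= ?add0r ?mulNr. Qed.

Lemma scale (c t : R) : 0 < c -> 0 <= t <= 1 ->
  [/\ 0 <= c * t, c * t <= c, (c <= c * t -> t = 1) & (c * t <= 0 -> t = 0)].
Proof.
move=> c0 /andP[t0 t1]; split.
- by rewrite mulr_ge0 // ltW.
- by rewrite ger_pMr.
- by rewrite ler_pMr // => h; apply/eqP; rewrite eq_le t1.
- by rewrite pmulr_rle0 // => h; apply/eqP; rewrite eq_le h.
Qed.

Lemma mid_pos s : 0 < 1 - tau (s, false) - tau (s, true).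
Proof. by have := tau4 (s, false); have := tau4 (s, true) => ? ?; lra. Qed.

Lemma pa_in w (t : R) : 0 <= t <= 1 -> 0 <= pa0 w + pa1 w * t <= 1.
Proof.
case: w => [d|s] ht /=.
  have [h1 h2 _ _] := scale (tau0 d) ht; have := tau4 d => ?.
  by case: d.2; rewrite ?mulNr; apply/andP; split; lra.
have [h1 h2 _ _] := scale (mid_pos s) ht; have := tau0 (s, false); have := tau0 (s, true) => ? ?.
by apply/andP; split; lra.
Qed.

Lemma pa1_neq0 w : pa1 w != 0.
Proof.
case: w => [d|s] /=; last by rewrite gt_eqF // mid_pos.
by case: d.2; rewrite ?oppr_eq0 gt_eqF // tau0.
Qed.

Lemma pa_end w (t : R) : 0 <= t <= 1 -> pa0 w + pa1 w * t = 0 \/ pa0 w + pa1 w * t = 1 -> t = 0 \/ t = 1.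
Proof.
case: w => [d|s] ht /=.
  have [h1 h2 _ h3] := scale (tau0 d) ht; have := tau4 d => ?.
  by case: d.2; rewrite ?mulNr => -[] e; left; apply: h3; lra.
have [h1 h2 _ _] := scale (mid_pos s) ht; have := tau0 (s, false); have := tau0 (s, true) => ? ?.
by case=> e; lra_absurd t.
Qed.

Lemma pa_sep w w' (t t' : R) : 0 <= t <= 1 -> 0 <= t' <= 1 -> w != w' -> sg w = sg w' ->
  pa0 w + pa1 w * t = pa0 w' + pa1 w' * t' -> t = 0 \/ t = 1.
Proof.
case: w w' => [[s b]|s] [[s' b']|s'] ht ht' ne /= es; rewrite -{s'}es in ne *.
- have [h1 h2 _ _] := scale (tau0 (s, b)) ht; have [h1' h2' _ _] := scale (tau0 (s, b')) ht'.
  have := tau4 (s, b); have := tau4 (s, b'); case: b b' ne h1 h2 h1' h2' => [] [];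
  rewrite ?eqxx ?mulNr // => _ ? ? ? ? ? ? e; lra_absurd t.
- have [h1 h2 h3 _] := scale (tau0 (s, b)) ht; have [h1' h2' _ _] := scale (mid_pos s) ht'.
  by case: b {ne} h1 h2 h3; rewrite ?mulNr => ? ? h3 e; right; apply: h3; lra.
- have [h1 h2 h3 h4] := scale (mid_pos s) ht; have [h1' h2' _ _] := scale (tau0 (s, b')) ht'.
  case: b' {ne} h1' h2'; rewrite ?mulNr => ? ? e.
    by left; apply: h4; lra.
  by right; apply: h3; lra.
- by rewrite eqxx in ne.
Qed.

Lemma sepW w w' (t t' : R) : 0 <= t <= 1 -> 0 <= t' <= 1 -> w != w' ->
  gam' (inl w) t = gam' (inl w') t' -> t = 0 \/ t = 1.
Proof.
move=> ht ht' ne /= e; have [es|ns] := eqVneq (sg w) (sg w').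
  by move: e; rewrite es => /(pg_inj PG (pa_in w ht) (pa_in w' ht')) /(pa_sep ht ht' ne es).
exact: pa_end ht (pg_sep PG ns (pa_in w ht) (pa_in w' ht') e).
Qed.

Lemma outerE d : outer d = gam' (inl (inl d)) 1.
Proof. by rewrite gam'_first mulr1. Qed.

Lemma injW w (t t' : R) : 0 <= t <= 1 -> 0 <= t' <= 1 -> gam' (inl w) t = gam' (inl w) t' -> t = t'.
Proof.
move=> ht ht' /= /(pg_inj PG (pa_in w ht) (pa_in w ht')) /addrI.
exact: (mulfI (pa1_neq0 w)).
Qed.

Lemma I1 : 0 <= (1 : R) <= 1. Proof. by rewrite ler01 lexx. Qed.
Lemma sep_outer w d (t : R) : 0 <= t <= 1 -> gam' (inl w) t = outer d -> t = 0 \/ t = 1.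
Proof.
move=> ht; rewrite outerE; have [->|ne] := eqVneq w (inl d).
  by move=> /(injW ht I1) ->; right.
exact: sepW ht I1 ne.
Qed.

Lemma qb_in x b (t : R) : 0 <= t <= 1 -> nb (r x) (0, 0) (qb x b t).
Proof.
move=> /andP[t0 t1]; rewrite /nb /qb /= !sub0r !normrN !normrM.
rewrite (ger0_norm t0) ger0_norm; last lra.
have k1 := kx_le x true true; have k2 := kx_le x false b.
have n1 := normr_ge0 (kx x true true); have n2 := normr_ge0 (kx x false b).
apply/andP; split.
  by apply: le_trans k1; apply: ler_piMl => //; lra.
by apply: le_trans k2; apply: ler_piMl.
Qed.

Lemma qb_axis x b (t : R) s (u : R) : 0 <= t <= 1 -> 0 <= u <= 1 -> gam s u = G x (qb x b t) -> t = 0 \/ t = 1.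
Proof.
move=> ht hu /(axes hu (qb_in x b ht)) [a [b' [_]]].
have ka : kx x true true != 0 := kx0 x true true; have kb : kx x false b != 0 := kx0 x false b.
move: ka kb; rewrite /qb; move: (kx x true true) (kx x false b) => k1 k2 n1 n2.
case: a => /= /eqP; rewrite mulf_eq0 ?(negbTE n1) ?(negbTE n2) orbF => /eqP ?; first by left.
by right; lra.
Qed.

Lemma G_inj x q q' : nb (r x) (0, 0) q -> nb (r x) (0, 0) q' -> G x q = G x q' -> q = q'.
Proof. by move=> h h' e; rewrite -(HG h) e HG. Qed.

Lemma cont_pair (f g : R -> R) : continuous f -> continuous g -> continuous (fun t => (f t, g t) : pl).
Proof. by move=> cf cg t; exact: (cvg_pair (cf t) (cg t)). Qed.

Lemma affine_cont (a b : R) : continuous (fun t : R => a + b * t).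
Proof. by move=> t; apply: cvgD; [exact: cvg_cst|apply: cvgM; [exact: cvg_cst|exact: cvg_id]]. Qed.

Lemma outer_node d v : outer d <> np v.
Proof.
rewrite outerE => /(pg_node PG (pa_in _ I1)) /= e.
have := tau0 d; have := tau4 d => h1 h2; move: e; case: d.2; rewrite ?mulr1 => -[] e; lra.
Qed.

Lemma outer_inj : injective outer.
Proof.
move=> d d' e; apply/eqP; apply: contraT => ne; have := e; rewrite !outerE /= => e1.
have [es|ns] := eqVneq d.1 d'.1.
  move: e1; rewrite es => e1; have := pg_inj PG (pa_in (inl d) I1) (pa_in (inl d') I1) e1 => /=.
  clear e1; case: d d' {e} ne es => s b [s' b'] /= ne es; rewrite -{s'}es in ne *.
  have := tau4 (s, b); have := tau4 (s, b'); case: b b' ne => [] []; rewrite ?eqxx // => _ h1 h2 e; lra.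
have := pg_sep PG ns (pa_in (inl d) I1) (pa_in (inl d') I1) e1 => /= e2.
have := tau0 d; have := tau4 d => h1 h2; clear e e1; move: e2; case: d.2; rewrite ?mulr1 => -[] e2; lra_absurd (tau d).
Qed.

Lemma gam'_start s : gam' s 0 = np' (node' (s, true)).
Proof.
case: s => [[d|s]|[x b]] /=.
- by rewrite mulr0 addr0 -dgam0 /dgam subr0.
- by rewrite mulr0 addr0.
- by rewrite outerG /qb subr0 mul1r mul0r.
Qed.

Lemma gam'_end s : gam' s 1 = np' (node' (s, false)).
Proof.
case: s => [[d|s]|[x b]].
- by rewrite /= -/(gam' (inl (inl d)) 1) -outerE.
- by rewrite /= mulr1 /outer /dgam /= addrC subrK.
- by rewrite /= outerG /qb subrr mul1r mul0r.
Qed.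

Lemma PG' : plane_graph node' np' gam'.
Proof.
split.
- case=> [w|[x b]] t.
    change (continuous_at t (gam (sg w) \o (fun t : R => pa0 w + pa1 w * t))).
    by apply: continuous_comp; [exact: affine_cont|exact: (pg_cont PG)].
  change (continuous_at t (G x \o qb x b)).
  apply: continuous_comp; last exact: G_cont.
  apply: (@cont_pair (fun t => (1 - t) * kx x true true) (fun t => t * kx x false b)) => {}t.
    by apply: cvgM; [apply: cvgB; [exact: cvg_cst|exact: cvg_id]|exact: cvg_cst].
  by apply: cvgM; [exact: cvg_id|exact: cvg_cst].
- exact: gam'_start.
- exact: gam'_end.
- move=> [v|d] [v'|d'] /=.
  + by move=> /(pg_np PG) ->.
  + by move=> /esym /outer_node.
  + by move=> /outer_node.
  + by move=> /outer_inj ->.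
- case=> [[d|s]|[x b]] //=; rewrite /node' /=; apply/eqP => // -[e] //.
  by have [] := ax_inj e.
- case=> [w|[x b]] t t' ht ht'; first exact: injW.
  move=> /(G_inj (qb_in x b ht) (qb_in x b ht')) [/(mulIf (kx0 x true true)) e _]; lra.
- case=> [w|[x b]] [w'|[x' b']] t t' ne ht ht'.
  + exact: sepW.
  + move=> e; have [e'|e'] := qb_axis ht' (pa_in w ht) e; move: e; rewrite e'.
      by rewrite gam'_start; apply: sep_outer.
    by rewrite gam'_end; apply: sep_outer.
  + by move=> /esym /(qb_axis ht (pa_in w' ht')).
  + move=> /= e; have ex := disj (qb_in x b ht) (qb_in x' b' ht') e.
    subst x'; move: e => /(G_inj (qb_in x b ht) (qb_in x b' ht')) [/(mulIf (kx0 x true true)) e1 e2].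
    have {}e1 : t = t' by lra.
    move: e2; rewrite -{t' ht'}e1 => /eqP; rewrite -subr_eq0 -mulrBr mulf_eq0 => /orP[/eqP ->|]; first by left.
    rewrite subr_eq0 => /eqP ek; exfalso.
    have := kx_opp x false; move: ek ne; case: b b' => [] []; rewrite ?eqxx //= => -> _;
      by rewrite ltNge -expr2 sqr_ge0.
- case=> [w|[x b]] t [v|d] ht /=.
  + by move=> /(pg_node PG (pa_in w ht)) /(pa_end ht).
  + exact: sep_outer.
  + move=> e; have ev := nodes (qb_in x b ht) (esym e); move: e; rewrite ev => e.
    have := HG (qb_in x b ht); rewrite e H0 /qb => -[/esym/eqP]; rewrite mulf_eq0 (negbTE (kx0 _ _ _)) orbF.
    by move=> /eqP ? _; right; lra.
  + by move=> /esym; rewrite outerE; apply: qb_axis ht (pa_in _ I1).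
Qed.

Definition lift (z : S -> bool) (s : S') : bool := if s is inl w then z (sg w) else false.

Lemma lift_even z : (forall p, even_at node z p) -> forall p, even_at node' (lift z) p.
Proof.
move=> ev p; rewrite /even_at even_atE big_sumType /= big_sumType /=.
rewrite [X in _ (+) X]big1 // addbF.
have E (q : pred D) : \big[addb/false]_d (z d.1 && q d) = \big[addb/false]_(d | q d) z d.1.
  by rewrite [RHS]big_mkcond; apply: eq_bigr => d _; case: (q d); rewrite ?andbT ?andbF.
case: p => [v|d0].
  rewrite [X in _ (+) X]big1 => [|s _]; last by rewrite andbF.
  rewrite addbF -[RHS](ev v) -(E (fun d => node d == v)); apply: eq_bigr => d _.
  by rewrite addbF.
transitivity (\big[addb/false]_(d | d == d0) z d.1 (+) \big[addb/false]_(d | id d == d0) z d.1); last exact: addbb.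
congr (_ (+) _); last by rewrite (@even_atE S D id z d0).
by rewrite -(E (fun d => d == d0)).
Qed.

Lemma big_one (I : finType) (i : I) (F : I -> bool) : \big[addb/false]_j ((j == i) && F j) = F i.
Proof.
rewrite -(big_pred1_eq addb i F) [RHS]big_mkcond; apply: eq_bigr => j _; by case: eqP.
Qed.

(* The two outer points at x off this triangle are joined by a straight segment of
   the chart, which avoids it: their darts are not separated by the other two. *)
Definition tri x b (s : S') : bool :=
  (s == inl (inl (ax x true true))) (+) (s == inl (inl (ax x false b))) (+) (s == inr (x, b)).

Lemma tri_even x b p : even_at node' (tri x b) p.
Proof.
rewrite /even_at even_atE.
transitivity (\big[addb/false]_s ((s == inl (inl (ax x true true))) && ((node' (s, true) == p) (+) (node' (s, false) == p)) (+)
  (s == inl (inl (ax x false b))) && ((node' (s, true) == p) (+) (node' (s, false) == p)) (+)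
  (s == inr (x, b)) && ((node' (s, true) == p) (+) (node' (s, false) == p)))).
  by apply: eq_bigr => s _; rewrite /tri !andb_addl.
rewrite !big_split !big_one /node' /= !ax_node.
by case: (_ == p) (_ == p) (_ == p) => [] [] [].
Qed.

(** The segment lies in the quadrant opposite to the one with the diagonal of the triangle, and
    meets the axes only at the two outer points off the triangle. *)
Lemma path_off x b (t u : R) s : 0 <= t <= 1 -> 0 <= u <= 1 -> tri x b s ->
  gam' s t <> G x ((1 - u) * kx x true false, u * kx x false (~~ b)).
Proof.
move=> ht hu.
have qin : nb (r x) (0, 0) ((1 - u) * kx x true false, u * kx x false (~~ b)).
  have /andP[u0 u1] := hu; rewrite /nb /= !sub0r !normrN !normrM (ger0_norm u0) ger0_norm; last lra.
  apply/andP; split.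
    by apply: le_trans (kx_le x true false); apply: ler_piMl => //; lra.
  by apply: le_trans (kx_le x false (~~ b)); apply: ler_piMl.
have st d : 0 <= tau d * t <= tau d by have [h1 h2 _ _] := scale (tau0 d) ht; rewrite h1 h2.
have T : tri x b s -> [\/ s = inl (inl (ax x true true)), s = inl (inl (ax x false b)) | s = inr (x, b)].
  rewrite /tri; case: eqP => [->|_]; first by constructor 1.
  by case: eqP => [->|_]; [constructor 2|case: eqP => // ->; constructor 3].
move=> /T[] {T} -> e.
- have [a [b' [/= es]]] := axes (pa_in (inl (ax x true true)) ht) qin e.
  have [<- _] := ax_seg es => /= /eqP; rewrite mulf_eq0 (negbTE (kx0 _ _ _)) orbF => /eqP u0.
  have : dgam (ax x true false) (tau (ax x true false)) = dgam (ax x true true) (tau (ax x true true) * t).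
    by rewrite -gam'_first e -/(outer _) outerG u0 subr0 mul1r mul0r.
  move=> /(dgam_sep _ (tau_tau _) (st _)) => /(_ isT) e0.
  by have := tau0 (ax x true false); rewrite e0 ltxx.
- have [a [b' [/= es]]] := axes (pa_in (inl (ax x false b)) ht) qin e.
  have [<- _] := ax_seg es => /= /eqP; rewrite mulf_eq0 (negbTE (kx0 _ _ _)) orbF => /eqP u0.
  have u1 : u = 1 by lra.
  have : dgam (ax x false (~~ b)) (tau (ax x false (~~ b))) = dgam (ax x false b) (tau (ax x false b) * t).
    by rewrite -gam'_first e -/(outer _) outerG u1 subrr mul1r mul0r.
  have ne : (false, ~~ b) != (false, b) by case: (b).
  move=> /(dgam_sep ne (tau_tau _) (st _)) e0.
  by have := tau0 (ax x false (~~ b)); rewrite e0 ltxx.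
- have := G_inj (qb_in x b ht) qin e; rewrite /qb => -[].
  have p1 := kx_opp x true.
  have p2 : kx x false b * kx x false (~~ b) < 0.
    by have := kx_opp x false; case: (b); rewrite // mulrC.
  move: (kx x true true) (kx x true false) (kx x false b) (kx x false (~~ b)) p1 p2 => k1 k2 y1 y2 p1 p2 e1 e2.
  have /andP[t0 t1] := ht; have /andP[u0 u1] := hu.
  have z1 : u = 1.
    apply/eqP; rewrite eq_le u1 leNgt; apply/negP => ul.
    have : (1 - t) * k1 * k2 = (1 - u) * (k2 * k2) by rewrite e1 mulrA.
    rewrite -mulrA => e3; have : 0 < (1 - u) * (k2 * k2).
      apply: mulr_gt0; first lra.
      by rewrite lt_neqAle -expr2 sqr_ge0 andbT eq_sym sqrf_eq0; apply/eqP => k0; rewrite k0 mulr0 ltxx in p1.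
    by rewrite -e3 ltNge mulr_ge0_le0 ?(ltW p1) //; lra.
  have : t * (y1 * y2) = u * (y2 * y2) by rewrite mulrA e2 mulrA.
  rewrite z1 mul1r => e3; have : 0 < y2 * y2.
    by rewrite lt_neqAle -expr2 sqr_ge0 andbT eq_sym sqrf_eq0; apply/eqP => k0; rewrite k0 mulr0 ltxx in p2.
  by rewrite -e3 ltNge mulr_ge0_le0 ?(ltW p2).
Qed.

Lemma tri_path x b :
  \big[addb/false]_s (tri x b s && Xl (gam' s) 0 1 (outer (ax x true false))) =
  \big[addb/false]_s (tri x b s && Xl (gam' s) 0 1 (outer (ax x false (~~ b)))).
Proof.
pose c (u : R) := G x ((1 - u) * kx x true false, u * kx x false (~~ b)).
have -> : outer (ax x true false) = c 0 by rewrite outerG /c subr0 mul1r mul0r.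
have -> : outer (ax x false (~~ b)) = c 1 by rewrite outerG /c subrr mul1r mul0r.
apply: (winding_const (pg_cont PG') (pg_start PG') (pg_end PG')).
- exact: tri_even.
- move=> u; change (continuous_at u (G x \o (fun u => ((1 - u) * kx x true false, u * kx x false (~~ b)) : pl))).
  apply: continuous_comp; last exact: G_cont.
    apply: (@cont_pair (fun u => (1 - u) * kx x true false) (fun u => u * kx x false (~~ b))) => {}u.
      by apply: cvgM; [apply: cvgB; [exact: cvg_cst|exact: cvg_id]|exact: cvg_cst].
    by apply: cvgM; [exact: cvg_id|exact: cvg_cst].
- by move=> s t t' zs ht ht'; apply: path_off.
Qed.

Lemma Xl_seg (s : S) p : (forall t : R, 0 <= t <= 1 -> gam s t <> p) ->
  Xl (gam' (inl (inl (s, true)))) 0 1 p (+) Xl (gam' (inl (inl (s, false)))) 0 1 p (+) Xl (gam' (inl (inr s))) 0 1 p =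
  Xl (gam s) 0 1 p.
Proof.
move=> off; have cg : continuous (gam s) := @pg_cont _ _ _ _ _ _ PG s; have m0 := mid_pos s.
have t0 := tau0 (s, true); have f0 := tau0 (s, false); have t4 := tau4 (s, true); have f4 := tau4 (s, false).
have o (w : D + S) : sg w = s -> forall t : R, 0 <= t <= 1 -> gam s (pa0 w + pa1 w * t) <> p.
  by move=> es t ht; rewrite -es in off *; apply: off; apply: pa_in.
have E1 : Xl (gam' (inl (inl (s, true)))) 0 1 p = Xl (gam s) 0 (tau (s, true)) p.
  rewrite /= (Xl_reparam cg ler01 t0); last exact: (o (inl (s, true)) erefl).
  by rewrite mulr0 mulr1 !add0r.
have E2 : Xl (gam' (inl (inr s))) 0 1 p = Xl (gam s) (tau (s, true)) (1 - tau (s, false)) p.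
  rewrite /= (Xl_reparam cg ler01 m0); last exact: (o (inr s) erefl).
  by rewrite mulr0 mulr1 addr0 addrC subrK.
have E3 : Xl (gam' (inl (inl (s, false)))) 0 1 p = Xl (gam s) (1 - tau (s, false)) 1 p.
  pose g (t : R) := gam s ((1 - tau (s, false)) + tau (s, false) * t).
  have cgg : continuous g.
    move=> t; apply: (@continuous_comp _ _ _ (fun t : R => (1 - tau (s, false)) + tau (s, false) * t) (gam s)).
      exact: affine_cont.
    exact: cg.
  have offg t : 0 <= t <= 1 -> g t <> p.
    move=> ht; have [h1 h2 _ _] := scale f0 ht; apply: off; apply/andP; split; lra.
  have e1 : gam' (inl (inl (s, false))) = fun t => g (1 - t).
    by apply/funext => t; rewrite /= /g; congr (gam s _); rewrite mulrBr mulr1; lra.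
  have := Xl_rev 1 cgg ler01 offg; rewrite subrr subr0 e1 => ->.
  rewrite /g (Xl_reparam cg ler01 f0); last exact: offg.
  by rewrite mulr0 mulr1 addr0 subrK.
rewrite E1 E2 E3 addbAC -(Xl_cat cg); try lra.
  by rewrite -(Xl_cat cg) //; lra.
by move=> t /andP[? ?]; apply: off; apply/andP; split; lra.
Qed.

Definition fd (d : D) : S' * bool := (inl (inl d), true).

Lemma fd_inj : injective fd.
Proof. by move=> d d' [->]. Qed.

Lemma lift_sum (z : S -> bool) p : (forall s (t : R), z s -> 0 <= t <= 1 -> gam s t <> p) ->
  \big[addb/false]_s (lift z s && Xl (gam' s) 0 1 p) = \big[addb/false]_s (z s && Xl (gam s) 0 1 p).
Proof.
move=> off; rewrite big_sumType /= big_sumType /= [X in _ (+) X]big1 // addbF.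
have -> : \big[addb/false]_d (z d.1 && Xl (gam' (inl (inl d))) 0 1 p) =
    \big[addb/false]_s \big[addb/false]_(b : bool) (z s && Xl (gam' (inl (inl (s, b)))) 0 1 p).
  by rewrite pair_big /=; apply: eq_bigr => -[].
rewrite -big_split; apply: eq_bigr => s _; rewrite big_bool /=.
by case zs: (z s) => //=; rewrite -(Xl_seg (fun t => @off s t zs)).
Qed.

(** The rotation is inherited from the refined graph, where an old node carries only first pieces.
    At x, [tri_path] makes the two darts on the triangle [tri x b] neighbours in the cyclic order;
    for both values of b, [four_cycle] turns this into alternation. *)
Theorem plane_rotation_alt : exists rho : D -> D,
  [/\ injective rho, forall d, node (rho d) = node d,
      forall d d', node d = node d' -> fconnect rho d d',
      forall z, (forall p, even_at node z p) -> exists c : D -> bool,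
        [/\ forall d, c (rho d) = c d (+) z d.1, forall d, c d (+) c (alpha d) = z d.1 &
         forall d, (forall s, z s -> (node d != node (s, true)) && (node d != node (s, false))) ->
           c d = \big[addb/false]_s (z s && Xl (gam s) 0 1 (np (node d)))] &
      forall x a b, rho (rho (ax x a b)) = ax x a (~~ b)].
Proof.
have [rho' [rinj rnode rtr rc]] := plane_rotation PG'.
have ex d : exists d', rho' (fd d) = fd d'.
  have := rnode (fd d); rewrite /node' /=; case: (rho' (fd d)) => [[[d'|s]|xb] []] //= _.
  by exists d'.
have [rho hrho] := fin_all_exists ex.
have nrho d : node (rho d) = node d.
  by have := rnode (fd d); rewrite hrho => -[].
have rI : injective rho.
  by move=> d d' e; apply/fd_inj/rinj; rewrite !hrho e.
have it n d : iter n rho' (fd d) = fd (iter n rho d) by elim: n => //= n ->; rewrite hrho.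
have tr d d' : node d = node d' -> fconnect rho d d'.
  move=> e; have : fconnect rho' (fd d) (fd d') by apply: rtr; rewrite /node' /= e.
  by move=> /iter_findex; rewrite it => /fd_inj <-; apply: fconnect_iter.
exists rho; split=> //.
  move=> z ev; have [c' [c1 c2 c3]] := rc _ (lift_even ev).
  (* Around an outer point only a first piece and a middle piece can belong to the lifted set, since
     diagonals never do. *)
  have thr s b : c' (inl (inl (s, b)), false) = c' (inl (inr s), b) (+) z s.
    have := @rot_through _ _ rho' node' c' (fun d => lift z d.1) (inl (inr s), b) (inl (inl (s, b)), false).
    apply=> //; first exact: rtr.
    move=> [[[d|s']|xb] b'] //=; rewrite /node' /=; case: b' => //= -[] e.
    + by rewrite e /= => _; rewrite eqxx.
    + by rewrite e => <- /eqP.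
    + by move: e => -> <- /eqP.
  exists (fun d => c' (fd d)); split=> [d|[s b]|d off].
  - by rewrite -hrho c1.
  - have e1 := c2 (fd (s, b)); have e2 := c2 (fd (s, ~~ b)); have e3 := c2 (inl (inr s), b).
    rewrite /alpha /= in e1 e2 e3 *; rewrite !thr in e1 e2.
    move: (c' (fd (s, b))) (c' (fd (s, ~~ b))) (c' (inl (inr s), b)) (c' (inl (inr s), ~~ b)) e1 e2 e3.
    by case: (z s) => [] [] [] [] [].
  - rewrite c3.
      rewrite lift_sum // => s t zs ht; have /andP[n1 n2] := off s zs => e.
      have [] := pg_node PG ht e => e0; move: e; rewrite e0.
        by rewrite (pg_start PG) => /(pg_np PG) e; rewrite e eqxx in n1.
      by rewrite (pg_end PG) => /(pg_np PG) e; rewrite e eqxx in n2.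
    move=> [[d'|s]|xb] //= zs; rewrite /node' /=.
    have := off _ zs; rewrite andbT => nn; apply/eqP => -[e]; move: nn; rewrite e.
    by case: d' {zs e} => s []; rewrite /= eqxx ?andbF.
move=> x; pose A (p : bool * bool) := ax x p.1 p.2.
have AI : injective A by move=> [a b] [a' b'] /ax_inj /= [-> ->].
have exA p : exists p', rho (A p) = A p'.
  have [|a [b e]] := @ax_all x (rho (A p)); first by rewrite nrho ax_node.
  by exists (a, b).
have [q hq] := fin_all_exists exA.
have itA n p : iter n rho (A p) = A (iter n q p) by elim: n => //= n ->; rewrite hq.
have cyc p p' : fconnect q p p'.
  have : fconnect rho (A p) (A p') by apply: tr; rewrite /A !ax_node.
  by move=> /iter_findex; rewrite itA => /AI <-; apply: fconnect_iter.
have qI : injective q by move=> p p' e; apply/AI/rI; rewrite !hq e.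
have ord4 p : order q p = 4%N.
  rewrite /order -[RHS](_ : #|{: bool * bool}| = _); last by rewrite card_prod !card_bool.
  by apply: eq_card => p'; rewrite !inE; apply: cyc.
have nofix k p : (0 < k < 4)%N -> iter k q p <> p.
  move=> /andP[k0 k4] e; have := @findex_iter _ q p k; rewrite ord4 e findex0 => /(_ k4) e0.
  by rewrite -e0 in k0.
have K b : exists u : bool * bool -> bool,
    (forall p, u (q p) = u p (+) (p \in [:: (true, true); (false, b)])) /\ u (true, false) = u (false, ~~ b).
  have [c [c1 c2 c3]] := rc _ (tri_even x b).
  exists (fun p => c (fd (A p))); split=> [p|].
    rewrite -hq -hrho c1; congr (_ (+) _).
    have E (p' : bool * bool) : (inl (inl (A p)) == inl (inl (A p')) :> S') = (p == p').
      by rewrite -(inj_eq AI).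
    rewrite /tri /= /fd /= -/(A (true, true)) -/(A (false, b)) !E addbF !inE.
    by case: (p) => [[] []]; case: (b).
  have Q p : p \notin [:: (true, true); (false, b)] ->
      c (fd (A p)) = \big[addb/false]_s (tri x b s && Xl (gam' s) 0 1 (outer (A p))).
    move=> np0; have T : tri x b (inl (inl (A p))) = false.
      have E (p' : bool * bool) : (inl (inl (A p)) == inl (inl (A p')) :> S') = (p == p').
        by rewrite -(inj_eq AI).
      rewrite /tri -/(A (true, true)) -/(A (false, b)) !E addbF.
      by move: np0; rewrite !inE negb_or => /andP[/negbTE -> /negbTE ->].
    have := c2 (fd (A p)); rewrite {1}/fd /= T /alpha /= => e.
    have -> : c (fd (A p)) = c (inl (inl (A p)), false) by move: e; case: (c _) (c _) => [] [].
    have n1 : A p <> ax x true true by move=> /(AI p (true, true)) e'; rewrite e' !inE eqxx in np0.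
    have n2 : A p <> ax x false b by move=> /(AI p (false, b)) e'; rewrite e' !inE eqxx orbT in np0.
    rewrite c3 // => s; rewrite /tri; case: eqP => [->|_].
      by rewrite /node' /= => _; apply/eqP => -[/n1].
    case: eqP => [->|_]; first by rewrite /node' /= => _; apply/eqP => -[/n2].
    by case: eqP => [-> _|//]; rewrite /node' /=; apply/andP; split; apply/eqP => -[]; [exact: n1|exact: n2].
  rewrite !Q; first exact: tri_path.
    by case: (b).
  by case: (b).
have [u [u1 u2]] := K true; have [v [v1 v2]] := K false.
move=> a b; rewrite -/(A (a, b)) !hq.
have -> // : q (q (a, b)) = (a, ~~ b).
apply: (@four_cycle q u v) => // p; [exact: (nofix 1)|exact: (nofix 2)].
Qed.
End Alt.

(** * Segments of a plane drawing *)

Section PlaneDrawing.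
Variables (R : realType) (n : nat) (E : finType) (ends : E -> 'I_n * 'I_n).
Local Notation pl := (R * R)%type.
Variables (pv : 'I_n -> pl) (A : E -> R -> pl).
Hypothesis A_cont : forall e, continuous (A e).
Hypothesis A_inj : forall e (t t' : R), 0 <= t <= 1 -> 0 <= t' <= 1 -> A e t = A e t' -> t = t'.
Hypothesis A0 : forall e, A e 0 = pv (ends e).1.
Hypothesis A1 : forall e, A e 1 = pv (ends e).2.
Hypothesis pv_inj : injective pv.
Hypothesis A_pv : forall e (t : R) v, 0 <= t <= 1 -> A e t = pv v -> t = 0 \/ t = 1.
Definition meets e f (p : pl) := e != f /\
  exists s t : R, [/\ 0 < s < 1, 0 < t < 1, A e s = p & A f t = p].
Variable xs : seq pl.
Hypothesis xsP : forall p, p \in xs <-> exists e f, meets e f p.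
Hypothesis no3 : forall e f g (s t u : R), e != f -> f != g -> e != g ->
  0 < s < 1 -> 0 < t < 1 -> 0 < u < 1 -> A e s = A f t -> A f t = A g u -> False.

Local Notation X := (seq_sub xs).
Local Notation P := ('I_n + X)%type.

Lemma inner_le (t : R) : 0 < t < 1 -> 0 <= t <= 1.
Proof. by move=> /andP[/ltW -> /ltW ->]. Qed.

Lemma vertex_xs v : pv v \notin xs.
Proof.
apply/negP => /xsP[e [f [_ [s [t [hs _ es _]]]]]].
by case: (A_pv (inner_le hs) es) => s0; rewrite s0 ltxx ?andbF in hs.
Qed.

Lemma inner_xs e (t : R) : 0 <= t <= 1 -> A e t \in xs -> 0 < t < 1.
Proof.
move=> /andP[t0 t1] ex; apply/andP; split; rewrite lt_neqAle ?t0 ?t1 andbT; apply: contraTneq ex.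
  by move=> <-; rewrite A0; exact: vertex_xs.
by move=> ->; rewrite A1; exact: vertex_xs.
Qed.

Definition onT e (t : R) : bool := [|| t == 0, t == 1 | (0 <= t <= 1) && (A e t \in xs)].

Lemma onT01 e t : onT e t -> 0 <= t <= 1.
Proof. by case/or3P => [/eqP ->|/eqP ->|/andP[]] //; rewrite ?lexx ?ler01. Qed.

(** By injectivity a crossing has at most one parameter on the edge. The bound on the size allows
    one ordinal type to number the segments of all edges. *)
Lemma cuts_ex e : exists l : seq R,
  [/\ sorted <%R l, forall t, (t \in l) = onT e t & (size l <= size xs + 2)%N].
Proof.
have exp x : exists t : R, onT e t /\ (forall t', 0 <= t' <= 1 -> x \in xs -> A e t' = x -> t' = t).
  have [[t [ht et]]|no] := pselect (exists t : R, 0 <= t <= 1 /\ A e t = x).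
    case xx: (x \in xs); last by exists 0; rewrite /onT eqxx.
    exists t; rewrite /onT ht et xx !orbT; split=> // t' ht' _ et'.
    by apply: (@A_inj e) => //; rewrite et et'.
  exists 0; rewrite /onT eqxx; split=> // t' ht' _ et'; case: no; by exists t'.
have [f hf] := choice exp.
exists (sort <=%R (undup (0 :: 1 :: map f xs))); split.
- by rewrite sort_lt_sorted undup_uniq.
- move=> t; rewrite mem_sort mem_undup !inE; apply/idP/idP.
    case/or3P => [/eqP ->|/eqP ->|/mapP[x xx ->]]; rewrite /onT ?eqxx ?orbT //.
    by case: (hf x).
  case/or3P => [->|->|/andP[ht ex]]; rewrite ?orbT //.
  apply/orP; right; apply/orP; right; apply/mapP; exists (A e t) => //.
  by case: (hf (A e t)) => _; apply.
- by rewrite size_sort (leq_trans (size_undup _)) //= size_map addn2.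
Qed.

Definition T e : seq R := proj1_sig (cid (cuts_ex e)).
Lemma T_sorted e : sorted <%R (T e). Proof. by rewrite /T; case: cid => l []. Qed.
Lemma T_mem e t : (t \in T e) = onT e t. Proof. by rewrite /T; case: cid => l []. Qed.
Lemma T_size e : (size (T e) <= size xs + 2)%N. Proof. by rewrite /T; case: cid => l []. Qed.
Definition Tn e i : R := nth 0 (T e) i.
Definition m e : nat := (size (T e)).-1.

Lemma m_size e : size (T e) = (m e).+1.
Proof. by rewrite /m prednK //; have : 0 \in T e by [rewrite T_mem /onT eqxx]; case: (T e). Qed.

Lemma Tn_on e i : (i <= m e)%N -> onT e (Tn e i).
Proof. by move=> hi; rewrite -T_mem mem_nth // m_size. Qed.

Lemma Tn_lt e i j : (i < j)%N -> (j <= m e)%N -> Tn e i < Tn e j.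
Proof.
move=> ij jm; apply: (sorted_ltn_nth lt_trans 0 (T_sorted e)); rewrite ?inE ?m_size ?ltnS //.
exact: leq_trans (ltnW ij) jm.
Qed.

Lemma Tn_le e i j : (i <= j)%N -> (j <= m e)%N -> Tn e i <= Tn e j.
Proof. by rewrite leq_eqVlt => /orP[/eqP -> //|ij jm]; rewrite ltW // Tn_lt. Qed.

Lemma Tn_inj e i j : (i <= m e)%N -> (j <= m e)%N -> Tn e i = Tn e j -> i = j.
Proof.
move=> im jm ee; case: (ltngtP i j) => // h; [have := Tn_lt h jm|have := Tn_lt h im];
  by rewrite ee ltxx.
Qed.

Lemma Tn_ex e t : onT e t -> exists2 i, (i <= m e)%N & t = Tn e i.
Proof.
by rewrite -T_mem => /(nthP 0)[i]; rewrite m_size ltnS => im <-; exists i.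
Qed.

Lemma Tn0 e : Tn e 0 = 0.
Proof.
have [|i im e0] := @Tn_ex e 0; first by rewrite /onT eqxx.
apply/eqP; rewrite eq_le; have /andP[-> _] := onT01 (Tn_on (leq0n (m e))).
by rewrite [X in _ <= X]e0 Tn_le.
Qed.

Lemma Tnm e : Tn e (m e) = 1.
Proof.
have [|i im e0] := @Tn_ex e 1; first by rewrite /onT eqxx orbT.
apply/eqP; rewrite eq_le; have /andP[_ ->] := onT01 (Tn_on (leqnn (m e))).
by rewrite [X in X <= _]e0 Tn_le.
Qed.

Lemma m_gt0 e : (0 < m e)%N.
Proof.
rewrite lt0n; apply/eqP => m0; have := Tnm e; rewrite m0 Tn0 => /eqP.
by rewrite eq_sym oner_eq0.
Qed.

Lemma Tn_gap e i t : onT e t -> (i < m e)%N -> Tn e i <= t <= Tn e i.+1 -> t = Tn e i \/ t = Tn e i.+1.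
Proof.
move=> /Tn_ex[j jm ->] im /andP[h1 h2]; case: (ltngtP i j) => h.
- move: h; rewrite leq_eqVlt => /orP[/eqP <-|h]; first by right.
  by have := Tn_lt h jm; rewrite ltNge h2.
- by have := Tn_lt h (ltnW im); rewrite ltNge h1.
- by left; rewrite h.
Qed.

Lemma Tn_in e i : (0 < i)%N -> (i < m e)%N -> 0 < Tn e i < 1.
Proof. by move=> i0 im; rewrite -(Tn0 e) -(Tnm e) !Tn_lt // ltnW. Qed.

Lemma Tn_xs e i : (0 < i)%N -> (i < m e)%N -> A e (Tn e i) \in xs.
Proof.
move=> i0 im; have := Tn_on (ltnW im); have /andP[h1 h2] := Tn_in i0 im.
by rewrite /onT gt_eqF // lt_eqF //= => /andP[].
Qed.

Definition S := {p : E * 'I_(size xs + 2) | (p.2 < m p.1)%N}.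
HB.instance Definition _ := Finite.on S.
Definition lab (s : S) : E := (val s).1.
Definition ix (s : S) : nat := (val s).2.

Lemma ix_lt s : (ix s < m (lab s))%N. Proof. exact: (valP s). Qed.

Lemma seg_ex e i : (i < m e)%N -> exists s : S, lab s = e /\ ix s = i.
Proof.
move=> im; have iN : (i < size xs + 2)%N.
  by have := T_size e; rewrite m_size => h; apply: leq_trans h; exact: ltnW.
by exists (exist _ (e, Ordinal iN) im).
Qed.

Lemma seg_inj s s' : lab s = lab s' -> ix s = ix s' -> s = s'.
Proof.
rewrite /lab /ix => e1 e2; apply: val_inj; move: e1 e2.
by case: (val s) (val s') => [a b] [a' b'] /= -> /val_inj ->.
Qed.

Definition par s (t : R) : R := Tn (lab s) (ix s) + (Tn (lab s) (ix s).+1 - Tn (lab s) (ix s)) * t.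
Definition gam s (t : R) : pl := A (lab s) (par s t).
(** All intermediate cuts are crossings, so the index only has to tell the two ends of the edge
    apart. *)
Definition nd e i : P :=
  if insub (A e (Tn e i)) is Some x then inr x else inl (if i == 0%N then (ends e).1 else (ends e).2).
Definition np (p : P) : pl := match p with inl v => pv v | inr x => ssval x end.
Definition node (d : S * bool) : P := nd (lab d.1) (if d.2 then ix d.1 else (ix d.1).+1).

Lemma np_nd e i : (i <= m e)%N -> np (nd e i) = A e (Tn e i).
Proof.
move=> im; rewrite /nd; case: insubP => [x _ <- //|nx] /=.
case: (posnP i) => [->|i0]; first by rewrite Tn0 A0.
move: im; rewrite leq_eqVlt => /orP[/eqP ->|im]; first by rewrite Tnm A1.
by rewrite Tn_xs in nx.
Qed.

Lemma nd_cr e i : (i <= m e)%N -> is_crossing (nd e i) = (0 < i < m e)%N.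
Proof.
move=> im; rewrite /nd; case: insubP => [x|] /=.
  move=> ex _; have := inner_xs (onT01 (Tn_on im)) ex.
  case: (posnP i) => [->|i0]; first by rewrite Tn0 ltxx.
  by move: im; rewrite leq_eqVlt => /orP[/eqP ->|//]; rewrite Tnm ltxx andbF.
by move=> nx; apply/esym/negbTE; apply: contra nx => /andP[? ?]; exact: Tn_xs.
Qed.

Lemma np_inj : injective np.
Proof.
move=> [v|x] [v'|x'] /=; first by move=> /pv_inj ->.
- by move=> e; have := valP x'; rewrite /= -e (negbTE (vertex_xs v)).
- by move=> e; have := valP x; rewrite /= e (negbTE (vertex_xs v')).
- by move=> /val_inj ->.
Qed.

Definition en (d : S * bool) : nat := if d.2 then ix d.1 else (ix d.1).+1.
Lemma en_le d : (en d <= m (lab d.1))%N.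
Proof. by have := ix_lt d.1; rewrite /en; case: d.2 => // /ltnW. Qed.

Lemma np_node d : np (node d) = A (lab d.1) (Tn (lab d.1) (en d)).
Proof. exact: np_nd (en_le d). Qed.

Lemma par_le s (t : R) : 0 <= t <= 1 -> Tn (lab s) (ix s) <= par s t <= Tn (lab s) (ix s).+1.
Proof.
move=> ht; have k0 : 0 < Tn (lab s) (ix s).+1 - Tn (lab s) (ix s).
  by rewrite subr_gt0; apply: Tn_lt => //; exact: ix_lt.
by have [h1 h2 _ _] := scale k0 ht; rewrite /par; apply/andP; split; lra.
Qed.

Lemma par_in s (t : R) : 0 <= t <= 1 -> 0 <= par s t <= 1.
Proof.
move=> /(par_le s) /andP[h1 h2].
have /andP[h3 _] := onT01 (Tn_on (ltnW (ix_lt s))).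
have /andP[_ h4] := onT01 (Tn_on (ix_lt s)).
by rewrite (le_trans h3 h1) (le_trans h2 h4).
Qed.

Lemma par_inj s : injective (par s).
Proof.
move=> t t' /addrI /mulfI; apply; rewrite subr_eq0 gt_eqF //.
by apply: Tn_lt => //; exact: ix_lt.
Qed.

Lemma par0 s : par s 0 = Tn (lab s) (ix s). Proof. by rewrite /par mulr0 addr0. Qed.
Lemma par1 s : par s 1 = Tn (lab s) (ix s).+1. Proof. by rewrite /par mulr1 addrC subrK. Qed.

Lemma par_cut s (t : R) : 0 <= t <= 1 -> onT (lab s) (par s t) -> t = 0 \/ t = 1.
Proof.
move=> ht /Tn_gap /(_ (ix_lt s) (par_le s ht)) [].
  by rewrite -par0 => /par_inj; left.
by rewrite -par1 => /par_inj; right.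
Qed.

Lemma meet_cut e f (a b : R) : e != f -> 0 <= a <= 1 -> 0 <= b <= 1 -> A e a = A f b -> onT e a.
Proof.
move=> ne ha hb ee; rewrite /onT.
have [//|a0] := eqVneq a 0; have [//|a1] := eqVneq a 1; rewrite ha /=.
have ha' : 0 < a < 1 by have /andP[h1 h2] := ha; rewrite !lt_neqAle h1 h2 eq_sym a0 a1.
have nb0 v : b = 0 \/ b = 1 -> pv v = A f b -> False.
  move=> hb' ev; have [|e0|e0] := @A_pv e a v ha; first by rewrite ee ev.
    by rewrite e0 eqxx in a0.
  by rewrite e0 eqxx in a1.
apply/xsP; exists e, f; split=> //; exists a, b; split=> //.
have /andP[h1 h2] := hb; rewrite !lt_neqAle h1 h2 !andbT; apply/andP; split; apply/eqP => b0.
  by apply: (nb0 (ends f).1); [left|rewrite -b0 A0].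
by apply: (nb0 (ends f).2); [right|rewrite b0 A1].
Qed.

Lemma PG : plane_graph node np gam.
Proof.
split.
- move=> s t; change (continuous_at t (A (lab s) \o par s)).
  by apply: continuous_comp; [exact: affine_cont|exact: A_cont].
- by move=> s; rewrite np_node /gam par0.
- by move=> s; rewrite np_node /gam par1.
- exact: np_inj.
- move=> s; apply/eqP => /(congr1 np); rewrite !np_node /=.
  move=> /(A_inj (onT01 (Tn_on (en_le (s, true)))) (onT01 (Tn_on (en_le (s, false))))).
  by move=> /(Tn_inj (en_le (s, true)) (en_le (s, false))) /= /n_Sn.
- by move=> s t t' ht ht' /(A_inj (par_in s ht) (par_in s ht')) /par_inj.
- move=> s s' t t' ne ht ht' ee; have [el|nl] := eqVneq (lab s) (lab s').
    have ni : ix s <> ix s' by move=> /(seg_inj el) e'; rewrite e' eqxx in ne.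
    have ep : par s t = par s' t'.
      apply: (@A_inj (lab s)); [exact: par_in|exact: par_in|].
      by rewrite [in RHS]el.
    have /andP[h1 h2] := par_le s ht; have /andP[h3 h4] := par_le s' ht'.
    case: (ltngtP (ix s) (ix s')) => // ii.
      right; apply: (@par_inj s); rewrite par1; apply/eqP; rewrite eq_le h2 /=.
      rewrite ep; apply: le_trans h3; rewrite el; apply: Tn_le => //.
      exact: ltnW (ix_lt s').
    left; apply: (@par_inj s); rewrite par0; apply/eqP; rewrite eq_le h1 andbT.
    rewrite ep; apply: (le_trans h4); rewrite el; apply: Tn_le => //.
    by rewrite -el ltnW // ix_lt.
  apply: (par_cut ht); exact: meet_cut nl (par_in s ht) (par_in s' ht') ee.
- move=> s t [v|x] ht ee; apply: (@par_cut s t ht); rewrite /onT.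
    by case: (A_pv (par_in s ht) ee) => ->; rewrite eqxx ?orbT.
  by rewrite (par_in s ht) -/(gam s t) ee (valP x) !orbT.
Qed.

(* Of the axes in [proper_crossing], only the inclusions of the edges are needed. *)
Definition chart_ok e f p (G H : pl -> pl) (V : set pl) (r : R) :=
  [/\ 0 < r, continuous G, open V /\ V p,
    forall q, V q -> {for q, continuous H} /\ G (H q) = q &
    [/\ H p = (0, 0), forall q, nb r (0, 0) q -> H (G q) = q,
      forall (t : R) q, 0 <= t <= 1 -> nb r (0, 0) q -> A e t = G q -> q.2 = 0 &
      forall (t : R) q, 0 <= t <= 1 -> nb r (0, 0) q -> A f t = G q -> q.1 = 0]].
Hypothesis charts : forall e f p, meets e f p -> exists G H V r, chart_ok e f p G H V r.

Lemma ed_ex (x : X) : exists ef : E * E, meets ef.1 ef.2 (ssval x).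
Proof. by have /xsP[e [f h]] := valP x; exists (e, f). Qed.
(** The two edges through x; [true] stands for the one along the first axis of the chart. *)
Definition ed (x : X) (a : bool) : E := let ef := proj1_sig (cid (ed_ex x)) in if a then ef.1 else ef.2.
Lemma edP x : meets (ed x true) (ed x false) (ssval x).
Proof. by rewrite /ed; case: cid. Qed.

Lemma jx_ex x a : exists j, (0 < j < m (ed x a))%N /\ A (ed x a) (Tn (ed x a) j) = ssval x.
Proof.
have [t [ht et]] : exists t : R, 0 < t < 1 /\ A (ed x a) t = ssval x.
  by have [_ [s [t [hs ht es et]]]] := edP x; case: (a); [exists s|exists t].
have [|j jm ej] := @Tn_ex (ed x a) t; first by rewrite /onT (inner_le ht) et (valP x) !orbT.
exists j; split; last by rewrite -ej.
have := nd_cr jm; rewrite /nd; case: insubP => [y _ _ <- //|]; by rewrite -ej et (valP x).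
Qed.
Definition jx x a := proj1_sig (cid (jx_ex x a)).
Lemma jxP x a : (0 < jx x a < m (ed x a))%N /\ A (ed x a) (Tn (ed x a) (jx x a)) = ssval x.
Proof. by rewrite /jx; case: cid. Qed.

Lemma ax_ex x a b : exists d : S * bool,
  [/\ lab d.1 = ed x a, d.2 = b & en d = jx x a].
Proof.
have [/andP[j0 jm] _] := jxP x a; case: b.
  by have [s [e1 e2]] := seg_ex jm; exists (s, true).
have [|s [e1 e2]] := @seg_ex (ed x a) (jx x a).-1.
  by apply: leq_ltn_trans jm; exact: leq_pred.
by exists (s, false); split=> //; rewrite /en /= e2 prednK.
Qed.
Definition ax x a b := proj1_sig (cid (ax_ex x a b)).
Lemma axP x a b : [/\ lab (ax x a b).1 = ed x a, (ax x a b).2 = b & en (ax x a b) = jx x a].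
Proof. by rewrite /ax; case: cid. Qed.

Lemma ed_neq x : ed x true != ed x false. Proof. by case: (edP x). Qed.

Lemma ed_inj x a a' : ed x a = ed x a' -> a = a'.
Proof. by have := ed_neq x; case: a a' => [] [] // /eqP ne e; case: ne. Qed.

Lemma en_inj d d' : lab d.1 = lab d'.1 -> d.2 = d'.2 -> en d = en d' -> d = d'.
Proof.
case: d d' => s b [s' b'] /= el eb; rewrite -eb /en /= => ei; congr (_, _) => //.
by apply: seg_inj => //; case: (b) ei => // -[].
Qed.

Lemma ax_node x a b : node (ax x a b) = inr x.
Proof.
apply: np_inj; rewrite np_node; have [-> _ ->] := axP x a b.
by case: (jxP x a).
Qed.

Lemma ax_inj x a b a' b' : ax x a b = ax x a' b' -> a = a' /\ b = b'.
Proof.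
have [e1 e2 _] := axP x a b; have [e1' e2' _] := axP x a' b' => e.
by split; [apply: (@ed_inj x); rewrite -e1 -e1' e|rewrite -e2 -e2' e].
Qed.

Lemma through x g (t : R) : 0 < t < 1 -> A g t = ssval x -> exists a, g = ed x a.
Proof.
move=> ht et; have [ne [s [u [hs hu es eu]]]] := edP x.
have [->|n1] := eqVneq g (ed x true); first by exists true.
have [->|n2] := eqVneq g (ed x false); first by exists false.
by exfalso; apply: (no3 n1 ne n2 ht hs hu); rewrite ?es ?et ?eu.
Qed.

Lemma cr_inner d : is_crossing (node d) -> 0 < Tn (lab d.1) (en d) < 1.
Proof. by rewrite /node -/(en d) nd_cr ?en_le // => /andP[h1 h2]; exact: Tn_in. Qed.

Lemma ax_all x d : node d = inr x -> exists a b, d = ax x a b.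
Proof.
move=> nx; have := np_node d; rewrite nx /= => ex.
have hi : 0 < Tn (lab d.1) (en d) < 1 by apply: cr_inner; rewrite nx.
have [a ea] := through hi (esym ex); exists a, d.2.
have [e1 e2 e3] := axP x a d.2; have [/andP[_ jm] jA] := jxP x a.
apply: en_inj; rewrite ?e1 ?e2 ?e3 //; apply: (@Tn_inj (lab d.1)); first exact: en_le.
  by rewrite ea ltnW.
apply: (@A_inj (lab d.1)); [exact: inner_le| |].
  by rewrite ea; apply/onT01/Tn_on/ltnW.
by rewrite -ex [in RHS]ea.
Qed.

Lemma box_small (G : pl -> pl) (r e : R) : continuous G -> 0 < r -> 0 < e ->
  exists2 r' : R, 0 < r' <= r & forall q, nb r' (0, 0) q -> nb e (G (0, 0)) (G q).
Proof.
move=> cG r0 e0.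
have N : nbhs (G (0, 0)) [set p | nb e (G (0, 0)) p].
  apply/nbhs_ballP; exists e => // p [h1 h2]; rewrite /nb.
  by move: h1 h2; rewrite /ball /= => /ltW -> /ltW ->.
have := cG (0, 0) _ N => /nbhs_ballP[d /= d0 hd].
exists (Num.min r (d / 2)); first by rewrite lt_min r0 divr_gt0 //= ge_min lexx.
move=> q /andP[h1 h2]; apply: hd; have h3 : Num.min r (d / 2) <= d / 2 by rewrite ge_min lexx orbT.
by split; rewrite /ball /=; [apply: le_lt_trans h1 _|apply: le_lt_trans h2 _]; lra.
Qed.

Theorem drawing_rotation : exists rho : S * bool -> S * bool,
  [/\ injective rho, forall d, node (rho d) = node d,
      forall d d', node d = node d' -> fconnect rho d d',
      forall z, (forall p, even_at node z p) -> exists c : S * bool -> bool,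
        [/\ forall d, c (rho d) = c d (+) z d.1, forall d, c d (+) c (alpha d) = z d.1 &
         forall d, (forall s, z s -> (node d != node (s, true)) && (node d != node (s, false))) ->
           c d = \big[addb/false]_s (z s && Xl (gam s) 0 1 (np (node d)))] &
      forall x a b, rho (rho (ax x a b)) = ax x a (~~ b)].
Proof.
have [e1 e10 he1] := eps_nodes PG; have [e2 e20 he2] := eps_off PG.
(* The charts are shrunk below this size, so that each meets only the segments ending at its
   crossing, contains no other node, and is disjoint from the other charts. *)
pose e := Num.min e1 e2; have e0 : 0 < e by rewrite lt_min e10.
have ee1 : e <= e1 by rewrite ge_min lexx.
have ee2 : e <= e2 by rewrite ge_min lexx orbT.
have ch (x : X) : exists GHVr : (pl -> pl) * (pl -> pl) * set pl * R,
    chart_ok (ed x true) (ed x false) (ssval x) GHVr.1.1.1 GHVr.1.1.2 GHVr.1.2 GHVr.2 /\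
    forall q, nb GHVr.2 (0, 0) q -> nb e (ssval x) (GHVr.1.1.1 q).
  have [G [H [V [r [r0 cG [oV Vx] HV [H0 HG ae af]]]]]] := charts (edP x).
  have [r' /andP[r'0 rr] hr'] := box_small cG r0 e0; exists (G, H, V, r').
  have rq q : nb r' (0, 0) q -> nb r (0, 0) q by apply: nb_le.
  split; last by move=> q hq; rewrite -(HV _ Vx).2 H0; apply: hr'.
  split=> //; split=> // [q /rq /HG //|t q ht /rq hq|t q ht /rq hq]; [exact: ae|exact: af].
have [F hF] := fin_all_exists ch.
have XI : injective (@inr 'I_n X) by move=> ? ? [].
apply: (@plane_rotation_alt R S P X node np gam PG inr ax XI ax_node ax_all ax_inj
  (fun x => (F x).1.1.1) (fun x => (F x).1.1.2) (fun x => (F x).1.2) (fun x => (F x).2)).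
- by move=> x; case: (hF x) => -[].
- by move=> x; case: (hF x) => -[].
- by move=> x; case: (hF x) => -[? ? []].
- by move=> x; case: (hF x) => -[? ? []].
- by move=> x p Vp; case: (hF x) => -[_ _ _ /(_ _ Vp)[]].
- by move=> x p Vp; case: (hF x) => -[_ _ _ /(_ _ Vp)[]].
- by move=> x; case: (hF x) => -[_ _ _ _ []].
- by move=> x q; case: (hF x) => -[_ _ _ _ [_ h _ _]] _; apply: h.
- move=> x s t q ht hq es; have [[_ _ _ _ [_ _ ae af]] hn] := hF x.
  have [b hb] : exists b, inr x = node (s, b).
    have [?|n1] := eqVneq (inr x) (node (s, true)); first by exists true.
    have [?|n2] := eqVneq (inr x) (node (s, false)); first by exists false.
    have := he2 s (inr x) t; rewrite n1 n2 => /(_ isT ht) /negP; case.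
    by rewrite es nb_sym; apply: nb_le (hn q hq); lra.
  have [a [b' eb]] := ax_all (esym hb); exists a, b'; rewrite -eb; split=> //.
  have [el _ _] := axP x a b'; rewrite -eb /= in el.
  move: es; rewrite /gam el; case: (a).
    exact: ae (par_in s ht) hq.
  exact: af (par_in s ht) hq.
- move=> x p q hq ep; apply/eqP; apply: contraT => ne; have := he1 _ _ ne => /negP; case.
  rewrite ep nb_sym; apply: nb_le ((hF x).2 q hq); lra.
- move=> x x' q q' hq hq' ep; apply/eqP; apply: contraT => ne.
  have ne' : (inr x : P) != inr x' by apply: contra ne => /eqP [->].
  have := he1 _ _ ne' => /negP; case.
  apply: (nb_le (r := e + e)); first lra.
  apply: (nb_trans ((hF x).2 q hq)); rewrite ep nb_sym; exact: ((hF x').2 q' hq').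
Qed.

(** * Lenses and winding numbers in the plane *)

Definition lens_data e f (s1 s2 t1 t2 : R) :=
  [/\ e != f, [/\ 0 <= s1, s1 < s2 & s2 <= 1], [/\ 0 <= t1, t1 < t2 & t2 <= 1],
    (A e s1 = A f t1 /\ A e s2 = A f t2) \/ (A e s1 = A f t2 /\ A e s2 = A f t1) &
    forall s t : R, s1 <= s <= s2 -> t1 <= t <= t2 -> A e s = A f t -> s = s1 \/ s = s2].
Definition off_lens e f (s1 s2 t1 t2 : R) (x : pl) :=
  (forall s : R, s1 <= s <= s2 -> A e s <> x) /\ (forall t : R, t1 <= t <= t2 -> A f t <> x).
Definition w_lens e f (s1 s2 t1 t2 : R) (x : pl) := Xl (A e) s1 s2 x (+) Xl (A f) t1 t2 x.
(** The component of x in the complement of the curve is replaced by the larger set of points with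
    the winding number of x. *)
Hypothesis nonhom : forall e f s1 s2 t1 t2 x, lens_data e f s1 s2 t1 t2 -> off_lens e f s1 s2 t1 t2 x ->
  exists q, [/\ (exists v, q = pv v) \/ (exists e f, meets e f q), off_lens e f s1 s2 t1 t2 q &
    w_lens e f s1 s2 t1 t2 q = w_lens e f s1 s2 t1 t2 x].

Lemma interp_in (a b t : R) : a < b -> 0 <= t <= 1 -> a <= a + (b - a) * t <= b.
Proof.
move=> ab ht; have c0 : 0 < b - a by lra.
by have [h1 h2 _ _] := scale c0 ht; apply/andP; split; lra.
Qed.

Lemma interp_cont e (a b : R) : continuous (fun t => A e (a + (b - a) * t)).
Proof.
move=> t; change (continuous_at t (A e \o (fun t => a + (b - a) * t))).
by apply: continuous_comp; [exact: affine_cont|exact: A_cont].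
Qed.

(** Non-homotopy spreads the value k from the nodes to all points off the curve, whereas
    [local_jordan] provides two points with different values. *)
Lemma lens_contra e f s1 s2 t1 t2 k : lens_data e f s1 s2 t1 t2 ->
  (forall p : P, off_lens e f s1 s2 t1 t2 (np p) -> w_lens e f s1 s2 t1 t2 (np p) = k) -> False.
Proof.
move=> L hk; have K x : off_lens e f s1 s2 t1 t2 x -> w_lens e f s1 s2 t1 t2 x = k.
  move=> /(nonhom L) [q [hq oq <-]].
  suff [p ep] : exists p, np p = q by rewrite -ep in oq *; apply: hk.
  case: hq => [[v ->]|/xsP hq]; first by exists (inl v).
  by exists (inr (SeqSub hq)).
have [ne [s10 s12 s21] [t10 t12 t21] ends_eq meet] := L.
pose ga (t : R) := A e (s1 + (s2 - s1) * t); pose g (t : R) := A f (t1 + (t2 - t1) * t).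
have cg : continuous g by exact: interp_cont.
have sin t : 0 <= t <= 1 -> 0 <= s1 + (s2 - s1) * t <= 1.
  by move=> /(interp_in s12) /andP[? ?]; apply/andP; split; lra.
have sinj t t' : s1 + (s2 - s1) * t = s1 + (s2 - s1) * t' -> t = t'.
  by move=> /addrI /mulfI; apply; rewrite subr_eq0 gt_eqF.
(* The second part is run through in the direction that closes up the first one. *)
have [be [cb be0 be1 beI beX]] : exists be : R -> pl, [/\ continuous be, ga 1 = be 0, be 1 = ga 0,
    forall t, 0 <= t <= 1 -> exists2 u, t1 <= u <= t2 & be t = A f u &
    forall x, (forall t, 0 <= t <= 1 -> be t <> x) ->
      (forall u, t1 <= u <= t2 -> A f u <> x) /\ Xl be 0 1 x = Xl (A f) t1 t2 x].
  have gX x : (forall t, 0 <= t <= 1 -> g t <> x) ->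
      (forall u, t1 <= u <= t2 -> A f u <> x) /\ Xl g 0 1 x = Xl (A f) t1 t2 x.
    move=> off; have d0 : 0 < t2 - t1 by lra.
    split; last by rewrite /g Xl_reparam //; rewrite mulr0 mulr1 addr0 addrC subrK.
    move=> u /andP[u1 u2]; have -> : u = t1 + (t2 - t1) * ((u - t1) / (t2 - t1)).
      by rewrite mulrC divfK ?gt_eqF // addrC subrK.
    apply: off; apply/andP; split; first by rewrite divr_ge0; lra.
    by rewrite ler_pdivrMr // mul1r; lra.
  case: ends_eq => -[ea eb]; last first.
    exists g; split=> //.
    - by rewrite /ga /g mulr1 mulr0 addr0 addrC subrK.
    - by rewrite /ga /g mulr1 mulr0 addr0 addrC subrK.
    - by move=> t ht; exists (t1 + (t2 - t1) * t) => //; exact: interp_in.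
  have r1 (t : R) : 0 <= t <= 1 -> 0 <= 1 - t <= 1 by move=> /andP[? ?]; apply/andP; split; lra.
  exists (fun t => g (1 - t)); split.
  - move=> t; change (continuous_at t (g \o (fun t => 1 - t))).
    by apply: continuous_comp; [apply: cvgB; [exact: cvg_cst|exact: cvg_id]|exact: cg].
  - by rewrite /ga /g subr0 !mulr1 addrC subrK addrC subrK.
  - by rewrite /ga /g subrr !mulr0 !addr0.
  - by move=> t /r1 ht; exists (t1 + (t2 - t1) * (1 - t)) => //; exact: interp_in.
  - move=> x off; have off' t : 0 <= t <= 1 -> g t <> x.
      by move=> /r1 ht; have := off _ ht; rewrite opprB addrC subrK.
    have [o1 o2] := gX x off'; split=> //; rewrite -o2.
    by have := Xl_rev 1 cg ler01 off'; rewrite subrr subr0.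
have u3 : 0 < (1 / 3 : R) by lra.
have uv : (1 / 3 : R) < 2 / 3 by lra.
have v1 : (2 / 3 : R) < 1 by lra.
have cga : continuous ga by exact: interp_cont.
have [|t t' ht ht' ee|x [x' [ox ox' _ _]]] := @local_jordan R ga be _ _ 1 cga cb _ be0 be1 _ u3 uv v1 ltr01.
- by move=> t t' ht ht' /(A_inj (sin _ ht) (sin _ ht')) /sinj.
- have [u hu eu] := beI t' ht'; rewrite eu in ee.
  have ht2 : 0 <= t <= 1 by exact: inner_le.
  have [e0|e0] := meet _ _ (interp_in s12 ht2) hu ee.
    have /sinj t0 : s1 + (s2 - s1) * t = s1 + (s2 - s1) * 0 by rewrite e0 mulr0 addr0.
    by rewrite t0 ltxx in ht.
  have /sinj t0 : s1 + (s2 - s1) * t = s1 + (s2 - s1) * 1 by rewrite e0 mulr1 addrC subrK.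
  by rewrite t0 ltxx andbF in ht.
have d0 : 0 < s2 - s1 by lra.
have WE y : (forall t : R, 0 <= t <= 1 -> ga t <> y /\ be t <> y) -> Xl ga 0 1 y (+) Xl be 0 1 y = k.
  move=> oy; have [o1 o2] := beX y (fun t ht => (oy t ht).2).
  have e1 : Xl ga 0 1 y = Xl (A e) s1 s2 y.
    rewrite /ga Xl_reparam //; first by rewrite mulr0 mulr1 addr0 addrC subrK.
    by move=> t ht; exact: (oy t ht).1.
  rewrite o2 e1; apply: K; split=> // u /andP[h1 h2].
  have {1}-> : u = s1 + (s2 - s1) * ((u - s1) / (s2 - s1)).
    by rewrite mulrC divfK ?gt_eqF // addrC subrK.
  apply: (oy _ _).1; apply/andP; split; first by rewrite divr_ge0; lra.
  by rewrite ler_pdivrMr // mul1r; lra.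
by case; rewrite !WE.
Qed.

Hypothesis loopl : forall e, (ends e).1 != (ends e).2.
Hypothesis conng : forall u v : 'I_n,
  connect (fun u v => [exists e, (ends e == (u, v)) || (ends e == (v, u))]) u v.
Hypothesis n3 : (3 <= n)%N.
Hypothesis quasi : forall e f g p q r, meets e f p -> meets f g q -> meets e g r -> False.

Lemma nd0 e : nd e 0 = inl (ends e).1.
Proof. by apply: np_inj; rewrite np_nd // Tn0 A0. Qed.

Lemma ndm e : nd e (m e) = inl (ends e).2.
Proof. by apply: np_inj; rewrite np_nd // Tnm A1. Qed.

Lemma conn_nodes (a : P -> bool) : (forall d, a (node d) = a (node (alpha d))) -> forall p q, a p = a q.
Proof.
move=> ha; have he e i : (i <= m e)%N -> a (nd e i) = a (inl (ends e).1).
  elim: i => [|i IH] hi; first by rewrite nd0.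
  have [s [es ei]] := seg_ex hi; rewrite -(IH (ltnW hi)).
  by have := ha (s, true); rewrite /node /= es ei.
have hv u v : a (inl u) = a (inl v).
  have /connectP[p pth ->] := conng u v; elim: p u pth => //= v' p IH u /andP[/existsP[e he'] /IH <-].
  have := he e (m e) (leqnn _); rewrite ndm.
  by case/orP: he' => /eqP -> /=.
have hp p : exists v, a p = a (inl v).
  case: p => [v|x]; first by exists v.
  exists (ends (ed x true)).1; have [/andP[_ jm] jA] := jxP x true.
  rewrite -(he _ _ (ltnW jm)); congr a; apply: np_inj; by rewrite np_nd ?(ltnW jm).
by move=> p q; have [u ->] := hp p; have [v ->] := hp q; apply: hv.
Qed.

Lemma has_dart p : exists d, node d = p.
Proof.
case: p => [v|x]; last by exists (ax x true true); rewrite ax_node.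
have [w wv] : exists w : 'I_n, w != v.
  have h0 : (0 < n)%N by apply: leq_trans n3.
  have h1 : (1 < n)%N by apply: leq_trans n3.
  have [e0|] := eqVneq (Ordinal h0) v; last by exists (Ordinal h0).
  by exists (Ordinal h1); rewrite -e0.
have /connectP[[|v' p] /=] := conng v w; first by move=> _ e; rewrite e eqxx in wv.
move=> /andP[/existsP[e /orP[] /eqP he] _] _.
  have [s [es ei]] := seg_ex (m_gt0 e).
  by exists (s, true); rewrite /node /= es ei nd0 he.
have [|s [es ei]] := @seg_ex e (m e).-1; first by rewrite prednK // m_gt0.
by exists (s, false); rewrite /node /= es ei prednK ?m_gt0 // ndm he.
Qed.

(** * From the rotation system to the count *)

Section Rot.
Variable rho : S * bool -> S * bool.
Hypothesis rho_inj : injective rho.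
Hypothesis node_rho : forall d, node (rho d) = node d.
Hypothesis node_orb : forall d d', node d = node d' -> fconnect rho d d'.
Hypothesis rho_wind : forall z, (forall p, even_at node z p) -> exists c : S * bool -> bool,
  [/\ forall d, c (rho d) = c d (+) z d.1, forall d, c d (+) c (alpha d) = z d.1 &
   forall d, (forall s, z s -> (node d != node (s, true)) && (node d != node (s, false))) ->
     c d = \big[addb/false]_s (z s && Xl (gam s) 0 1 (np (node d)))].

Lemma face_step_alpha d : face_step rho (alpha d) = rho d.
Proof. by rewrite /face_step alphaK. Qed.

Lemma wind_nodes (q : S * bool -> bool) (z : S -> bool) : (forall x, q (face_step rho x) = q x) ->
  (forall x, q x (+) q (alpha x) = z x.1) ->
  exists k, forall d, (forall s, z s -> (node d != node (s, true)) && (node d != node (s, false))) ->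
    q d = false -> \big[addb/false]_s (z s && Xl (gam s) 0 1 (np (node d))) = k.
Proof.
move=> q1 q2; have qr d : q (rho d) = q d (+) z d.1.
  by rewrite -face_step_alpha q1 -q2; case: (q d) (q _) => [] [].
have ev p : even_at node z p.
  rewrite /even_at (eq_bigr (fun d => q d (+) q (rho d))) => [|d _]; last first.
    by rewrite qr; case: (q d) (z _) => [] [].
  rewrite big_split /= [X in _ (+) X](_ : _ = \big[addb/false]_(d | node d == p) q d) ?addbb //.
  rewrite [RHS](reindex_inj rho_inj) /=.
  by apply: eq_bigl => d; rewrite node_rho.
have [c [c1 c2 c3]] := rho_wind ev.
pose h d := c d (+) q d.
have h1 d : h (rho d) = h d by rewrite /h c1 qr; case: (c d) (q d) (z _) => [] [] [].
have h2 d : h (alpha d) = h d.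
  have := c2 d; have := q2 d; rewrite /h.
  by case: (c d) (q d) (c (alpha d)) (q (alpha d)) (z d.1) => [] [] [] [] [].
have hn d d' : node d = node d' -> h d = h d'.
  move=> /node_orb /iter_findex <-; elim: (findex _ _ _) => //= i ->; by rewrite h1.
pose a p := [exists d, (node d == p) && h d].
have aE d : a (node d) = h d.
  apply/existsP/idP => [[d' /andP[/eqP e]]|hd]; first by rewrite (hn _ _ e).
  by exists d; rewrite eqxx.
have ac := @conn_nodes a (fun d => etrans (aE d) (esym (etrans (aE _) (h2 d)))).
have n0 : (0 < n)%N by apply: leq_trans n3.
exists (a (inl (Ordinal n0))) => d off qd.
by rewrite -c3 // -(ac (node d)) aE /h qd addbF.
Qed.

Lemma Xl_gam s p : (forall t : R, 0 <= t <= 1 -> gam s t <> p) ->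
  Xl (gam s) 0 1 p = Xl (A (lab s)) (Tn (lab s) (ix s)) (Tn (lab s) (ix s).+1) p.
Proof.
move=> off; have d0 : 0 < Tn (lab s) (ix s).+1 - Tn (lab s) (ix s).
  by rewrite subr_gt0; apply: Tn_lt => //; exact: ix_lt.
have := @Xl_reparam R (A (lab s)) 0 1 (Tn (lab s) (ix s)) _ p (@A_cont _) ler01 d0 off.
by rewrite -!/(par s _) par0 par1.
Qed.

(** The nodes where [q] holds are on the curve, so all others share one winding number by
    [wind_nodes], against [lens_contra]. *)
Lemma seg_digon (d d' : S * bool) (q : S * bool -> bool) : d.1 != d'.1 ->
  node d' = node (alpha d) -> node (alpha d') = node d ->
  (forall x, q (face_step rho x) = q x) ->
  (forall x, q x (+) q (alpha x) = (x.1 == d.1) (+) (x.1 == d'.1)) ->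
  (forall x, q x -> node x = node d \/ node x = node (alpha d)) -> False.
Proof.
move=> ne e1 e2 q1 q2 q3.
pose s := d.1; pose s' := d'.1.
have Ee (a b : S * bool) : node a = node b -> A (lab a.1) (Tn (lab a.1) (en a)) = A (lab b.1) (Tn (lab b.1) (en b)).
  by move=> /(congr1 np); rewrite !np_node.
(* On a single edge, the two segments would have the same pair of cuts as ends, hence be equal. *)
have nl : lab s != lab s'.
  apply/eqP => el; have /eqP := ne; apply; apply: seg_inj => //.
  have Ei (a b : S * bool) : lab a.1 = lab b.1 -> node a = node b -> en a = en b.
    move=> l /Ee; rewrite l => /A_inj.
    have hb := en_le b; have := en_le a; rewrite l => ha.
    by move=> /(_ (onT01 (Tn_on ha)) (onT01 (Tn_on hb))) /(Tn_inj ha hb).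
  have := Ei _ _ (esym el : lab d'.1 = lab (alpha d).1) e1; have := Ei _ _ (esym el : lab (alpha d').1 = lab d.1) e2.
  rewrite /en /alpha /=; case: (d.2); case: (d'.2) => /=; lia.
have [k hk] := @wind_nodes q (fun u => (u == d.1) (+) (u == d'.1)) q1 q2.
pose a1 := Tn (lab s) (ix s); pose a2 := Tn (lab s) (ix s).+1.
pose b1 := Tn (lab s') (ix s'); pose b2 := Tn (lab s') (ix s').+1.
have T01 (u : S) : [/\ 0 <= Tn (lab u) (ix u), Tn (lab u) (ix u) < Tn (lab u) (ix u).+1 & Tn (lab u) (ix u).+1 <= 1].
  have /andP[h1 _] := onT01 (Tn_on (ltnW (ix_lt u))); have /andP[_ h2] := onT01 (Tn_on (ix_lt u)).
  by split=> //; apply: Tn_lt => //; exact: ix_lt.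
have in01 (u : S) a : Tn (lab u) (ix u) <= a <= Tn (lab u) (ix u).+1 -> 0 <= a <= 1.
  by have [h1 h2 h3] := T01 u => /andP[h4 h5]; apply/andP; split; lra.
apply: (@lens_contra (lab s) (lab s') a1 a2 b1 b2 k).
  split; [exact: nl|exact: T01|exact: T01| |].
    have := Ee _ _ e1; have := Ee _ _ e2; rewrite /en /alpha /= /a1 /a2 /b1 /b2 /s /s'.
    by case: (d.2); case: (d'.2) => /= -> ->; [right|left|left|right].
  move=> a b ha hb ee; apply: Tn_gap => //; last exact: ix_lt.
  exact: meet_cut nl (in01 _ _ ha) (in01 _ _ hb) ee.
move=> p; have [d0 <-] := has_dart p => -[o1 o2].
have onp (u : S) b : np (node (u, b)) = A (lab u) (if b then Tn (lab u) (ix u) else Tn (lab u) (ix u).+1).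
  by rewrite np_node; case: b.
have bnd (u : S) (b : bool) : Tn (lab u) (ix u) <= (if b then Tn (lab u) (ix u) else Tn (lab u) (ix u).+1) <= Tn (lab u) (ix u).+1.
  by have [_ /ltW h2 _] := T01 u; case: b; rewrite lexx h2.
have ns b : node d0 <> node (s, b) by move=> e; apply: (o1 _ (bnd s b)); rewrite -onp e.
have ns' b : node d0 <> node (s', b) by move=> e; apply: (o2 _ (bnd s' b)); rewrite -onp e.
have og u t : u = s \/ u = s' -> 0 <= t <= 1 -> gam u t <> np (node d0).
  by move=> eu /(par_le u) hp; case: eu hp => ->; [exact: o1|exact: o2].
rewrite -(hk d0).
- transitivity (Xl (gam s) 0 1 (np (node d0)) (+) Xl (gam s') 0 1 (np (node d0))).
    rewrite (Xl_gam (fun t => og s t (or_introl erefl))).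
    by rewrite (Xl_gam (fun t => og s' t (or_intror erefl))).
  have F u := big_one u (fun s' => Xl (gam s') 0 1 (np (node d0))).
  rewrite -(F s) -(F s') -big_split.
  by apply: eq_bigr => u _; rewrite /= andb_addl.
- move=> u hu; have /orP[/eqP ->|/eqP ->] : (u == s) || (u == s').
  + by move: hu; rewrite /s /s'; case: (u == d.1) (u == d'.1) => [] [].
  + by apply/andP; split; apply/eqP; exact: ns.
  + by apply/andP; split; apply/eqP; exact: ns'.
- apply/negP => /q3[] e0; first by apply: (ns d.2); rewrite e0 /s -surjective_pairing.
  by apply: (ns (~~ d.2)).
Qed.

Lemma edge_Xl e p : (forall t : R, 0 <= t <= 1 -> A e t <> p) ->
  \big[addb/false]_s ((lab s == e) && Xl (gam s) 0 1 p) = Xl (A e) 0 1 p.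
Proof.
move=> off.
suff K k : (k <= m e)%N -> \big[addb/false]_s ((lab s == e) && (ix s < k)%N && Xl (gam s) 0 1 p) = Xl (A e) 0 (Tn e k) p.
  have := K (m e) (leqnn _); rewrite Tnm => <-; apply: eq_bigr => s _; case: eqP => //= <-.
  by rewrite ix_lt.
elim: k => [|k IH] hk.
  rewrite Tn0 big1 => [|s _]; last by rewrite ltn0 andbF.
  have := @Xl_cat R (A e) 0 0 0 p (@A_cont e) (lexx 0) (lexx 0).
  case: (Xl _ _ _ _) => //= -> // t /andP[h1 h2]; apply: off; rewrite h1 /=; lra.
have [s0 [e0 i0]] := seg_ex hk.
rewrite (eq_bigr (fun s => (lab s == e) && (ix s < k)%N && Xl (gam s) 0 1 p (+) ((s == s0) && Xl (gam s) 0 1 p))).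
  have b01 := onT01 (Tn_on (ltnW hk)); have b01' := onT01 (Tn_on hk).
  rewrite big_split /= IH ?(ltnW hk) // big_one (Xl_gam (s := s0)).
    rewrite e0 i0 -Xl_cat //; first by case/andP: b01.
      by apply: Tn_le.
    by move=> t /andP[h1 h2]; apply: off; have /andP[h3 h4] := b01'; apply/andP; split; lra.
  by move=> t /(par_in s0) ht; rewrite /gam e0; apply: off.
move=> s _; have -> : (s == s0) = (lab s == e) && (ix s == k).
  by apply/eqP/andP => [->|[/eqP es /eqP is_]]; [rewrite e0 i0 !eqxx|apply: seg_inj; rewrite ?e0 ?i0].
rewrite ltnS leq_eqVlt; case: (lab s == e) => //=; case: ltngtP => //= _; by case: (Xl _ _ _ _).
Qed.

Lemma seg_edges e f (q : S * bool -> bool) : e != f ->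
  (ends e = ends f \/ ends e = ((ends f).2, (ends f).1)) ->
  (forall p, ~ meets e f p) ->
  (forall x, q (face_step rho x) = q x) ->
  (forall x, q x (+) q (alpha x) = (lab x.1 == e) (+) (lab x.1 == f)) ->
  (forall x, q x -> exists y, node y = node x /\ (lab y.1 = e \/ lab y.1 = f)) -> False.
Proof.
move=> ne ends_eq nm q1 q2 q3.
have [k hk] := @wind_nodes q (fun u => (lab u == e) (+) (lab u == f)) q1 q2.
apply: (@lens_contra e f 0 1 0 1 k).
  split=> //.
    by rewrite !A0 !A1; case: ends_eq => ->; [left|right].
  move=> a b ha hb ee; have := meet_cut ne ha hb ee; rewrite /onT => /or3P[/eqP|/eqP|/andP[_ ex]]; [by left|by right|].
  exfalso; apply: (nm (A e a)); split=> //; exists a, b; split; [exact: inner_xs ha ex| |by []|by rewrite ee].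
  by apply: (inner_xs (e := f)) => //; rewrite -ee.
move=> p; have [d0 <-] := has_dart p => -[o1 o2].
have nd_lab y : node y = node d0 -> lab y.1 = e \/ lab y.1 = f -> False.
  move=> /(congr1 np); rewrite np_node => ey; have hy := onT01 (Tn_on (en_le y)).
  by case=> el; rewrite el in ey hy; [apply: o1 hy ey|apply: o2 hy ey].
have nl u : (lab u == e) (+) (lab u == f) -> lab u = e \/ lab u = f.
  by case: eqP => [->|_]; [left|case: eqP => // ->; right].
rewrite -(hk d0).
- rewrite /w_lens -(edge_Xl o1) -(edge_Xl o2) -big_split; apply: eq_bigr => u _.
  by rewrite /= andb_addl.
- move=> u /nl hu; apply/andP; split; apply/eqP => e'.
    by apply: (nd_lab (u, true)) => //; rewrite -e'.
  by apply: (nd_lab (u, false)) => //; rewrite -e'.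
- by apply/negP => /q3[y [ey hy]]; exact: nd_lab ey hy.
Qed.

Hypothesis rho_ax : forall x a b, rho (rho (ax x a b)) = ax x a (~~ b).

Lemma cr_ax d : is_crossing (node d) -> exists x a b, d = ax x a b.
Proof.
by case nx : (node d) => [v|x] // _; have [a [b ->]] := ax_all nx; exists x, a, b.
Qed.

Lemma rho_ax1 x a b : exists b', rho (ax x a b) = ax x (~~ a) b'.
Proof.
have [|a' [b' e]] := @ax_all x (rho (ax x a b)); first by rewrite node_rho ax_node.
have := rho_ax x a b; rewrite e; have [->|na] := eqVneq a' (~~ a); first by exists b'.
have ea : a' = a by case: a a' na {e} => [] [].
subst a'; clear na; case: (eqVneq b' b) => [eb|nb'].
  by rewrite eb in e *; rewrite e => /ax_inj[_]; case: (b).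
have eb : b' = ~~ b by case: b b' nb' {e} => [] [].
rewrite eb in e *; rewrite -{2}e => /rho_inj /ax_inj[_]; by case: (b).
Qed.

(* Position of the segment on its edge, counted in the direction of the dart. *)
Definition rk (d : S * bool) : nat := if d.2 then ix d.1 else ((m (lab d.1)).-1 - ix d.1)%N.

Lemma cr_en d : is_crossing (node d) = (0 < en d < m (lab d.1))%N.
Proof. by rewrite /node -/(en d) nd_cr // en_le. Qed.

Lemma drawing_count : (#|E| <= 8 * n - 20)%N.
Proof.
have cr0 x a b : is_crossing (node (ax x a b)) by rewrite ax_node.
apply: (@quasiplanar_count n S X E ends lab node rho rk) => //.
- by move=> d; apply/eqP => /(congr1 np); case: d => s [] /eqP; rewrite (inj_eq np_inj) ?(negbTE (pg_ne PG s)) // eq_sym (negbTE (pg_ne PG s)).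
- by move=> d /cr_ax[x [a [b ->]]]; rewrite !rho_ax negbK.
- by move=> d /cr_ax[x [a [b ->]]]; rewrite rho_ax; have [-> _ _] := axP x a (~~ b); have [-> _ _] := axP x a b.
- by move=> d /cr_ax[x [a [b ->]]]; rewrite rho_ax; have [_ -> _] := axP x a (~~ b); have [_ -> _] := axP x a b.
- move=> d /cr_ax[x [a [b ->]]]; have [b' ->] := rho_ax1 x a b.
  have [-> _ _] := axP x (~~ a) b'; have [-> _ _] := axP x a b.
  by apply/eqP => /ed_inj; case: (a).
- move=> [s b] [s' b'] /= el eb; rewrite -{b'}eb /rk /= => er; congr (_, _); apply: seg_inj => //.
  have := ix_lt s; have := ix_lt s'; rewrite el in er *; case: (b) er => // er h1 h2; lia.
- move=> d /cr_ax[x [a [b e]]]; rewrite /straight e rho_ax.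
  have [l1 b1 n1] := axP x a b; have [l2 b2 n2] := axP x a (~~ b).
  have [/andP[j0 jm] _] := jxP x a.
  have ld : lab d.1 = ed x a by rewrite -l1 -e.
  have bd : d.2 = ~~ b by rewrite -b1 -e /alpha /= negbK.
  have ed' : en (alpha d) = jx x a by rewrite e.
  rewrite /rk l2 b2 bd ld; move: n2 ed'; rewrite /en /alpha /= b2 bd.
  case: (b) => /= n2 ed'; lia.
- move=> [s b]; rewrite cr_en /en /rk /=; have := ix_lt s; case: b => /= h; lia.
- move=> [s b] [s' b'] /=; rewrite cr_en /en /rk /alpha /= => h el -> {b'}.
  have := ix_lt s; have := ix_lt s'; rewrite el; case: (b) h => /= h h1 h2; lia.
- move=> [s b] v nv; have := cr_en (s, b); rewrite nv /en /=; have := ix_lt s; move: nv; rewrite /node /=.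
  case: b => /= nv im /esym/negbT.
    rewrite im andbT -eqn0Ngt => /eqP i0; move: nv; rewrite i0 nd0; by case.
  rewrite -leqNgt => im'; have e' : (ix s).+1 = m (lab s) by apply/eqP; rewrite eqn_leq im im'.
  by move: nv; rewrite e' ndm => -[].
- exact: conn_nodes.
- exact: has_dart.
- have mt d e f : is_crossing (node d) -> lab d.1 = e -> lab (rho d).1 = f -> exists p, meets e f p.
    move=> /cr_ax[x [a [b ->]]]; have [b' ->] := rho_ax1 x a b.
    have [-> _ _] := axP x (~~ a) b'; have [-> _ _] := axP x a b => <- <-.
    exists (ssval x); have := edP x; case: (a) => //= -[ne [s [t [hs ht es et]]]].
    by split; [rewrite eq_sym|exists t, s].
  move=> e f g [d [c1 l1 l1']] [d2 [c2 l2 l2']] [d3 [c3 l3 l3']].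
  have [p1 h1] := mt _ _ _ c1 l1 l1'; have [p2 h2] := mt _ _ _ c2 l2 l2'; have [p3 h3] := mt _ _ _ c3 l3 l3'.
  exact: quasi h1 h2 h3.
- exact: seg_digon.
- move=> e f q ne ee nc; apply: seg_edges => // p [_ [s [t [hs ht es et]]]].
  have px : p \in xs by apply/xsP; exists e, f; split=> //; exists s, t.
  pose x : X := SeqSub px.
  have [a ea] := @through x e s hs es; have [a' ea'] := @through x f t ht et.
  apply: (nc (ax x a true)) => //; first by have [-> _ _] := axP x a true.
  have [b' ->] := rho_ax1 x a true; have [-> _ _] := axP x (~~ a) b'.
  rewrite ea'; congr (ed x _); case: (a) (a') ea ea' => [] [] // ea ea'; by rewrite ea ea' eqxx in ne.
- have [p0] : exists p : P, True by have n0 : (0 < n)%N by [apply: leq_trans n3]; exists (inl (Ordinal n0)).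
  have [d0 _] := has_dart p0 => _.
  have fi : injective (face_step rho) by move=> d d' /rho_inj /(inv_inj (@alphaK _)).
  have := @euler_ineq S P node (face_step rho) fi _ p0 d0.
  rewrite card_sum card_ord; apply=> z ev; have [c [c1 c2 _]] := rho_wind ev.
  exists c; split=> // d; rewrite /face_step c1; have := c2 d; rewrite /alpha /=.
  by move: (c d) (c (d.1, ~~ d.2)) (z d.1) => [] [] [].
- have ex (eb : E * bool) : exists d : S * bool, [/\ lab d.1 = eb.1, d.2 = eb.2 & ~~ is_crossing (node d)].
    case: eb => e [].
      have [s [es ei]] := seg_ex (m_gt0 e); exists (s, true); split=> //.
      by rewrite cr_en /en /= ei.
    have [|s [es ei]] := @seg_ex e (m e).-1; first by rewrite prednK // m_gt0.
    by exists (s, false); split=> //; rewrite cr_en /en /= ei es prednK ?m_gt0 // ltnn.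
  have [h hh] := fin_all_exists ex.
  have hI : injective h.
    by move=> [e b] [e' b'] eh; have [/= e1 e2 _] := hh (e, b); have [/= e3 e4 _] := hh (e', b'); congr (_, _); [rewrite -e1 -e3 eh|rewrite -e2 -e4 eh].
  rewrite mulnC -card_bool -card_prod -(card_codom hI); apply: subset_leq_card.
  by apply/fintype.subsetP => d /codomP[eb ->]; rewrite inE; case: (hh eb).
Qed.
End Rot.

Theorem plane_count : (#|E| <= 8 * n - 20)%N.
Proof.
have [rho [h1 h2 h3 h4 h5]] := drawing_rotation.
exact: drawing_count h1 h2 h3 h4 h5.
Qed.
End PlaneDrawing.

(** * Stereographic projection from a point off the drawing *)

Section Stereo.
Variables (R : realType) (p0 : pt R).
Local Notation pl := (R * R)%type.
Hypothesis s0 : sphere R p0.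
Hypothesis c0 : p0.2 != 0.

(* Inversion at p0 maps the sphere to a plane normal to p0; [St] then drops the third
   coordinate, which is injective on that plane when p0.2 <> 0. *)
Definition dot (p : pt R) : R := p0.1.1 * p.1.1 + p0.1.2 * p.1.2 + p0.2 * p.2.
Definition St (p : pt R) : pl := ((p.1.1 - p0.1.1) / (1 - dot p), (p.1.2 - p0.1.2) / (1 - dot p)).
(** The third coordinate of the point above q in the plane of vectors whose inner product with p0 is
    -1. *)
Definition wz (q : pl) : R := (- 1 - p0.1.1 * q.1 - p0.1.2 * q.2) / p0.2.
Definition nrm (q : pl) : R := q.1 ^+ 2 + q.2 ^+ 2 + wz q ^+ 2.
Definition Ti (q : pl) : pt R :=
  ((p0.1.1 + 2 / nrm q * q.1, p0.1.2 + 2 / nrm q * q.2), p0.2 + 2 / nrm q * wz q).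

Lemma s0' : p0.1.1 ^+ 2 + p0.1.2 ^+ 2 + p0.2 ^+ 2 = 1. Proof. exact: s0. Qed.

Lemma wzE q : p0.1.1 * q.1 + p0.1.2 * q.2 + p0.2 * wz q = - 1.
Proof. by have h := c0; rewrite /wz; field. Qed.

Lemma nrm_gt0 q : 0 < nrm q.
Proof.
have h1 := sqr_ge0 q.1; have h2 := sqr_ge0 q.2; have h3 := sqr_ge0 (wz q).
rewrite lt_neqAle; apply/andP; split; last by rewrite /nrm; lra.
apply/eqP => e; have e1 : q.1 ^+ 2 = 0 by rewrite /nrm in e; lra.
have e2 : q.2 ^+ 2 = 0 by rewrite /nrm in e; lra.
have e3 : wz q ^+ 2 = 0 by rewrite /nrm in e; lra.
have := wzE q; move/eqP: e1; rewrite sqrf_eq0 => /eqP ->; move/eqP: e2; rewrite sqrf_eq0 => /eqP ->.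
by move/eqP: e3; rewrite sqrf_eq0 => /eqP ->; rewrite !mulr0 !addr0 => /eqP; rewrite eq_sym oppr_eq0 oner_eq0.
Qed.

Lemma dot_Ti q : 1 - dot (Ti q) = 2 / nrm q.
Proof.
have -> : dot (Ti q) = (p0.1.1 ^+ 2 + p0.1.2 ^+ 2 + p0.2 ^+ 2) +
   2 / nrm q * (p0.1.1 * q.1 + p0.1.2 * q.2 + p0.2 * wz q) by rewrite /dot /Ti /=; ring.
by rewrite wzE s0'; ring.
Qed.

Lemma Ti_sphere q : sphere R (Ti q).
Proof.
rewrite /sphere /= /Ti /=.
have -> : (p0.1.1 + 2 / nrm q * q.1) ^+ 2 + (p0.1.2 + 2 / nrm q * q.2) ^+ 2 + (p0.2 + 2 / nrm q * wz q) ^+ 2 =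
  (p0.1.1 ^+ 2 + p0.1.2 ^+ 2 + p0.2 ^+ 2) + 4 / nrm q * (p0.1.1 * q.1 + p0.1.2 * q.2 + p0.2 * wz q) +
  (2 / nrm q) ^+ 2 * nrm q by rewrite {6}/nrm; ring.
by rewrite s0' wzE; have := nrm_gt0 q => h; field; rewrite gt_eqF.
Qed.

Lemma St_Ti q : St (Ti q) = q.
Proof.
rewrite /St dot_Ti; have := nrm_gt0 q => h; rewrite /Ti /=.
by case: q h => x y /= h; congr (_, _); field; rewrite gt_eqF.
Qed.

Lemma Ti_inj : injective Ti. Proof. exact: can_inj St_Ti. Qed.

Lemma dot_p0 : dot p0 = 1.
Proof. by rewrite /dot -!expr2 s0'. Qed.

Lemma Ti_p0 q : Ti q <> p0.
Proof.
move=> e; have := dot_Ti q; rewrite e dot_p0 subrr => /eqP; rewrite eq_sym mulf_eq0 invr_eq0.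
by rewrite (gt_eqF (nrm_gt0 q)) orbF pnatr_eq0.
Qed.

(** Since 1 - dot p is half of the squared distance from p0, [St] is the inversion at p0, and its
    denominator vanishes on the sphere only at p0. *)
Lemma dist_dot p : sphere R p ->
  (p.1.1 - p0.1.1) ^+ 2 + (p.1.2 - p0.1.2) ^+ 2 + (p.2 - p0.2) ^+ 2 = 2 * (1 - dot p).
Proof.
rewrite /sphere /= => hp.
have -> : (p.1.1 - p0.1.1) ^+ 2 + (p.1.2 - p0.1.2) ^+ 2 + (p.2 - p0.2) ^+ 2 =
  (p.1.1 ^+ 2 + p.1.2 ^+ 2 + p.2 ^+ 2) + (p0.1.1 ^+ 2 + p0.1.2 ^+ 2 + p0.2 ^+ 2) - 2 * dot p.
  by rewrite /dot; ring.
by rewrite hp s0'; ring.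
Qed.

Lemma dot_lt1 p : sphere R p -> p <> p0 -> 0 < 1 - dot p.
Proof.
move=> hp ne; have e := dist_dot hp.
have h1 := sqr_ge0 (p.1.1 - p0.1.1); have h2 := sqr_ge0 (p.1.2 - p0.1.2); have h3 := sqr_ge0 (p.2 - p0.2).
rewrite lt_neqAle; apply/andP; split; last by lra.
apply/eqP => d0; apply: ne.
have e1 : (p.1.1 - p0.1.1) ^+ 2 = 0 by lra.
have e2 : (p.1.2 - p0.1.2) ^+ 2 = 0 by lra.
have e3 : (p.2 - p0.2) ^+ 2 = 0 by lra.
move/eqP: e1; rewrite sqrf_eq0 subr_eq0 => /eqP e1; move/eqP: e2; rewrite sqrf_eq0 subr_eq0 => /eqP e2.
move/eqP: e3; rewrite sqrf_eq0 subr_eq0 => /eqP e3.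
by move: e1 e2 e3; case: p {hp e h1 h2 h3 d0} => [[x y] z]; case: (p0) => [[x' y'] z'] /= -> -> ->.
Qed.

Lemma Ti_St p : sphere R p -> p <> p0 -> Ti (St p) = p.
Proof.
move=> hp ne; have d0 := dot_lt1 hp ne; have e := dist_dot hp; have h := c0.
have dn : 1 - dot p != 0 by rewrite gt_eqF.
have ez : wz (St p) = (p.2 - p0.2) / (1 - dot p).
  have e1 := s0'; rewrite /wz /St /=.
  apply: (mulIf h); apply: (mulIf dn); rewrite divfK //.
  have -> : (-1 - p0.1.1 * ((p.1.1 - p0.1.1) / (1 - dot p)) - p0.1.2 * ((p.1.2 - p0.1.2) / (1 - dot p))) * (1 - dot p) =
    - (1 - dot p) - p0.1.1 * (p.1.1 - p0.1.1) - p0.1.2 * (p.1.2 - p0.1.2) by field.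
  have -> : (p.2 - p0.2) / (1 - dot p) * p0.2 * (1 - dot p) = (p.2 - p0.2) * p0.2 by field.
  rewrite /dot.
  have -> : - (1 - (p0.1.1 * p.1.1 + p0.1.2 * p.1.2 + p0.2 * p.2)) - p0.1.1 * (p.1.1 - p0.1.1) - p0.1.2 * (p.1.2 - p0.1.2) =
    p0.2 * p.2 - 1 + (p0.1.1 ^+ 2 + p0.1.2 ^+ 2 + p0.2 ^+ 2) - p0.2 ^+ 2 by ring.
  by rewrite e1; ring.
have en : 2 / nrm (St p) = 1 - dot p.
  have -> : nrm (St p) = 2 / (1 - dot p).
    rewrite /nrm ez /St /=.
    have -> : ((p.1.1 - p0.1.1) / (1 - dot p)) ^+ 2 + ((p.1.2 - p0.1.2) / (1 - dot p)) ^+ 2 + ((p.2 - p0.2) / (1 - dot p)) ^+ 2 =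
      ((p.1.1 - p0.1.1) ^+ 2 + (p.1.2 - p0.1.2) ^+ 2 + (p.2 - p0.2) ^+ 2) / (1 - dot p) ^+ 2 by field.
    by rewrite e; field.
  by field.
rewrite /Ti en ez /St /= !(mulrC (1 - dot p)) !divfK //.
by case: p {hp ne d0 e dn ez en} => [[x y] z] /=; rewrite !(addrC _ (_ - _)) !subrK.
Qed.

Lemma St_inj p p' : sphere R p -> sphere R p' -> p <> p0 -> p' <> p0 -> St p = St p' -> p = p'.
Proof. by move=> h h' n n' e; rewrite -(Ti_St h n) e Ti_St. Qed.

Lemma cont11 (p : pt R) : {for p, continuous (fun p : pt R => p.1.1)}.
Proof. apply: (@continuous_comp _ _ _ (fun p : pt R => p.1) (fun q : pl => q.1)); exact: cvg_fst. Qed.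
Lemma cont12 (p : pt R) : {for p, continuous (fun p : pt R => p.1.2)}.
Proof. apply: (@continuous_comp _ _ _ (fun p : pt R => p.1) (fun q : pl => q.2)); [exact: cvg_fst|exact: cvg_snd]. Qed.
Lemma cont2 (p : pt R) : {for p, continuous (fun p : pt R => p.2)}.
Proof. exact: cvg_snd. Qed.

Lemma dot_cont (p : pt R) : {for p, continuous dot}.
Proof.
apply: cvgD; first apply: cvgD; apply: cvgM; try exact: cvg_cst.
- exact: cont11.
- exact: cont12.
- exact: cont2.
Qed.

Lemma St_cont (p : pt R) : 1 - dot p != 0 -> {for p, continuous St}.
Proof.
move=> dn; have cd : {for p, continuous (fun p => (1 - dot p)^-1)}.
  by apply: cvgV => //; apply: cvgB; [exact: cvg_cst|exact: dot_cont].
have c1 : {for p, continuous (fun p : pt R => (p.1.1 - p0.1.1) / (1 - dot p))}.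
  by apply: cvgM => //; apply: cvgB; [exact: cont11|exact: cvg_cst].
have c2 : {for p, continuous (fun p : pt R => (p.1.2 - p0.1.2) / (1 - dot p))}.
  by apply: cvgM => //; apply: cvgB; [exact: cont12|exact: cvg_cst].
exact: (cvg_pair c1 c2).
Qed.

Lemma wz_cont (q : pl) : {for q, continuous wz}.
Proof.
apply: cvgM; last exact: cvg_cst.
apply: cvgB; first apply: cvgB; first exact: cvg_cst.
  by apply: cvgM; [exact: cvg_cst|exact: cvg_fst].
by apply: cvgM; [exact: cvg_cst|exact: cvg_snd].
Qed.

Lemma Ti_cont : continuous Ti.
Proof.
move=> q; have f1 : {for q, continuous (fun q : pl => q.1)} by exact: cvg_fst.
have f2 : {for q, continuous (fun q : pl => q.2)} by exact: cvg_snd.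
have fz := @wz_cont q.
have fn : {for q, continuous (fun q => 2 / nrm q)}.
  apply: cvgM; first exact: cvg_cst.
  apply: cvgV; first by rewrite gt_eqF // nrm_gt0.
  by rewrite /nrm; apply: cvgD; first apply: cvgD; (under eq_fun do rewrite expr2); apply: cvgM.
have k1 : {for q, continuous (fun q : pl => p0.1.1 + 2 / nrm q * q.1)}.
  by apply: cvgD; [exact: cvg_cst|apply: cvgM].
have k2 : {for q, continuous (fun q : pl => p0.1.2 + 2 / nrm q * q.2)}.
  by apply: cvgD; [exact: cvg_cst|apply: cvgM].
have k3 : {for q, continuous (fun q : pl => p0.2 + 2 / nrm q * wz q)}.
  by apply: cvgD; [exact: cvg_cst|apply: cvgM].
exact: (cvg_pair (cvg_pair k1 k2) k3).
Qed.
End Stereo.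

(** * A point of the plane off finitely many arcs *)

Section Avoid.
Variable R : realType.
Local Notation pl := (R * R)%type.

(** Shrink a box so as to leave one closed set after the other, as in Baire's theorem. *)
Lemma avoid_closed (I : finType) (F : I -> set pl) (r0 : R) : 0 < r0 -> (forall i, closed (F i)) ->
  (forall i c r, 0 < r -> exists2 q, nb r c q & ~ F i q) ->
  exists2 q, nb r0 (0, 0) q & forall i, ~ F i q.
Proof.
move=> r00 cF noF.
suff K (s : seq I) : exists c (r : R), 0 < r /\ forall q, nb r c q -> nb r0 (0, 0) q /\ forall i, i \in s -> ~ F i q.
  have [c [r [r_0 h]]] := K (enum I); have [h1 h2] := h c (nb_refl c (ltW r_0)).
  by exists c => // i; apply: h2; rewrite mem_enum.
elim: s => [|i s [c [r [r_0 h]]]]; first by exists (0, 0), r0.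
have r20 : 0 < r / 2 by rewrite divr_gt0.
have [q nq nF] := noF i c _ r20.
have : nbhs q (~` F i) by apply: open_nbhs_nbhs; split => //; exact: closed_openC.
move=> /nbhs_ballP[d /= d0 hd].
exists q, (Num.min (r / 2) (d / 2)); split; first by rewrite lt_min r20 divr_gt0.
move=> q' nq'; have n1 : nb (r / 2) q q' by apply: nb_le nq'; rewrite ge_min lexx.
have n2 : nb (d / 2) q q' by apply: nb_le nq'; rewrite ge_min lexx orbT.
have [h1 h2] : nb r0 (0, 0) q' /\ forall i0, i0 \in s -> ~ F i0 q'.
  by apply: h; apply: (nb_le (r := r / 2 + r / 2)); [lra|exact: nb_trans nq n1].
split=> // j; rewrite inE => /orP[/eqP ->|/h2 //].
apply: (hd q'); case/andP: n2 => m1 m2; split; rewrite /ball /=.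
  by apply: le_lt_trans m1 _; lra.
by apply: le_lt_trans m2 _; lra.
Qed.

Definition seg_pt (P Q : pl) (t : R) : pl := (P.1 + (Q.1 - P.1) * t, P.2 + (Q.2 - P.2) * t).
Definition corner (c : pl) (r : R) (i : nat) : pl :=
  if i == 0%N then c else if i == 1%N then (c.1 + r, c.2) else (c.1, c.2 + r).

Lemma corner_off (x y r t : R) i j k : 0 < r -> (i < 3)%N -> (j < 3)%N -> (k < 3)%N ->
  i != j -> j != k -> i != k -> seg_pt (corner (x, y) r i) (corner (x, y) r j) t <> corner (x, y) r k.
Proof.
move=> r0; move: i j k => [|[|[|//]]] [|[|[|//]]] [|[|[|//]]] // _ _ _ _ _ _;
  by rewrite /seg_pt /corner /= => -[e1 e2]; have : r < r; [lra|rewrite ltxx].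
Qed.

Lemma corner_inj (x y r : R) i j : 0 < r -> (i < 3)%N -> (j < 3)%N -> i != j ->
  corner (x, y) r i <> corner (x, y) r j.
Proof.
move=> r0; move: i j => [|[|[|//]]] [|[|[|//]]] // _ _ _;
  by rewrite /corner /= => -[] *; have : r < r; [lra|rewrite ltxx].
Qed.

Variables (K : topologicalType) (ga : R -> K) (f : pl -> K).
Hypothesis hK : hausdorff_space K.
Hypothesis cga : continuous ga.
Hypothesis iga : forall t t' : R, 0 <= t <= 1 -> 0 <= t' <= 1 -> ga t = ga t' -> t = t'.
Hypothesis cf : continuous f.
Hypothesis If : injective f.

Lemma arc_closed (a b : R) : closed (f @^-1` (ga @` `[a, b]%classic)).
Proof.
apply: preimage_closed => //; apply: compact_closed => //.
by apply: continuous_compact; [exact: continuous_subspaceT|exact: segment_compact].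
Qed.

Lemma seg_cont P Q : continuous (seg_pt P Q).
Proof.
move=> t; have c1 (x y : R) : {for t, continuous (fun t : R => x + y * t)}.
  by apply: cvgD; [exact: cvg_cst|apply: cvgM; [exact: cvg_cst|exact: cvg_id]].
exact: (cvg_pair (c1 P.1 _) (c1 P.2 _)).
Qed.

(** The parts of the segment covered by ga([0, w]) and by ga([w, 1]) are closed and non-empty, and
    disjoint because the segment misses ga(w): it would not be connected. *)
Lemma three_arc (P Q : pl) (u v w : R) : 0 <= u <= 1 -> 0 <= v <= 1 -> 0 <= w <= 1 -> u < w -> w < v ->
  (forall t : R, 0 <= t <= 1 -> exists2 s : R, 0 <= s <= 1 & ga s = f (seg_pt P Q t)) ->
  ga u = f P -> ga v = f Q -> (forall t : R, 0 <= t <= 1 -> f (seg_pt P Q t) <> ga w) -> False.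
Proof.
move=> hu hv hw uw wv cov eu ev off.
have [/andP[u0 u1] /andP[v0 v1] /andP[w0 w1]] := And3 hu hv hw.
pose g := f \o seg_pt P Q.
have cg : continuous g by move=> t; apply: continuous_comp; [exact: seg_cont|exact: cf].
pose B1 := g @^-1` (ga @` `[0, w]%classic); pose B2 := g @^-1` (ga @` `[w, 1]%classic).
have cl x y : closed (g @^-1` (ga @` `[x, y]%classic)).
  apply: preimage_closed => //; apply: compact_closed => //.
  by apply: continuous_compact; [exact: continuous_subspaceT|exact: segment_compact].
have dis t : 0 <= t <= 1 -> B1 t -> B2 t -> False.
  move=> ht [s /=]; rewrite in_itv /= => /andP[s0 s1] e1 [s' /=]; rewrite in_itv /= => /andP[s0' s1'] e2.
  have es : s = s' by apply: iga; rewrite ?e1 ?e2 //; apply/andP; split; lra.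
  have ew : s = w by lra.
  by apply: (off t ht); rewrite -ew e1.
have tot t : 0 <= t <= 1 -> B1 t \/ B2 t.
  move=> ht; have [s /andP[s0 s1] e] := cov t ht; case: (leP s w) => sw.
    by left; exists s => //=; rewrite in_itv /= s0.
  by right; exists s => //=; rewrite in_itv /= s1 (ltW sw).
have g0 : g 0 = ga u by rewrite eu /g /= /seg_pt !mulr0 !addr0; case: (P).
have g1 : g 1 = ga v.
  by rewrite ev /g /= /seg_pt !mulr1 !(addrC _ (_ - _)) !subrK; case: (Q).
have B10 : B1 0 by exists u; rewrite ?g0 //= in_itv /= u0 ltW.
have B21 : B2 1 by exists v; rewrite ?g1 //= in_itv /= v1 ltW.
have sc := @segment_connected R 0 1 (`[0, 1]%classic `&` B1).
have con : (`[0, 1]%classic `&` B1) = `[0, 1]%classic -> False.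
  move=> e; have : (`[0, 1]%classic `&` B1) 1 by rewrite e /= in_itv /= ler01 lexx.
  by move=> [_ b1]; apply: (dis 1 _ b1 B21); rewrite ler01 lexx.
apply/con/sc.
- by exists 0; split=> //=; rewrite in_itv /= lexx ler01.
- exists (~` B2); first exact/closed_openC/cl.
  rewrite eqEsubset; split=> t /= [ht b1]; split=> //; have ht' : 0 <= t <= 1 by rewrite in_itv /= in ht.
    by move=> b2; exact: dis ht' b1 b2.
  by case: (tot t ht').
- by exists B1 => //; exact: cl.
Qed.

(* Otherwise, given three non-collinear points, the one with the middle parameter
   would separate the segment joining the two others. *)
Lemma arc_no_box (c : pl) (r : R) : 0 < r -> exists2 q, nb r c q & ~ (f @^-1` (ga @` `[0, 1]%classic)) q.
Proof.
move=> r0; apply: contrapT => no.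
have cov q : nb r c q -> exists2 s : R, 0 <= s <= 1 & ga s = f q.
  move=> nq; apply: contrapT => ns; apply: no; exists q => // -[s /=]; rewrite in_itv /= => hs es.
pose P := corner c r.
have inB i : nb r c (P i).
  apply/nbP; rewrite /P /corner; case: (i == 0%N); [|case: (i == 1%N)] => /=; split; lra.
have seg_in i j (t : R) : 0 <= t <= 1 -> nb r c (seg_pt (P i) (P j) t).
  move=> /andP[t0 t1]; have /nbP[a1 a2 a3 a4] := inB i; have /nbP[b1 b2 b3 b4] := inB j.
  apply/nbP; rewrite /seg_pt /=.
  have h x y l h : l <= x -> x <= h -> l <= y -> y <= h -> l <= x + (y - x) * t /\ x + (y - x) * t <= h.
    move=> x1 x2 y1 y2; have -> : x + (y - x) * t = (1 - t) * x + t * y by ring.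
    have t1' : 0 <= 1 - t by lra.
    have m1 := ler_wpM2l t1' x1; have m2 := ler_wpM2l t1' x2.
    have m3 := ler_wpM2l t0 y1; have m4 := ler_wpM2l t0 y2; split; lra.
  have [k1 k2] := h _ _ _ _ a1 a2 b1 b2; have [k3 k4] := h _ _ _ _ a3 a4 b3 b4.
  by split.
have /choice[u hu] : forall i, exists s : R, 0 <= s <= 1 /\ ga s = f (P i).
  by move=> i; have [s ? ?] := cov _ (inB i); exists s.
have off i j k (t : R) : (i < 3)%N -> (j < 3)%N -> (k < 3)%N -> i != j -> j != k -> i != k -> f (seg_pt (P i) (P j) t) <> ga (u k).
  move=> i3 j3 k3 n1 n2 n3; rewrite (hu k).2 => /If.
  by rewrite /P; case: (c) => x y; exact: corner_off.
have key i j k : (i < 3)%N -> (j < 3)%N -> (k < 3)%N -> i != j -> j != k -> i != k -> u i < u k -> u k < u j -> False.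
  move=> i3 j3 k3 n1 n2 n3 h1 h2.
  apply: (@three_arc (P i) (P j) (u i) (u j) (u k) (hu i).1 (hu j).1 (hu k).1 h1 h2 _ (hu i).2 (hu j).2).
    by move=> t ht; apply: cov; exact: seg_in.
  by move=> t _; apply: off.
have ne i j : (i < 3)%N -> (j < 3)%N -> i != j -> u i < u j \/ u j < u i.
  move=> i3 j3 nij; case: (ltrgtP (u i) (u j)) => [|| e]; [by left|by right|].
  have : P i = P j by apply: If; rewrite -(hu i).2 -(hu j).2 e.
  by move=> e'; exfalso; move: e'; rewrite /P; case: (c) => x y; exact: corner_inj.
have [h01|h01] := ne 0%N 1%N isT isT isT; have [h12|h12] := ne 1%N 2%N isT isT isT; have [h02|h02] := ne 0%N 2%N isT isT isT.
- exact: (key 0%N 2%N 1%N).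
- by lra.
- exact: (key 0%N 1%N 2%N).
- exact: (key 2%N 1%N 0%N).
- exact: (key 1%N 2%N 0%N).
- exact: (key 1%N 0%N 2%N).
- by lra.
- exact: (key 2%N 0%N 1%N).
Qed.
End Avoid.

(** * From the sphere to the plane *)

Lemma within_comp (X Y Z : topologicalType) (A : set Y) (f : Y -> Z) (g : X -> Y) (x : X) :
  {within A, continuous f} -> {for x, continuous g} -> (\forall y \near x, A (g y)) ->
  {for x, continuous (f \o g)}.
Proof.
move=> cf cg nA N HN.
have W := (subspace_continuousP A f).1 cf (g x) (nbhs_singleton nA) N HN.
have W' : nbhs (g x) [set u | A u -> N (f u)] by exact: W.
have V := cg _ W'.
have V' : nbhs x [set y | A (g y) -> N (f (g y))] by exact: V.
by apply: (filterS2 _ _ V' nA) => y; exact.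
Qed.

Lemma connected_loc_const (K : topologicalType) (L D : set K) (k : K -> bool) : connected L -> L `<=` D ->
  (forall p, D p -> \forall p' \near p, D p' -> k p' = k p) -> forall p p', L p -> L p' -> k p = k p'.
Proof.
move=> cL LD hk p p' Lp Lp'.
pose O b := interior [set q | D q -> k q = b].
have OP q b : L q -> O b q <-> k q = b.
  move=> Lq; split; first by move=> /interior_subset /(_ (LD _ Lq)).
  by move=> <-; exact: hk (LD _ Lq).
have := cL (L `&` [set q | k q = k p]).
have con : (L `&` [set q | k q = k p]) = L -> k p = k p'.
  by move=> e; have : (L `&` [set q | k q = k p]) p' by [rewrite e]; case=> _ /= ->.
move=> sc; apply/con/sc.
- by exists p.
- exists (O (k p)); first exact: open_interior.
  by rewrite eqEsubset; split=> q [Lq h]; split=> //; [exact/(OP q _ Lq)|exact/(OP q _ Lq)].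
- exists (~` O (~~ k p)); first exact/open_closedC/open_interior.
  rewrite eqEsubset; split=> q [Lq h]; split=> //.
    by move=> /(OP q _ Lq) e; move: h => /=; rewrite e; case: (k p).
  have : ~ (k q = ~~ k p) by move=> /(OP q _ Lq).
  by rewrite /=; case: (k q) (k p) => [] [].
Qed.

(** * The winding number as a locally constant function off a closed curve *)

Section PlaneWinding.
Variable R : realType.
Local Notation pl := (R * R)%type.

Lemma curve_bound (ga : R -> pl) (a b : R) : continuous ga ->
  exists2 M : R, 0 < M & forall t, a <= t <= b -> nb M (0, 0) (ga t).
Proof.
(* A reciprocal turns the upper bound wanted into the lower bound given by [compact_sep]. *)
move=> cg; pose f (x : pl) : R := (1 + l1 (ga x.1) (0, 0))^-1.
have pos x : 0 < 1 + l1 (ga x) (0, 0) by have := l1_ge0 (ga x) (0, 0); lra.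
have cf : continuous f.
  move=> x; apply: cvgV; first by rewrite gt_eqF.
  apply: cvgD; first exact: cvg_cst.
  apply: (@cont_l1 _ _ (fun x : pl => ga x.1) (fun _ => (0, 0))) => y.
    by apply: continuous_comp; [exact: cvg_fst|exact: cg].
  exact: cst_continuous.
have c0 : continuous (fun _ : pl => 0 : R) by move=> x; exact: cst_continuous.
have [|e e0 he] := @compact_sep R f (fun _ => 0) a b 0 0 cf c0.
  by move=> x _ _ _; rewrite /f invr_eq0 gt_eqF.
exists e^-1; first by rewrite invr_gt0.
move=> t ht; have := he (t, 0) ht; rewrite /= lexx => /(_ isT isT).
rewrite /f /= gtr0_norm ?invr_gt0 // => h.
have h' : 1 + l1 (ga t) (0, 0) < e^-1 by rewrite -[X in X < _]invrK ltf_pV2 // posrE ?invr_gt0.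
have := normr_ge0 (ga t).1; have := normr_ge0 (ga t).2.
move: h'; rewrite /l1 /nb /= !subr0 !sub0r !normrN => h1 h2 h3; apply/andP; split; lra.
Qed.

Variables (ga be : R -> pl) (a b c d : R).
Hypothesis cga : continuous ga.
Hypothesis cbe : continuous be.
Hypothesis ab : a <= b.
Hypothesis cd : c <= d.
Hypothesis match_ends : (ga a = be c /\ ga b = be d) \/ (ga a = be d /\ ga b = be c).
Let w x := Xl ga a b x (+) Xl be c d x.

(** Outside a box around both parts, each increment depends only on the ends of the part, and the
    ends match. *)
Lemma closed_far : exists2 M : R, 0 < M & forall x, ~~ nb M (0, 0) x -> w x = false.
Proof.
have [M1 M10 h1] := curve_bound a b cga; have [M2 M20 h2] := curve_bound c d cbe.
exists (Num.max M1 M2); first by rewrite lt_max M10.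
move=> x nx; have hab := ab; have hcd := cd.
have b1 t : a <= t <= b -> nb (Num.max M1 M2) (0, 0) (ga t).
  by move=> /h1; apply: nb_le; rewrite le_max lexx.
have b2 t : c <= t <= d -> nb (Num.max M1 M2) (0, 0) (be t).
  by move=> /h2; apply: nb_le; rewrite le_max lexx orbT.
rewrite /w (Xl_box cga ab b1 nx) (Xl_box cbe cd b2 nx).
have [g hg] := chi_box nx; rewrite !hg; try by [apply: b1; rewrite lexx|apply: b2; rewrite lexx].
  by case: match_ends => -[-> ->]; case: (g _) (g _) => [] [].
all: by [apply: b1; rewrite lexx ?andbT|apply: b2; rewrite lexx ?andbT].
Qed.

Lemma closed_near x : (forall t, a <= t <= b -> ga t <> x) -> (forall t, c <= t <= d -> be t <> x) ->
  exists2 s : R, 0 < s & forall x', nb s x x' -> w x' = w x.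
Proof.
move=> o1 o2; have [r1 r10 h1] := curve_away cga o1; have [r2 r20 h2] := curve_away cbe o2.
pose r := Num.min r1 r2; have r0 : 0 < r by rewrite lt_min r10.
exists (r / 2); first by rewrite divr_gt0.
move=> x' nx; have sr : r / 2 < r by lra.
have s0 : 0 <= r / 2 by lra.
have a1 t : a <= t <= b -> ~~ nb r (ga t) x by move=> /h1; apply: contra; apply: nb_le; rewrite ge_min lexx.
have a2 t : c <= t <= d -> ~~ nb r (be t) x by move=> /h2; apply: contra; apply: nb_le; rewrite ge_min lexx orbT.
have e1 := Xl_dual cga ab s0 sr a1 nx; have e2 := Xl_dual cbe cd s0 sr a2 nx.
rewrite /w; move: e1 e2; case: match_ends => -[-> ->].
  move: (dual_pot _ _ _) (dual_pot _ _ _) (Xl ga _ _ _) (Xl ga _ _ _) (Xl be _ _ _) (Xl be _ _ _).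
  by move=> [] [] [] [] [] [].
move: (dual_pot _ _ _) (dual_pot _ _ _) (Xl ga _ _ _) (Xl ga _ _ _) (Xl be _ _ _) (Xl be _ _ _).
by move=> [] [] [] [] [] [].
Qed.
End PlaneWinding.

(** * A drawing on the sphere seen from a pole *)

Section Transfer.
Variables (R : realType) (n : nat) (E : finType) (ends : E -> 'I_n * 'I_n).
Local Notation pl := (R * R)%type.
Variables (pos : 'I_n -> pt R) (arc : E -> R -> pt R).
Hypothesis pos_sph : forall v, sphere R (pos v).
Hypothesis pos_inj : injective pos.
Hypothesis arc_sph : forall e, arc e @` I01 R `<=` sphere R.
Hypothesis arc_cont : forall e, {within I01 R, continuous (arc e)}.
Hypothesis arc_inj : forall e s t, I01 R s -> I01 R t -> arc e s = arc e t -> s = t.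
Hypothesis arc_ends : forall e, arc e 0 = pos (ends e).1 /\ arc e 1 = pos (ends e).2.
Hypothesis arc_pos : forall e v, ~ edge_int arc e (pos v).
Hypothesis arc_fin : forall e f, e != f -> finite_set (edge_img arc e `&` edge_img arc f).
Hypothesis arc_cross : forall e f p, e != f -> edge_int arc e p -> edge_int arc f p -> proper_crossing arc e f p.
Hypothesis arc_no3 : forall e f g p, e != f -> f != g -> e != g ->
  ~ [/\ edge_int arc e p, edge_int arc f p & edge_int arc g p].

(** Clamping the parameter makes the arcs continuous on the whole line. *)
Definition cl (t : R) : R := Num.max 0 (Num.min 1 t).
Lemma clP t : 0 <= cl t <= 1. Proof. exact: clampP (@ler01 R). Qed.
Lemma clE t : 0 <= t <= 1 -> cl t = t. Proof. exact: clamp_id. Qed.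
Definition arcc e (t : R) := arc e (cl t).

Lemma arcc_cont e : continuous (arcc e).
Proof.
move=> t; apply: (within_comp (@arc_cont e) (g := cl)); first exact: clamp_cont.
exact: (@filterE _ (nbhs t) _ _ clP).
Qed.

Lemma arcc_inj e (t t' : R) : 0 <= t <= 1 -> 0 <= t' <= 1 -> arcc e t = arcc e t' -> t = t'.
Proof. by move=> ht ht'; rewrite /arcc !clE //; exact: arc_inj. Qed.

Lemma haus : hausdorff_space (pt R).
Proof. exact: norm_hausdorff. Qed.

Lemma pole_ex : exists p0 : pt R, [/\ sphere R p0, p0.2 != 0, forall e t, 0 <= t <= 1 -> arc e t <> p0 &
  forall v, pos v <> p0].
Proof.
pose N : pt R := ((0, 0), 1).
have sN : sphere R N by rewrite /sphere /= expr0n /= !add0r expr1n.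
have cN : N.2 != 0 by exact: oner_neq0.
pose F (i : E + 'I_n) : set pl := match i with
  | inl e => Ti N @^-1` (arcc e @` `[0, 1]%classic)
  | inr v => Ti N @^-1` [set pos v] end.
have cT : continuous (Ti N) by exact: Ti_cont.
have iT : injective (Ti N) by exact: Ti_inj.
have r20 : 0 < (1 / 2 : R) by lra.
(* Under the projection from N, the points with third coordinate 0 are those over the unit circle,
   and the box of radius 1/2 misses it. *)
have [|[e|v] c r r0|q nq hq] := @avoid_closed R _ F (1 / 2) r20.
- case=> [e|v]; first exact: (arc_closed haus (@arcc_cont e) cT).
  apply: preimage_closed => //; apply: compact_closed; [exact: haus|exact: compact_set1].
- exact: (arc_no_box haus (@arcc_cont e) (@arcc_inj e) cT iT c r0).
- have [e1|n1] := pselect (Ti N c = pos v); last by exists c => //; exact: nb_refl (ltW r0).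
  exists (c.1 + r, c.2); first by apply/nbP; split=> /=; lra.
  move=> /= e2; have /iT e3 : Ti N (c.1 + r, c.2) = Ti N c by rewrite e1.
  by move: e3; case: (c) => x y [] ?; lra.
exists (Ti N q); split.
- exact: Ti_sphere.
- rewrite /Ti /= /wz /= !mul0r !subr0 divr1; apply/eqP => e0.
  have n0 := nrm_gt0 cN q; have e1 : 2 / nrm N q = 1 by lra.
  have e2 : nrm N q = 2 by have := divfK (lt0r_neq0 n0) 2; rewrite e1 mul1r.
  move: e2; rewrite /nrm /wz /= !mul0r !subr0 divr1 sqrrN expr1n.
  move: nq => /nbP /= [a1 a2 a3 a4] e2.
  have h1 : 0 <= (1 / 2 - q.1) * (1 / 2 + q.1) by apply: mulr_ge0; lra.
  have h2 : 0 <= (1 / 2 - q.2) * (1 / 2 + q.2) by apply: mulr_ge0; lra.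
  have h3 : (1 / 2 - q.1) * (1 / 2 + q.1) = 1 / 4 - q.1 ^+ 2 by field.
  have h4 : (1 / 2 - q.2) * (1 / 2 + q.2) = 1 / 4 - q.2 ^+ 2 by field.
  lra.
- move=> e t ht et; apply: (hq (inl e)); exists t; first by rewrite /= in_itv.
  by rewrite /arcc clE.
- by move=> v ev; apply: (hq (inr v)) => /=.
Qed.

Section Pole.
Variable p0 : pt R.
Hypothesis sp : sphere R p0.
Hypothesis cp : p0.2 != 0.
Hypothesis arc_p0 : forall e t, 0 <= t <= 1 -> arc e t <> p0.
Hypothesis pos_p0 : forall v, pos v <> p0.
Local Notation St := (St p0).
Local Notation Ti := (Ti p0).

Definition A e (t : R) : pl := St (arcc e t).
Definition pv v : pl := St (pos v).

Lemma arcc_sph e t : sphere R (arcc e t).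
Proof. by apply: (arc_sph (e := e)); exists (cl t) => //; exact: clP. Qed.
Lemma arcc_p0 e t : arcc e t <> p0. Proof. by apply: arc_p0; exact: clP. Qed.

Lemma St_inj' p p' : sphere R p -> sphere R p' -> p <> p0 -> p' <> p0 -> St p = St p' -> p = p'.
Proof. exact: St_inj. Qed.

Lemma A_cont e : continuous (A e).
Proof.
move=> t; apply: (@continuous_comp _ _ _ (arcc e) St); first exact: arcc_cont.
by apply: St_cont; rewrite gt_eqF //; apply: dot_lt1 => //; [exact: arcc_sph|exact: arcc_p0].
Qed.

Lemma A_arc e f s t : A e s = A f t -> arcc e s = arcc f t.
Proof. by apply: St_inj'; [exact: arcc_sph|exact: arcc_sph|exact: arcc_p0|exact: arcc_p0]. Qed.

Lemma A_inj e (t t' : R) : 0 <= t <= 1 -> 0 <= t' <= 1 -> A e t = A e t' -> t = t'.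
Proof. by move=> ht ht' /A_arc; exact: arcc_inj. Qed.

Lemma A0 e : A e 0 = pv (ends e).1.
Proof. by rewrite /A /arcc clE ?lexx ?ler01 // (arc_ends e).1. Qed.
Lemma A1 e : A e 1 = pv (ends e).2.
Proof. by rewrite /A /arcc clE ?lexx ?ler01 // (arc_ends e).2. Qed.

Lemma pv_inj : injective pv.
Proof. by move=> v v' /(St_inj' (pos_sph _) (pos_sph _) (@pos_p0 _) (@pos_p0 _)) /pos_inj. Qed.

Lemma A_pv e (t : R) v : 0 <= t <= 1 -> A e t = pv v -> t = 0 \/ t = 1.
Proof.
move=> ht /(St_inj' (arcc_sph _ _) (pos_sph _) (@arcc_p0 _ _) (@pos_p0 _)); rewrite /arcc clE // => et.
have [->|n0] := eqVneq t 0; first by left.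
have [->|n1] := eqVneq t 1; first by right.
exfalso; apply: (@arc_pos e v); exists t => //=.
by have /andP[h1 h2] := ht; rewrite /I01o /= !lt_neqAle h1 h2 n1 eq_sym n0.
Qed.

Lemma inner01 (t : R) : 0 < t < 1 -> 0 <= t <= 1.
Proof. by move=> /andP[/ltW -> /ltW ->]. Qed.

Lemma meets_int e f p : meets A e f p -> [/\ e != f, p = St (Ti p), sphere R (Ti p), edge_int arc e (Ti p) & edge_int arc f (Ti p)].
Proof.
move=> [ne [s [t [hs ht es et]]]]; have TA g u : Ti (A g u) = arcc g u.
  by rewrite /A Ti_St //; [exact: arcc_sph|exact: arcc_p0].
split=> //; first by rewrite St_Ti.
- exact: Ti_sphere.
- by rewrite -es TA /arcc clE ?inner01 //; exists s.
- by rewrite -et TA /arcc clE ?inner01 //; exists t.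
Qed.

Lemma int_meets e f P : e != f -> edge_int arc e P -> edge_int arc f P -> meets A e f (St P).
Proof.
move=> ne [s hs es] [t ht et]; split=> //; exists s, t; rewrite /A /arcc !clE ?inner01 //.
by rewrite es et.
Qed.

Lemma xs_ex : exists xs : seq pl, forall p, p \in xs <-> exists e f, meets A e f p.
Proof.
have ex (ef : E * E) : exists l : seq (pt R), ef.1 != ef.2 -> edge_img arc ef.1 `&` edge_img arc ef.2 = [set` l].
  case: (boolP (ef.1 != ef.2)) => ne; last by exists [::].
  by have /finite_seqP[l hl] := arc_fin ne; exists l.
have [l hl] := fin_all_exists ex.
exists [seq p <- flatten [seq map St (l ef) | ef <- enum {: E * E}] | `[< exists e f, meets A e f p >]].
move=> p; rewrite mem_filter; split; first by move=> /andP[/asboolP].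
move=> h; apply/andP; split; first exact/asboolP.
have [e [f m]] := h; have [ne ep _ [s hs es] [t ht et]] := meets_int m; rewrite [X in X \in _]ep.
apply/flattenP; exists (map St (l (e, f))); first by apply/mapP; exists (e, f); rewrite ?mem_enum.
apply: map_f; have : [set` l (e, f)] (Ti p).
  by rewrite -hl //; split; [exists s|exists t] => //; exact: inner01.
by [].
Qed.

Lemma A_no3 e f g (s t u : R) : e != f -> f != g -> e != g ->
  0 < s < 1 -> 0 < t < 1 -> 0 < u < 1 -> A e s = A f t -> A f t = A g u -> False.
Proof.
move=> n1 n2 n3 hs ht hu /A_arc e1 /A_arc e2.
apply: (arc_no3 (p := arcc f t) n1 n2 n3); split.
- by exists s => //; rewrite -e1 /arcc clE ?inner01.
- by exists t => //; rewrite /arcc clE ?inner01.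
- by exists u => //; rewrite e2 /arcc clE ?inner01.
Qed.

(** Composition with this retraction onto the box extends the inverse of a chart continuously to the
    whole plane. *)
Definition cbox (r : R) (q : pl) : pl := (Num.max (- r) (Num.min r q.1), Num.max (- r) (Num.min r q.2)).

Lemma cbox_cont r : continuous (cbox r).
Proof.
have c1 (f : pl -> R) : continuous f -> continuous (fun q => Num.max (- r) (Num.min r (f q))).
  move=> cf q; apply: (@continuous_max _ _ (fun _ => - r) (fun q => Num.min r (f q))); first exact: cvg_cst.
  by apply: (@continuous_min _ _ (fun _ => r) f); [exact: cvg_cst|exact: cf].
move=> q; have k1 : continuous (fun q : pl => q.1) by move=> ?; exact: cvg_fst.
have k2 : continuous (fun q : pl => q.2) by move=> ?; exact: cvg_snd.
exact: (cvg_pair (c1 _ k1 q) (c1 _ k2 q)).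
Qed.

Lemma cboxP (r : R) q : 0 <= r -> nb r (0, 0) (cbox r q).
Proof.
move=> r0; apply/nbP => /=; have rr : - r <= r by lra.
by split; rewrite ?sub0r ?add0r ?le_max ?ge_max ?lexx // ge_min lexx rr.
Qed.

Lemma cbox_id (r : R) q : nb r (0, 0) q -> cbox r q = q.
Proof.
move=> /nbP /=; rewrite !sub0r !add0r => -[h1 h2 h3 h4].
by rewrite /cbox !(min_r, max_r) //; case: q {h1 h2 h3 h4}.
Qed.

Lemma box_disk (r : R) q : 0 < r -> r <= 1 / 2 -> nb r (0, 0) q -> disk R q.
Proof.
move=> r0 r1 /nbP /=; rewrite !sub0r !add0r => -[h1 h2 h3 h4].
rewrite /disk /=.
have k1 : 0 <= (1 / 2 - q.1) * (1 / 2 + q.1) by apply: mulr_ge0; lra.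
have k2 : 0 <= (1 / 2 - q.2) * (1 / 2 + q.2) by apply: mulr_ge0; lra.
have k3 : (1 / 2 - q.1) * (1 / 2 + q.1) = 1 / 4 - q.1 ^+ 2 by field.
have k4 : (1 / 2 - q.2) * (1 / 2 + q.2) = 1 / 4 - q.2 ^+ 2 by field.
lra.
Qed.

Lemma A_charts e f p : meets A e f p -> exists G H V r, chart_ok A e f p G H V r.
Proof.
move=> /meets_int[ne ep sP iE iF]; set P := Ti p in ep sP iE iF *.
have [U [oU UP [h [[g [hU [gD [gh [hg [ch cg]]]]]] h0 hE hF]]]] := arc_cross ne iE iF.
have Pp : P <> p0 by exact: Ti_p0.
(* The box has to fit in the unit disk and to miss the image of the pole, where the projection
   breaks down. *)
have [r [r0 r1 rp]] : exists r : R, [/\ 0 < r, r <= 1 / 2 & (U `&` sphere R) p0 -> ~~ nb r (0, 0) (h p0)].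
  have [Up|nU] := pselect ((U `&` sphere R) p0); last by exists (1 / 2); split; [lra|lra|].
  have k0 : 0 < l1 (h p0) (0, 0).
    rewrite lt_neqAle l1_ge0 andbT eq_sym l1_eq0; apply/eqP => e0.
    apply: Pp; rewrite -(gh P) // -[RHS]gh // e0 h0 //.
  exists (Num.min (1 / 2) (l1 (h p0) (0, 0) / 4)); split.
  - by rewrite lt_min; apply/andP; split; lra.
  - by rewrite ge_min lexx.
  - move=> _; rewrite nb_sym; apply: contra (_ : ~~ nb (l1 (h p0) (0, 0) / 2 / 2) (h p0) (0, 0)).
      by apply: nb_le; rewrite ge_min; apply/orP; right; lra.
    by apply: l1_nb; lra.
have r0' := ltW r0.
pose G := St \o (g \o cbox r); pose H := h \o Ti.
pose V := [set q : pl | U (Ti q) /\ ball ((0 : R), (0 : R)) r (H q)].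
have cT : continuous Ti by exact: Ti_cont.
have inU q : U (Ti q) -> (U `&` sphere R) (Ti q) by move=> u; split=> //; exact: Ti_sphere.
have nU q : U (Ti q) -> nbhs q (Ti @^-1` (U `&` sphere R)).
  move=> u; have N : nbhs q (Ti @^-1` U) by apply: cT; exact: open_nbhs_nbhs.
  by apply: filterS N => q' u'; exact: inU.
have cH q : U (Ti q) -> {for q, continuous H}.
  by move=> u; apply: (within_comp ch); [exact: cT|exact: nU].
have oV : open V.
  rewrite openE => q [u bq]; have N1 := nU q u.
  have N2 : nbhs q (H @^-1` ball ((0 : R), (0 : R)) r).
    by apply: (cH q u); apply: open_nbhs_nbhs; split; [exact: ball_open|].
  by apply: filterS2 N1 N2 => q' [u' _] b'; split.
have dq q : disk R (cbox r q) by apply: (box_disk r0 r1); exact: cboxP.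
have gs q : (U `&` sphere R) (g (cbox r q)) by apply: gD; exact: dq.
have gp q : g (cbox r q) <> p0.
  move=> e0; have := gs q; rewrite e0 => /rp; rewrite -e0 hg // cboxP //.
have HG q : nb r (0, 0) q -> H (G q) = q.
  move=> nq; rewrite /H /G /= (Ti_St sp cp (gs q).2 (@gp q)).
  by rewrite cbox_id // hg //; exact: (box_disk r0 r1).
have AG k (t : R) q : 0 <= t <= 1 -> nb r (0, 0) q -> A k t = G q -> (h @` (U `&` edge_img arc k)) q.
  move=> ht nq; rewrite /A /G /= => /(St_inj' (arcc_sph _ _) (gs _).2 (@arcc_p0 _ _) (@gp _)) eA.
  exists (arcc k t); last by rewrite eA hg // cbox_id.
  by split; [rewrite eA; exact: (gs q).1|exists t => //; rewrite /arcc clE].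
exists G, H, V, r; split=> //.
- move=> q; apply: (@continuous_comp _ _ _ (g \o cbox r) St).
    apply: (within_comp cg); first exact: cbox_cont.
    exact: (@filterE _ (nbhs q) _ _ dq).
  by apply: St_cont; rewrite gt_eqF //; apply: dot_lt1 => //; [exact: (gs q).2|exact: gp].
- split=> //; split=> //; rewrite /H /= -/P h0; exact: ballxx.
- move=> q [u bq]; split; first exact: cH.
  have nq : nb r (0, 0) (H q) by case: bq => b1 b2; rewrite /nb; move: b1 b2; rewrite /ball /= => /ltW -> /ltW ->.
  by rewrite /G /= cbox_id // /H /= gh ?St_Ti //; exact: inU.
- split=> //.
  + by move=> t q ht nq /(AG _ _ _ ht nq); rewrite hE => -[].
  + by move=> t q ht nq /(AG _ _ _ ht nq); rewrite hF => -[].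
Qed.

Hypothesis NH : non_homotopic_drawing pos arc.

Lemma nrm_inv_cont : continuous (fun q : pl => (nrm p0 q)^-1).
Proof.
move=> q; apply: cvgV; first by rewrite gt_eqF // nrm_gt0.
have f1 : {for q, continuous (fun q : pl => q.1)} by exact: cvg_fst.
have f2 : {for q, continuous (fun q : pl => q.2)} by exact: cvg_snd.
have fz := @wz_cont _ p0 q.
by rewrite /nrm; apply: cvgD; first apply: cvgD; (under eq_fun do rewrite expr2); apply: cvgM.
Qed.

(** As 1 - dot p equals 2 / nrm (St p), points near the pole have images far away. *)
Lemma near_pole (M : R) : exists2 N : set (pt R), nbhs p0 N &
  forall p, N p -> sphere R p -> p <> p0 -> ~~ nb M (0, 0) (St p).
Proof.
have c0 : continuous (fun _ : pl => 0 : R) by move=> x; exact: cst_continuous.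
have [|e e0 he] := @compact_sep R (fun q : pl => (nrm p0 q)^-1) (fun _ => 0) (- M) M (- M) M nrm_inv_cont c0.
  by move=> q _ _ _; rewrite invr_eq0 gt_eqF // nrm_gt0.
exists [set p | `|dot p0 p0 - dot p0 p| < 2 * e].
  have e20 : 0 < 2 * e by lra.
  have B : nbhs (dot p0 p0) (ball (dot p0 p0) (2 * e)) by exact: nbhsx_ballx.
  exact: (@dot_cont _ p0 p0 _ B).
move=> p /= Np spp np; apply/negP => nq.
have := he (St p); move: nq => /nbP /=; rewrite !sub0r !add0r => -[h1 h2 h3 h4].
rewrite h1 h2 h3 h4 lexx => /(_ isT isT isT).
have n0 := nrm_gt0 cp (St p); rewrite gtr0_norm ?invr_gt0 // => h.
have := dot_Ti sp cp (St p); rewrite Ti_St // => ed.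
move: Np; rewrite dot_p0 // ed gtr0_norm; first lra.
by rewrite mulr_gt0 // invr_gt0.
Qed.

Lemma img_sph (a b s : R) : 0 <= a -> b <= 1 -> a <= s <= b -> 0 <= s <= 1.
Proof. by move=> a0 b1 /andP[h1 h2]; apply/andP; split; lra. Qed.

(** Carried over to the sphere, the winding number is locally constant off the curve C, hence
    constant on the component of [Ti x]. The vertex or crossing which that component contains has
    the winding number of x. *)
Lemma A_nonhom e f s1 s2 t1 t2 x : lens_data A e f s1 s2 t1 t2 -> off_lens A e f s1 s2 t1 t2 x ->
  exists q, [/\ (exists v, q = pv v) \/ (exists e f, meets A e f q), off_lens A e f s1 s2 t1 t2 q &
    w_lens A e f s1 s2 t1 t2 q = w_lens A e f s1 s2 t1 t2 x].
Proof.
move=> [ne [s10 s12 s21] [t10 t12 t21] ends_eq meet] [o1 o2].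
have in1 s : s1 <= s <= s2 -> 0 <= s <= 1 by exact: img_sph.
have in2 t : t1 <= t <= t2 -> 0 <= t <= 1 by exact: img_sph.
have l1 : s1 <= s1 <= s2 by rewrite lexx ltW.
have l2 : s1 <= s2 <= s2 by rewrite lexx ltW.
have l3 : t1 <= t1 <= t2 by rewrite lexx ltW.
have l4 : t1 <= t2 <= t2 by rewrite lexx ltW.
have AE g u : 0 <= u <= 1 -> A g u = St (arc g u) by move=> hu; rewrite /A /arcc clE.
have aE g u : 0 <= u <= 1 -> arcc g u = arc g u by move=> hu; rewrite /arcc clE.
pose C := arc e @` Iab s1 s2 `|` arc f @` Iab t1 t2.
have LC : lens_curve arc C.
  exists e, f, s1, s2, t1, t2; do 7!split=> //; split.
    by case: ends_eq => -[/A_arc e1 /A_arc e2]; [left|right]; move: e1 e2; rewrite !aE //; try (by apply: in1); by apply: in2.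
  split=> //; rewrite eqEsubset; split.
    move=> p [[s hs es] [t ht et]].
    have [|e'|e'] := meet s t hs ht; first by rewrite !AE ?es ?et //; [exact: in2|exact: in1].
      by left; rewrite -es e'.
    by right; rewrite -es e'.
  move=> p [->|->]; split; try by [exists s1|exists s2].
    case: ends_eq => -[/A_arc e1 _]; [exists t1|exists t2] => //; move: e1; rewrite !aE //; try (by apply: in1); by apply: in2.
  case: ends_eq => -[_ /A_arc e2]; [exists t2|exists t1] => //; move: e2; rewrite !aE //; try (by apply: in1); by apply: in2.
have offC P : (sphere R `\` C) P -> P <> p0 -> off_lens A e f s1 s2 t1 t2 (St P).
  move=> [sP nC] nP; split=> u hu.
    have hu' := in1 u hu => /(St_inj' (arcc_sph _ _) sP (@arcc_p0 _ _) nP); rewrite aE // => eP.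
    by apply: nC; left; exists u.
  have hu' := in2 u hu => /(St_inj' (arcc_sph _ _) sP (@arcc_p0 _ _) nP); rewrite aE // => eP.
  by apply: nC; right; exists u.
have X0 : (sphere R `\` C) (Ti x).
  split; first exact: Ti_sphere.
  case=> -[u hu eu]; first by apply: (o1 u hu); rewrite AE ?in1 // eu St_Ti.
  by apply: (o2 u hu); rewrite AE ?in2 // eu St_Ti.
(* At the pole, the value is the winding number of all points far away in the plane. *)
pose k P := if `[< P = p0 >] then false else w_lens A e f s1 s2 t1 t2 (St P).
have loc P : (sphere R `\` C) P -> \forall P' \near P, (sphere R `\` C) P' -> k P' = k P.
  move=> CP; have [e0|n0] := pselect (P = p0).
    have [M M0 hM] := closed_far (@A_cont e) (@A_cont f) (ltW s12) (ltW t12) ends_eq.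
    have [N nN hN] := near_pole M.
    rewrite e0; apply: filterS nN => P' NP' [sP' _]; rewrite /k (asboolT (erefl p0)).
    case: asboolP => // nP'; exact: hM (hN _ NP' sP' nP').
  have [q1 q2] := offC P CP n0.
  have [s s0 hs] := closed_near (@A_cont e) (@A_cont f) (ltW s12) (ltW t12) ends_eq q1 q2.
  have N1 : nbhs P (St @^-1` ball (St P) s).
    apply: St_cont; last exact: nbhsx_ballx.
    by rewrite gt_eqF //; apply: dot_lt1 => //; case: CP.
  have N2 : nbhs P (~` [set p0]).
    apply: open_nbhs_nbhs; split=> //; apply: closed_openC; apply: compact_closed; [exact: haus|exact: compact_set1].
  apply: filterS2 N1 N2 => P' [b1 b2] nP' _; rewrite /k; case: asboolP => // _; case: asboolP => // _.
  by apply: hs; rewrite /nb; move: b1 b2; rewrite /ball /= => /ltW -> /ltW ->.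
pose L := connected_component (sphere R `\` C) (Ti x).
have [|P [LP hP]] := NH (L := L); first by exists C, (Ti x).
have CP : (sphere R `\` C) P by exact: connected_component_sub LP.
have nP : P <> p0.
  case: hP => [[v ->]|[e' [f' [_ [[s hs <-] _]]]]]; first exact: pos_p0.
  by apply: arc_p0; exact: inner01.
exists (St P); split; last first.
- have := connected_loc_const (@component_connected _ _ _) (@connected_component_sub _ _ _) loc LP
    (connected_component_refl X0).
  by rewrite /k asboolF // asboolF ?St_Ti //; exact: Ti_p0.
- exact: offC.
- case: hP => [[v ->]|[e' [f' [ne' [h1 h2]]]]]; [left; by exists v|right].
  by exists e', f'; exact: int_meets.
Qed.
End Pole.
End Transfer.

Theorem theorem22 (R : realType) (n : nat) (E : finType)
    (ends : E -> 'I_n * 'I_n) :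
  (3 <= n)%N ->
  loopless ends ->
  connected_graph ends ->
  nonhomotopic_quasiplanar R ends ->
  (#|E| <= 8 * n - 20)%N.
Proof.
move=> n3 nl cg [pos [arc [[D1 [D2 [D3 [D4 [D5 [D6 [D7 [D8 [D9 D10]]]]]]]]] Q NH]]].
have [p0 [sp cp h1 h2]] := pole_ex pos D4 D5.
have [xs xsP] : exists xs : seq (R * R)%type, forall p, p \in xs <-> exists e f, meets (A arc p0) e f p.
  by apply: xs_ex.
have I2 e f p : meets (A arc p0) e f p -> cross arc e f.
  move=> h; have [ne _ _ hP hQ] : [/\ e != f, p = St p0 (Ti p0 p), sphere R (Ti p0 p),
      edge_int arc e (Ti p0 p) & edge_int arc f (Ti p0 p)] by apply: meets_int h.
  by split=> //; exists (Ti p0 p).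
apply: (@plane_count R n E ends (pv pos p0) (A arc p0) _ _ _ _ _ _ xs xsP) => //.
- by move=> e; apply: A_cont.
- by move=> e t t'; apply: A_inj.
- by apply: A0.
- by apply: A1.
- by apply: pv_inj.
- by apply: A_pv.
- by apply: A_no3.
- by apply: A_charts.
- by move=> *; apply: A_nonhom.
- by move=> e f g p q r /I2 k1 /I2 k2 /I2 k3; apply: (Q e f g).
Qed.
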